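(* Let $A$ be a generalized Cartan matrix of affine type and $k\in\mathbb{N}$. Let $R_k(A)$ be the commutative ring of $\mathbb{C}$-valued functions on the finite set $\Sigma_k$, and for $f,g\in R_k(A)$ put $$(f,g):=\frac{1}{|\mathring{P}/(k+\check{h})M|}\sum_{t\in\Sigma_k} f(t)\overline{g(t)}\,\Delta(t).$$ Then: (1) The Hermitian form $(\cdot,\cdot)$ on $R_k(A)$ is an inner product (i.e. it is positive definite). (2) The set of functions $\{\mathring{\chi}_\lambda \mid \lambda\in P_k\}$ is an orthonormal basis of $R_k(A)$ with respect to the inner product $(\cdot,\cdot)$.
   Context: Affine types. $A=X_N^{(r)}$ is a generalized Cartan matrix of affine type in Kac's notation, with vertices $0,1,\dots,n$ in Kac's numbering (untwisted if $r=1$, twisted if $r>1$). $\mathring{\mathfrak{g}}$ is the complex simple Lie algebra generated by the Chevalley generators $e_i,f_i$ ($i=1,\dots,n$) of the Kac-Moody algebra $\mathfrak{g}(A)$ (delete vertex $0$), with Cartan subalgebra $\mathring{\mathfrak{h}}$, and $\check{h}$ is the dual Coxeter number of $\mathfrak{g}(A)$. The types, with (type of $\mathring{\mathfrak{g}}$; $\check{h}$), are: $A_n^{(1)}$, $n\ge1$: $(A_n;n+1)$; $B_n^{(1)}$, $n\ge3$: $(B_n;2n-1)$; $C_n^{(1)}$, $n\ge2$: $(C_n;n+1)$; $D_n^{(1)}$, $n\ge4$: $(D_n;2n-2)$; $E_6^{(1)}$: $(E_6;12)$; $E_7^{(1)}$: $(E_7;18)$; $E_8^{(1)}$: $(E_8;30)$;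 $F_4^{(1)}$: $(F_4;9)$; $G_2^{(1)}$: $(G_2;4)$; $A_{2n}^{(2)}$, $n\ge2$: $(C_n;2n+1)$; $A_{2n-1}^{(2)}$, $n\ge3$: $(C_n;2n)$; $D_{n+1}^{(2)}$, $n\ge3$: $(B_n;2n)$; $E_6^{(2)}$: $(F_4;12)$; $D_4^{(3)}$: $(G_2;6)$. Finite root data of $\mathring{\mathfrak{g}}$. $\mathring{P}$ and $\mathring{Q}$ are the weight and root lattices in $\mathring{\mathfrak{h}}^*$; $\check{\mathring{Q}}\subset\mathring{\mathfrak{h}}$ is the dual lattice of $\mathring{P}$ (coroot lattice) and $\check{\mathring{P}}\subset\mathring{\mathfrak{h}}$ the dual lattice of $\mathring{Q}$ (coweight lattice); $\mathring{P}^+$, $\check{\mathring{P}}^+$ are the dominant weights and coweights; $\mathring{\rho}$, $\check{\mathring{\rho}}$ are the sums of the fundamental weights and of the fundamental coweights; $\theta$ is the highest root; $\mathring{W}$ is the Weyl group with length function $\ell$. Form. When $A=X_N^{(1)}$ or $A=A_{2n}^{(2)}$, $(\cdot|\cdot)$ is the restriction of Kac's normalized invariant form to $\mathring{\mathfrak{h}}$, $\kappa:\mathring{\mathfrak{h}}\to\mathring{\mathfrak{h}}^*$ is the induced isomorphism, and $(\cdot|\cdot)$ also denotes the form transported to $\mathring{\mathfrak{h}}^*$. Concretely it is the $\mathring{W}$-invariant form with $(\theta|\theta)=2$ if $A=X_N^{(1)}$ and $(\theta|\theta)=4$ if $A=A_{2n}^{(2)}$. $M$ and $\check{\theta}$.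 If $A=X_N^{(1)}$ or $A=A_{2n}^{(2)}$: $M=\kappa(\check{\mathring{Q}})$ and $\check{\theta}=\kappa^{-1}(\theta)$. Otherwise: $M=\mathring{Q}$ and $\check{\theta}$ is the highest coroot of $\mathring{\mathfrak{g}}$ (the highest root of the dual root system). Level $k$. $P_k=\{\lambda\in\mathring{P}^+ : \langle\lambda,\check{\theta}\rangle\le k\}$ and $\check{P}_k=\{\check{\lambda}\in\check{\mathring{P}}^+ : \langle\check{\lambda},\theta\rangle\le k\}$. Let $\mathring{T}=\mathrm{Hom}(\mathring{P},\mathbb{C}^\times)$; for $\mu\in\mathring{P}$, $t\in\mathring{T}$ write $\mu(t):=t(\mu)$. If $A=X_N^{(1)}$ or $A=A_{2n}^{(2)}$, $\Sigma_k=\{e^{\frac{2\pi i}{k+\check{h}}(\mathring{\rho}+\lambda|\cdot)}\in\mathring{T} : \lambda\in P_k\}$; otherwise $\Sigma_k=\{e^{\frac{2\pi i}{k+\check{h}}\langle\check{\mathring{\rho}}+\check{\lambda},\cdot\rangle}\in\mathring{T} : \check{\lambda}\in\check{P}_k\}$. Functions. For $\lambda\in P_k$, $t\in\Sigma_k$: $J_\lambda(t)=\sum_{w\in\mathring{W}}(-1)^{\ell(w)}\,w(\lambda+\mathring{\rho})(t)$, $\mathring{\chi}_\lambda(t)=J_\lambda(t)/J_0(t)$ (by the Weyl character formula, the trace of $t$ on the irreducible representation $\mathring{V}_\lambda$ of $\mathring{\mathfrak{g}}$ of highest weight $\lambda$), and $\Delta(t)=|J_0(t)|^2$. *)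

(* Defs.v *)
From mathcomp Require Import all_boot all_order all_algebra.
From mathcomp Require Import all_classical all_reals all_analysis.
From mathcomp Require Import finmap complex.

Set Implicit Arguments.
Unset Strict Implicit.
Unset Printing Implicit Defensive.

Import Order.TTheory GRing.Theory Num.Theory.

Local Open Scope classical_set_scope.
Local Open Scope ring_scope.
Local Open Scope complex_scope.

(* Affine types, in Kac's notation.  The constructor for X_N^(r) is named     *)
(* X_r; the argument n is the rank, so that the vertices are 0, 1, ..., n.    *)
Inductive affine_type : Type :=
| A_1 (n : nat) of (1 <= n)%N
| B_1 (n : nat) of (3 <= n)%N
| C_1 (n : nat) of (2 <= n)%N
| D_1 (n : nat) of (4 <= n)%N
| E6_1
| E7_1
| E8_1
| F4_1
| G2_1
| Aeven_2 (n : nat) of (2 <= n)%N (* A_{2n}^(2) *)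
| Aodd_2 (n : nat) of (3 <= n)%N  (* A_{2n-1}^(2) *)
| D_2 (n : nat) of (3 <= n)%N     (* D_{n+1}^(2) *)
| E6_2
| D4_3.

Definition affine_rank (X : affine_type) : nat :=
  match X with
  | A_1 n _ | B_1 n _ | C_1 n _ | D_1 n _ => n
  | E6_1 => 6
  | E7_1 => 7
  | E8_1 => 8
  | F4_1 => 4
  | G2_1 => 2
  | Aeven_2 n _ | Aodd_2 n _ | D_2 n _ => n
  | E6_2 => 4
  | D4_3 => 2
  end.

Definition dual_coxeter (X : affine_type) : nat :=
  match X with
  | A_1 n _ => n.+1
  | B_1 n _ => (2 * n - 1)%N
  | C_1 n _ => n.+1
  | D_1 n _ => (2 * n - 2)%N
  | E6_1 => 12
  | E7_1 => 18
  | E8_1 => 30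
  | F4_1 => 9
  | G2_1 => 4
  | Aeven_2 n _ => (2 * n).+1
  | Aodd_2 n _ => (2 * n)%N
  | D_2 n _ => (2 * n)%N
  | E6_2 => 12
  | D4_3 => 6
  end.

(* A bond (i, j, m) joins i and j by m lines, with an arrow pointing towards  *)
(* j when m > 1; it contributes -1 to a_ij and -m to a_ji.                    *)
Definition bond : Type := (nat * nat * nat)%type.

Definition chain (p q : nat) : seq bond :=
  [seq (i, i.+1, 1%N) | i <- iota p (q - p)].

(* For A_1^(1) the closed chain below has the two bonds 0 - 1 and 1 - 0, whose *)
(* contributions add up to a_01 = a_10 = -2.                                  *)
Definition dynkin_diagram (X : affine_type) : seq bond :=
  match X with
  | A_1 n _ => (n, 0, 1)%N :: chain 0 n
  | B_1 n _ => [:: (0, 2, 1)%N, (n.-1, n, 2)%N & chain 1 n.-1]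
  | C_1 n _ => [:: (0, 1, 2)%N, (n, n.-1, 2)%N & chain 1 n.-1]
  | D_1 n _ => [:: (0, 2, 1)%N, (n.-2, n, 1)%N & chain 1 n.-1]
  | E6_1 => [:: (0, 6, 1)%N, (3, 6, 1)%N & chain 1 5]
  | E7_1 => (3, 7, 1)%N :: chain 0 6
  | E8_1 => (5, 8, 1)%N :: chain 0 7
  | F4_1 => [:: (0, 1, 1); (1, 2, 1); (2, 3, 2); (3, 4, 1)]%N
  | G2_1 => [:: (0, 1, 1); (1, 2, 3)]%N
  | Aeven_2 n _ => [:: (1, 0, 2)%N, (n, n.-1, 2)%N & chain 1 n.-1]
  | Aodd_2 n _ => [:: (0, 2, 1)%N, (n, n.-1, 2)%N & chain 1 n.-1]
  | D_2 n _ => [:: (1, 0, 2)%N, (n.-1, n, 2)%N & chain 1 n.-1]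
  | E6_2 => [:: (0, 1, 1); (1, 2, 1); (3, 2, 2); (3, 4, 1)]%N
  | D4_3 => [:: (0, 1, 1); (2, 1, 3)]%N
  end.

Definition bond_entry (d : seq bond) (i j : nat) : int :=
  if i == j then 2%:Z
  else - (sumn [seq ((b.1 == (i, j)) + (b.1 == (j, i)) * b.2)%N | b <- d])%:Z.

(* a_ij = <alpha_i^vee, alpha_j> *)
Definition gcm (X : affine_type) : 'M[int]_((affine_rank X).+1) :=
  \matrix_(i, j) bond_entry (dynkin_diagram X) i j.

(* vertex 0 deleted: vertex i.+1 becomes row and column i *)
Definition cartan (X : affine_type) : 'M[int]_(affine_rank X) :=
  row' ord0 (col' ord0 (gcm X)).

(* Root data of a finite Cartan matrix A.                                     *)
(* - The weight lattice P is 'rV[int]_n in the basis of fundamental weights,  *)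
(*   and the dual space of the Cartan subalgebra is 'rV[rat]_n in that basis  *)
(*   (all the data used below are rational).                                  *)
(* - The Cartan subalgebra is 'rV[rat]_n in the basis of simple coroots; it   *)
(*   is dual to the basis of fundamental weights, so the pairing is the dot   *)
(*   product, and the coroot lattice consists of the integral vectors.        *)
(* - The coweight lattice is 'rV[int]_n in the basis of fundamental           *)
(*   coweights; see coweight for its embedding in the Cartan subalgebra.      *)
Definition toQ n (x : 'rV[int]_n) : 'rV[rat]_n := map_mx intr x.

Definition pairing n (l h : 'rV[rat]_n) : rat := \sum_i l 0 i * h 0 i.

(* alpha_i = \sum_j a_ji omega_j *)
Definition simple_root n (A : 'M[int]_n) (i : 'I_n) : 'rV[int]_n :=
  \row_j A j i.

Definition root_lattice n (A : 'M[int]_n) : set 'rV[int]_n :=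
  [set x | exists c : 'I_n -> int, x = \sum_i simple_root A i *~ c i].

Definition positive_root_cone n (A : 'M[int]_n) : set 'rV[int]_n :=
  [set x | exists c : 'I_n -> nat, x = \sum_i simple_root A i *+ c i].

(* omega_i^vee = \sum_j (A^-1)_ij alpha_j^vee *)
Definition coweight n (A : 'M[int]_n) (m : 'rV[int]_n) : 'rV[rat]_n :=
  toQ m *m invmx (map_mx intr A).

(* Both for weights and for coweights, in fundamental coordinates.            *)
Definition dominant n (x : 'rV[int]_n) : Prop := forall i, 0 <= x 0 i.

Definition sum_fundamental n : 'rV[int]_n := const_mx 1.

(* x *m simple_refl A i = x - <x, alpha_i^vee> alpha_i; the Weyl group acts   *)
(* on P by right multiplication on row vectors.                               *)
Definition simple_refl n (A : 'M[int]_n) (i : 'I_n) : 'M[int]_n :=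
  1%:M - delta_mx i (0 : 'I_1) *m simple_root A i.

Definition word_refl n (A : 'M[int]_n) (s : seq 'I_n) : 'M[int]_n :=
  \big[mulmx/1%:M]_(i <- s) simple_refl A i.

Definition weyl n (A : 'M[int]_n) : set 'M[int]_n := range (word_refl A).
Arguments weyl {n} A _.

Definition weyl_length n (A : 'M[int]_n) (w : 'M[int]_n) : nat :=
  xget 0%N [set m | (exists2 s : seq 'I_n, word_refl A s = w & size s = m) /\
                    (forall s : seq 'I_n, word_refl A s = w -> m <= size s)%N].

Definition root_system n (A : 'M[int]_n) : set 'rV[int]_n :=
  [set x | exists i, exists2 w, weyl A w & x = simple_root A i *m w].
Arguments root_system {n} A _.

Definition highest_root n (A : 'M[int]_n) : 'rV[int]_n :=
  xget 0 [set x | root_system A x /\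
                  forall y, root_system A y -> positive_root_cone A (x - y)].

(* The dual root system has Cartan matrix A^T, and its weight lattice is the  *)
(* coweight lattice of A.                                                     *)
Definition highest_coroot n (A : 'M[int]_n) : 'rV[rat]_n :=
  coweight A (highest_root A^T).

(* A bilinear form on the dual of the Cartan subalgebra is given by its Gram  *)
(* matrix in the basis of fundamental weights.                                *)
Definition bilin n (B : 'M[rat]_n) (l m : 'rV[rat]_n) : rat :=
  (l *m B *m m^T) 0 0.

Definition normalized_invariant_form n (A : 'M[int]_n) (c : rat)
    (B : 'M[rat]_n) : Prop :=
  [/\ B^T = B,
      forall w, weyl A w -> forall l m : 'rV[rat]_n,
        bilin B (l *m map_mx intr w) (m *m map_mx intr w) = bilin B l m
    & bilin B (toQ (highest_root A)) (toQ (highest_root A)) = c].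

(* X_N^(1) or A_{2n}^(2) *)
Definition untwisted_or_Aeven (X : affine_type) : bool :=
  match X with
  | Aodd_2 _ _ | D_2 _ _ | E6_2 | D4_3 => false
  | _ => true
  end.

Definition theta_norm (X : affine_type) : rat :=
  match X with Aeven_2 _ _ => 4 | _ => 2 end.

(* Only used when untwisted_or_Aeven X.                                       *)
Definition form_mx (X : affine_type) : 'M[rat]_(affine_rank X) :=
  xget 0 [set B | normalized_invariant_form (cartan X) (theta_norm X) B].

(* pairing l (kappa_inv m) = (l|m) *)
Definition kappa_inv (X : affine_type) (m : 'rV[rat]_(affine_rank X)) :
  'rV[rat]_(affine_rank X) := m *m form_mx X.

Definition kappa (X : affine_type) (h : 'rV[rat]_(affine_rank X)) :
  'rV[rat]_(affine_rank X) := h *m invmx (form_mx X).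

Definition latM (X : affine_type) : set 'rV[rat]_(affine_rank X) :=
  if untwisted_or_Aeven X then @kappa X @` range (@toQ (affine_rank X))
  else @toQ (affine_rank X) @` root_lattice (cartan X).
Arguments latM X _ : clear implicits.

Definition theta (X : affine_type) : 'rV[rat]_(affine_rank X) :=
  toQ (highest_root (cartan X)).

Definition theta_check (X : affine_type) : 'rV[rat]_(affine_rank X) :=
  if untwisted_or_Aeven X then kappa_inv (theta X)
  else highest_coroot (cartan X).

Definition Pk (X : affine_type) (k : nat) : set 'rV[int]_(affine_rank X) :=
  [set l | dominant l /\ pairing (toQ l) (theta_check X) <= k%:R].
Arguments Pk X k _ : clear implicits.

Definition Pk_check (X : affine_type) (k : nat) : set 'rV[int]_(affine_rank X) :=
  [set m | dominant m /\ pairing (theta X) (coweight (cartan X) m) <= k%:R].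
Arguments Pk_check X k _ : clear implicits.

(* |P / (k + h^vee) M|, as the number of cosets *)
Definition card_quotient (X : affine_type) (k : nat) : nat :=
  #|` fset_set [set [set toQ x + (k + dual_coxeter X)%:R *: m | m in latM X]
               | x in [set: 'rV[int]_(affine_rank X)]]|.

Definition expi (R : realType) (x : R) : R[i] := (cos x +i* sin x)%C.

(* exp (2 pi i q / (k + h^vee)) *)
Definition level_exp (R : realType) (X : affine_type) (k : nat) (q : rat) :
  R[i] := expi (2 * pi / (k + dual_coxeter X)%:R * ratr q).

(* Hom(P, C^x) *)
Definition is_character (R : realType) n (t : 'rV[int]_n -> R[i]) : Prop :=
  (forall x, t x != 0) /\ (forall x y, t (x + y) = t x * t y).

Notation torus R n :=
  (set_type [set t : 'rV[int]_n -> R[i] | is_character t]).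

Definition torus_val (R : realType) n (t : torus R n) (x : 'rV[int]_n) : R[i] :=
  val t x.

Definition Sigma (R : realType) (X : affine_type) (k : nat) :
    set (torus R (affine_rank X)) :=
  let rho := sum_fundamental (affine_rank X) in
  if untwisted_or_Aeven X then
    [set t | exists2 l, Pk X k l & forall x,
       torus_val t x =
       level_exp R X k (bilin (form_mx X) (toQ (rho + l)) (toQ x))]
  else
    [set t | exists2 m, Pk_check X k m & forall x,
       torus_val t x =
       level_exp R X k (pairing (toQ x) (coweight (cartan X) (rho + m)))].
Arguments Sigma R X k _ : clear implicits.

Definition J (R : realType) (X : affine_type) (l : 'rV[int]_(affine_rank X))
    (t : torus R (affine_rank X)) : R[i] :=
  \sum_(w \in weyl (cartan X))
    (-1) ^+ weyl_length (cartan X) w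
      * torus_val t ((l + sum_fundamental (affine_rank X)) *m w).

Definition Delta (R : realType) (X : affine_type) (t : torus R (affine_rank X)) :
  R[i] := `|J 0 t| ^+ 2.

Notation Rk R X k := (set_type (Sigma R X k) -> R[i]).

Definition chi (R : realType) (X : affine_type) (k : nat)
    (l : 'rV[int]_(affine_rank X)) : Rk R X k :=
  fun t => J l (val t) / J 0 (val t).

Definition Rk_form (R : realType) (X : affine_type) (k : nat)
    (f g : Rk R X k) : R[i] :=
  (card_quotient X k)%:R^-1 *
  \sum_(t \in [set: set_type (Sigma R X k)])
    f t * Num.conj (g t) * Delta (val t).

Definition is_inner_product (C : numClosedFieldType) (V : lmodType C)
    (form : V -> V -> C) : Prop :=
  exists phi : {dot V for (@Num.conj C)}, forall u v, phi u v = form u v.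

Definition is_basis (C : numClosedFieldType) (V : lmodType C) (I : choiceType)
    (S : set I) (v : I -> V) : Prop :=
  [/\ forall c : I -> C, finite_set (S `&` [set i | c i != 0]) ->
        \sum_(i \in S) c i *: v i = 0 -> forall i, S i -> c i = 0
    & forall u : V, exists2 c : I -> C, finite_set (S `&` [set i | c i != 0]) &
        u = \sum_(i \in S) c i *: v i].

Definition is_orthonormal (C : numClosedFieldType) (V : lmodType C) (I : choiceType)
    (form : V -> V -> C) (S : set I) (v : I -> V) : Prop :=
  forall i j, S i -> S j -> form (v i) (v j) = (i == j)%:R.

(* Main.v *)
(* With N = k + h^vee, the weights lambda + rho, lambda in P_k, and the labels  *)
(* of the points of Sigma_k are the lattice points of open alcoves of two       *)
(* affine Weyl groups, acting on lattices P and L in duality modulo N.  The     *)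
(* alternating sums J are invariant up to sign, and vanish at points with a     *)
(* nontrivial stabilizer; as each free orbit meets the alcove exactly once,     *)
(* Fourier inversion on the finite group P/NM gives                             *)
(*   sum_{t in Sigma_k} J_lambda(t) conj(J_mu(t)) = |P/NM| delta_{lambda,mu}.   *)
(* The roles of P and L are symmetric, so the rows of the matrix (J_lambda(t))  *)
(* are orthogonal as well as its columns, whence the spanning property.  If     *)
(* J_0(t) vanished, multiplying by orbit sums would show inductively that all   *)
(* J_lambda(t) vanish, contradicting this orthogonality.                        *)
(*   That the alcove is a fundamental domain on which the group acts freely is  *)
(* proved by rewriting: reflect a point in a wall that it violates.  This       *)
(* terminates, since the distance to an interior point of the alcove decreases, *)
(* and it is locally confluent by computation in the dihedral groups of rank 2; *)
(* Newman's lemma makes the normal form unique.                                 *)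
Require Import Defs.
From HB Require Import structures.
From mathcomp Require Import all_boot all_order all_algebra.
From mathcomp Require Import all_classical all_reals all_analysis.
From mathcomp Require Import complex.
From mathcomp Require Import zify ring lra.

Set Implicit Arguments.
Unset Strict Implicit.
Unset Printing Implicit Defensive.
Import Order.TTheory GRing.Theory Num.Theory.
Local Open Scope ring_scope.
Local Open Scope complex_scope.

(** With N = k + h^vee, both families of types are instances of the record [duality]: two lattices
    paired by F, a finite Weyl group on each, adjoint to one another, and on each an open alcove of
    the affine group generated by the Weyl group and N times the lattice dual to the other one. For
    X_N^(1) and A_{2n}^(2) both lattices are P, paired by the normalized form; for the other types
    they are P and the coweight lattice. A point of Sigma_k is a character psi(., l) with l in the
    second alcove, and J_lambda is the alternating sum [alt_sum] at lambda + rho.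

    Over a finite quotient of the second lattice, the products J_x conj(J_y) are summed by
    orthogonality of characters ([sum_alt_sum_box]). Such a product is invariant under the affine
    group and vanishes at points fixed by an element of determinant -1, so the same sum is a
    multiple of the sum over the alcove ([sum_box_orbits]). Comparing the two gives
    [alt_sum_orthogonal], the orthonormality of the chi_lambda. Exchanging the lattices gives
    orthogonality of the columns, whence the chi_lambda span. That J_rho has no zero on Sigma_k
    ([alt_sum_rho_neq0]) makes Delta positive and lets it cancel the denominators of the chi_lambda.

    The affine group enters through [alcove_data]: it acts freely on the alcove ([in_alcove_free]),
    and every point is either in the orbit of an alcove point or fixed by an element of determinant
    -1 ([alcove_representative]). Both come from an abstract rewriting system ([sys_act_free],
    [sys_act_to_dominant]), whose hypotheses follow from a positive definite invariant form
    ([finite_datum_exists]): strict Cauchy-Schwarz bounds the rank two entries, and the distance to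
    an interior point decreases. The highest root is recognized from its marks ([highest_rootE]),
    which [bond_check] certifies for each type. Since the comarks of theta add up to h^vee - 1,
    shifting by rho turns P_k into the open alcove at N ([shifted_level]). *)

(** * Rewriting by reflections *)

(* The off-diagonal entries whose dihedral group is finite, of order 4, 6, 8 or *)
(* 12.                                                                          *)
Definition rank2_finite (p q : int) : bool :=
  (p, q) \in [:: (0, 0); (-1, -1); (-1, -2); (-2, -1); (-1, -3); (-3, -1)].

Section ReflectionSystem.
Variables (I : finType) (E : zmodType) (al : I -> E) (lev : I -> E -> int).
Variables (a : I -> I -> int) (mu : E -> nat).

Definition sys_refl i x := x - al i *~ lev i x.
(* In a pair of points moved together, the first one decides which reflections  *)
(* may be applied, and the second one keeps track of the group element.         *)
Definition sys_refl2 i (p : E * E) := (sys_refl i p.1, sys_refl i p.2).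

Hypothesis lev_shift : forall i j x c, lev i (x - al j *~ c) = lev i x - c * a i j.
Hypothesis a_diag : forall i, a i i = 2.
Hypothesis a_rank2 : forall i j, i != j ->
  rank2_finite (a i j) (a j i) \/ forall x, lev i x <= 0 -> lev j x <= 0 -> False.
Hypothesis mu_decr : forall i x, lev i x < 0 -> (mu (sys_refl i x) < mu x)%N.

Inductive climbs : E * E -> E * E -> Prop :=
| climbs_refl p : climbs p p
| climbs_step i p q : lev i p.1 < 0 -> climbs (sys_refl2 i p) q -> climbs p q.

Definition at_top (p : E * E) := forall i, 0 <= lev i p.1.

Lemma climbs_trans p q r : climbs p q -> climbs q r -> climbs p r.
Proof. by elim=> // i {}p {}q lp _ IH /IH; apply: climbs_step. Qed.

Lemma climbs_at_top p q : climbs p q -> at_top p -> q = p.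
Proof. by case=> // i {}p {}q lp _ /(_ i); rewrite leNgt lp. Qed.

Lemma climbs_mu p q : climbs p q -> (mu q.1 <= mu p.1)%N.
Proof.
elim=> // i {}p {}q lp _ /leq_trans; apply.
exact: ltnW (mu_decr lp).
Qed.

Lemma climbs_to_top p : exists2 q, climbs p q & at_top q.
Proof.
have [k] := ubnP (mu p.1); elim: k p => // k IH p mup.
case: (pickP (fun i => lev i p.1 < 0)) => [i lip|lp]; last first.
  by exists p; [exact: climbs_refl | move=> i; rewrite leNgt lp].
have [|q pq topq] := IH (sys_refl2 i p).
  by apply: leq_trans (mu_decr lip) _; rewrite -ltnS.
by exists q => //; apply: climbs_step pq.
Qed.

Section RankTwo.
Variables i j : I.
(** Coordinates on the coset of x modulo the span of [al i] and [al j]. Both reflections are affine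
    in c, so braid relations become integer identities within reach of [lia]. *)
Let T x (c : int * int) := x - al i *~ c.1 - al j *~ c.2.

Let T0 x : x = T x (0, 0).
Proof. by rewrite /T /= !mulr0z !subr0. Qed.

Let lev1 x c : lev i (T x c) = lev i x - c.1 * 2 - c.2 * a i j.
Proof. by rewrite /T !lev_shift a_diag. Qed.

Let lev2 x c : lev j (T x c) = lev j x - c.1 * a j i - c.2 * 2.
Proof. by rewrite /T !lev_shift a_diag. Qed.

Let refl1 x c : sys_refl i (T x c) = T x (lev i x - c.1 - c.2 * a i j, c.2).
Proof.
rewrite /sys_refl lev1 /T /= [x - _ - _ - _]addrAC; congr (_ - _).
by rewrite -addrA -opprD -mulrzDr; congr (_ - _ *~ _); ring.
Qed.

Let refl2 x c : sys_refl j (T x c) = T x (c.1, lev j x - c.2 - c.1 * a j i).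
Proof.
rewrite /sys_refl lev2 /T /= -addrA -opprD -mulrzDr.
by congr (_ - _ *~ _); ring.
Qed.

Let refl1_0 x : sys_refl i x = T x (lev i x, 0).
Proof. by rewrite {1}(T0 x) refl1 mul0r !subr0. Qed.

Let refl2_0 x : sys_refl j x = T x (0, lev j x).
Proof. by rewrite {1}(T0 x) refl2 mul0r !subr0. Qed.

Let climb12 x z :
  (forall c c' r, lev i x - c.1 * 2 - c.2 * a i j < 0 ->
    climbs (T x (lev i x - c.1 - c.2 * a i j, c.2),
            T z (lev i z - c'.1 - c'.2 * a i j, c'.2)) r ->
    climbs (T x c, T z c') r) *
  (forall c c' r, lev j x - c.1 * a j i - c.2 * 2 < 0 ->
    climbs (T x (c.1, lev j x - c.2 - c.1 * a j i),
            T z (c'.1, lev j z - c'.2 - c'.1 * a j i)) r ->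
    climbs (T x c, T z c') r).
Proof.
split=> c c' r lc cr.
  by apply: (@climbs_step i); [rewrite lev1 | rewrite /sys_refl2 !refl1].
by apply: (@climbs_step j); [rewrite lev2 | rewrite /sys_refl2 !refl2].
Qed.

Ltac up H := apply: (H); [rewrite /=; lia|].

(** The two alternating words of length 2, 3, 4 or 6, according to the order of the dihedral group,
    consist of climbing steps only, and they agree by the braid relation. It holds for the second
    components too, whose levels are unconstrained. *)
Lemma climbs_join2 p :
    rank2_finite (a i j) (a j i) -> lev i p.1 < 0 -> lev j p.1 < 0 ->
  exists2 r, climbs (sys_refl2 i p) r & climbs (sys_refl2 j p) r.
Proof.
case: p => x z /= + li lj; have [step1 step2] := climb12 x z.
have stop c c' d d' : c = d -> c' = d' -> climbs (T x c, T z c') (T x d, T z d').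
  by move=> -> ->; apply: climbs_refl.
rewrite /sys_refl2 /= !refl1_0 !refl2_0.
set u := lev i x in li lj step1 step2 *; set v := lev j x in lj step1 step2 *.
set u' := lev i z in step1 step2 *; set v' := lev j z in step1 step2 *.
move: (a i j) (a j i) step1 step2 => p q step1 step2.
rewrite /rank2_finite !inE => /or4P[|||/or3P[]] /eqP [? ?]; subst p q.
- eexists; [by up step2; apply: climbs_refl|].
  by up step1; apply: stop => /=; congr pair; lia.
- eexists; [by up step2; up step1; apply: climbs_refl|].
  by up step1; up step2; apply: stop => /=; congr pair; lia.
- eexists; [by up step2; up step1; up step2; apply: climbs_refl|].
  by up step1; up step2; up step1; apply: stop => /=; congr pair; lia.
- eexists; [by up step2; up step1; up step2; apply: climbs_refl|].
  by up step1; up step2; up step1; apply: stop => /=; congr pair; lia.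
- eexists; [by up step2; up step1; up step2; up step1; up step2; apply: climbs_refl|].
  by up step1; up step2; up step1; up step2; up step1; apply: stop => /=; congr pair; lia.
- eexists; [by up step2; up step1; up step2; up step1; up step2; apply: climbs_refl|].
  by up step1; up step2; up step1; up step2; up step1; apply: stop => /=; congr pair; lia.
Qed.

(* Walls persist under climbing, so the orbit of a strictly dominant point      *)
(* avoids all of them.                                                          *)
Lemma climbs_wall2 p : rank2_finite (a i j) (a j i) -> lev i p.1 = 0 ->
    lev j p.1 < 0 ->
  exists2 r, climbs (sys_refl2 j p) r & lev i r.1 = 0 \/ lev j r.1 = 0.
Proof.
case: p => x z /= + li lj; have [step1 step2] := climb12 x z.
rewrite /sys_refl2 /= !refl2_0;
move: (lev1 x) (lev2 x) step1 step2; rewrite li => lev1x lev2x.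
move: lj lev1x lev2x; set v := lev j x; set u' := lev i z; set v' := lev j z.
move: (a i j) (a j i) => p q lj lev1x lev2x step1 step2.
rewrite /rank2_finite !inE => /or4P[|||/or3P[]] /eqP [? ?]; subst p q.
- eexists; first by apply: climbs_refl.
  by rewrite /= lev1x lev2x /=; lia.
- eexists; first by up step1; apply: climbs_refl.
  by rewrite /= lev1x lev2x /=; lia.
- eexists; first by up step1; up step2; apply: climbs_refl.
  by rewrite /= lev1x lev2x /=; lia.
- eexists; first by up step1; up step2; apply: climbs_refl.
  by rewrite /= lev1x lev2x /=; lia.
- eexists; first by up step1; up step2; up step1; up step2; apply: climbs_refl.
  by rewrite /= lev1x lev2x /=; lia.
- eexists; first by up step1; up step2; up step1; up step2; apply: climbs_refl.
  by rewrite /= lev1x lev2x /=; lia.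
Qed.
End RankTwo.

Lemma climbs_join p i j : lev i p.1 < 0 -> lev j p.1 < 0 ->
  exists2 r, climbs (sys_refl2 i p) r & climbs (sys_refl2 j p) r.
Proof.
move=> li lj; have [<-|nij] := eqVneq i j.
  by exists (sys_refl2 i p); apply: climbs_refl.
by have [fin|/(_ p.1 (ltW li) (ltW lj))//] := a_rank2 nij; apply: climbs_join2.
Qed.

(** Newman's lemma, by induction on the measure [mu]. *)
Lemma climbs_unique p q r :
  climbs p q -> at_top q -> climbs p r -> at_top r -> q = r.
Proof.
have [k] := ubnP (mu p.1); elim: k p q r => // k IH p q r.
move=> + pq; case: p q / pq => [p _ topp pr _|i p q li piq mup topq pr].
  by rewrite (climbs_at_top pr topp).
case: p r / pr li piq mup => [p li _ _ /(_ i)|j p r lj pjr li piq mup topr].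
  by rewrite leNgt li.
have [s pis pjs] := climbs_join li lj; have [t st topt] := climbs_to_top s.
have mui l : lev l p.1 < 0 -> (mu (sys_refl2 l p).1 < k)%N.
  by move=> ll; apply: leq_trans (mu_decr ll) _; rewrite -ltnS.
rewrite (IH _ q t (mui i li) piq topq (climbs_trans pis st) topt).
exact: IH (mui j lj) (climbs_trans pjs st) topt pjr topr.
Qed.

(** By uniqueness of the top, q is also reached along the path of [climbs_wall2], on which some
    level is again zero. *)
Lemma climbs_wall p q :
  climbs p q -> at_top q -> (exists i, lev i p.1 = 0) -> exists i, lev i q.1 = 0.
Proof.
have [k] := ubnP (mu p.1); elim: k p => // k IH p mup pq topq [i li].
case: (pickP (fun j => lev j p.1 < 0)) => [j lj|lp]; last first.
  by rewrite (climbs_at_top pq) => [|l]; [exists i | rewrite leNgt lp].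
have nij : i != j by apply: contraTneq lj => <-; rewrite li.
have [fin|] := a_rank2 nij; last by move/(_ p.1); rewrite li (ltW lj) => /(_ _ _)[].
have [r pjr wallr] := climbs_wall2 fin li lj.
have [t rt topt] := climbs_to_top r.
have qt : q = t.
  exact: climbs_unique pq topq (climbs_step lj (climbs_trans pjr rt)) topt.
rewrite -qt in rt; apply: (IH r) => //.
  apply: leq_ltn_trans (climbs_mu pjr) _.
  by apply: leq_trans (mu_decr lj) _; rewrite -ltnS.
by case: wallr; [exists i | exists j].
Qed.

Definition sys_act (g : seq I) x := foldr sys_refl x g.

Lemma sys_reflK i : involutive (sys_refl i).
Proof.
move=> x; rewrite /sys_refl lev_shift a_diag -addrA -opprD -mulrzDr.
by rewrite (_ : _ + _ = 0 :> int) ?mulr0z ?subr0 //; ring.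
Qed.

Lemma lev_sys_refl i x : lev i (sys_refl i x) = - lev i x.
Proof. by rewrite /sys_refl lev_shift a_diag; ring. Qed.

(** Induction on the word: a new letter is either a climbing step, absorbed by uniqueness of the
    top, or the inverse of one. It can meet a wall only if z = y, and then it acts trivially on both
    components. *)
Lemma sys_act_climbs y z g :
    (forall i, 0 <= lev i y) -> z = y \/ (forall i, lev i y != 0) ->
  climbs (sys_act g y, sys_act g z) (y, z).
Proof.
move=> topy free; elim: g => [|i g IH] /=; first exact: climbs_refl.
set p := (_, _) in IH; rewrite -/(sys_refl2 i p).
have topyz : at_top (y, z) by [].
have [li|li|li] := ltgtP (lev i p.1) 0; last 1 first.
- case: free => [eyz|free]; last first.
    have [j /= lj] := climbs_wall IH topyz (ex_intro _ i li).
    by have := free j; rewrite lj.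
  subst z; rewrite /= in li; rewrite /sys_refl2 /sys_refl /= li mulr0z subr0.
  exact: IH.
- have [t it topt] := climbs_to_top (sys_refl2 i p).
  by have -> := climbs_unique IH topyz (climbs_step li it) topt.
- apply: (@climbs_step i); first by rewrite /= lev_sys_refl oppr_lt0.
  by rewrite /sys_refl2 /= !sys_reflK.
Qed.

Lemma sys_act_dominant g y : (forall i, 0 <= lev i y) ->
  (forall i, 0 <= lev i (sys_act g y)) -> sys_act g y = y.
Proof.
move=> topy topgy; have := sys_act_climbs g topy (or_introl (erefl y)).
by move/climbs_at_top => /(_ topgy) [].
Qed.

(** As the second component z of the pair is arbitrary, the whole group element is trivial and not
    just its effect on y. *)
Lemma sys_act_free g y : (forall i, 0 < lev i y) ->
  (forall i, 0 <= lev i (sys_act g y)) -> sys_act g =1 id.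
Proof.
move=> posy topgy z.
have free : z = y \/ (forall i, lev i y != 0) by right=> i; rewrite gt_eqF.
have := sys_act_climbs g (fun i => ltW (posy i)) free.
by move/climbs_at_top => /(_ topgy) [].
Qed.

Lemma sys_act_to_dominant y : exists g, forall i, 0 <= lev i (sys_act g y).
Proof.
have [q + topq] := climbs_to_top (y, y).
have [g] : exists g, (y, y).1 = sys_act g y by exists [::].
move: (y, y) => p + pq; elim: pq topq g => {p q} [p topp|i p q li _ IH topq] g pg.
  by exists g; rewrite -pg.
by apply: (IH topq (i :: g)); rewrite /= pg.
Qed.

End ReflectionSystem.

(** * Weyl groups of integer matrices *)

(** Two block triangular factorizations of the matrix with blocks 1, u, v, 1. *)
Lemma det_1_sub_mul (R : comNzRingType) n (u : 'cV[R]_n) (v : 'rV[R]_n) :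
  \det (1%:M - u *m v) = 1 - (v *m u) 0 0.
Proof.
have detD : \det (block_mx 1%:M u v (1%:M : 'M[R]_1)) = \det (1%:M - u *m v).
  rewrite (_ : block_mx _ _ _ _ =
    block_mx (1%:M - u *m v) u 0 1%:M *m block_mx 1%:M 0 v 1%:M); last first.
    by rewrite mulmx_block !mulmx1 !mul1mx ?mul0mx ?mulmx0 ?add0r ?addr0 ?subrK.
  by rewrite det_mulmx det_ublock det_lblock !det1 !mulr1.
rewrite -detD (_ : block_mx _ _ _ _ =
  block_mx 1%:M 0 v 1%:M *m block_mx 1%:M u 0 (1%:M - v *m u)); last first.
  by rewrite mulmx_block !mulmx1 !mul1mx ?mul0mx ?mulmx0 ?addr0 addrC subrK.
by rewrite det_mulmx det_ublock det_lblock !det1 !mul1r det_mx11 !mxE.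
Qed.

Section ToQ.
Variable n : nat.
Implicit Types x y : 'rV[int]_n.

Lemma toQ0 : toQ (0 : 'rV[int]_n) = 0.
Proof. exact: map_mx0. Qed.

Lemma toQD x y : toQ (x + y) = toQ x + toQ y.
Proof. exact: map_mxD. Qed.

Lemma toQN x : toQ (- x) = - toQ x.
Proof. exact: map_mxN. Qed.

Lemma toQB x y : toQ (x - y) = toQ x - toQ y.
Proof. exact: map_mxB. Qed.

Lemma toQM x (w : 'M[int]_n) : toQ (x *m w) = toQ x *m map_mx intr w.
Proof. exact: map_mxM. Qed.

Lemma toQMz x c : toQ (x *~ c) = c%:~R *: toQ x.
Proof. by rewrite scaler_int /toQ raddfMz. Qed.

Lemma toQ_inj : injective (@toQ n).
Proof.
by move=> x y /rowP e; apply/rowP=> i; have := e i; rewrite !mxE => /intr_inj.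
Qed.
End ToQ.

Section Weyl.
Variables (n : nat) (C : 'M[int]_n).
Implicit Types (x y : 'rV[int]_n) (i j : 'I_n).

Lemma mul_delta_col (R : pzRingType) (x : 'rV[R]_n) i :
  x *m delta_mx i (0 : 'I_1) = (x 0 i)%:M.
Proof.
apply/matrixP=> a b; rewrite !ord1 !mxE (bigD1 i) //= big1 ?addr0 => [|j ij].
  by rewrite !mxE !eqxx mulr1.
by rewrite !mxE (negPf ij) mulr0.
Qed.

Lemma mul_simple_refl x i :
  x *m simple_refl C i = x - simple_root C i *~ x 0 i.
Proof.
rewrite /simple_refl mulmxBr mulmx1 mulmxA mul_delta_col mul_scalar_mx.
by congr (_ - _); rewrite -scaler_int intz.
Qed.

Lemma simple_reflK i : C i i = 2 -> simple_refl C i *m simple_refl C i = 1%:M.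
Proof.
move=> Cii; rewrite {2}/simple_refl mulmxBr mulmx1 mulmxA.
rewrite [simple_refl C i *m _]mulmxBl mul1mx -mulmxA mul_delta_col mxE Cii.
by rewrite mul_mx_scalar scaler_nat mulr2n opprD addNKr mulNmx opprK subrK.
Qed.

Lemma det_simple_refl i : C i i = 2 -> \det (simple_refl C i) = -1.
Proof.
by move=> Cii; rewrite det_1_sub_mul mul_delta_col !mxE Cii eqxx mulr1n.
Qed.

Lemma word_refl_cons i s : word_refl C (i :: s) = simple_refl C i *m word_refl C s.
Proof. by rewrite /word_refl big_cons. Qed.

Lemma word_refl1 i : word_refl C [:: i] = simple_refl C i.
Proof. by rewrite /word_refl big_cons big_nil mulmx1. Qed.

Lemma word_refl_cat s1 s2 :
  word_refl C (s1 ++ s2) = word_refl C s1 *m word_refl C s2.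
Proof.
rewrite /word_refl; elim: s1 => [|i s1 IH] /=; first by rewrite big_nil mul1mx.
by rewrite !big_cons IH mulmxA.
Qed.

Lemma weyl1 : weyl C 1%:M.
Proof. by exists [::]; rewrite // /word_refl big_nil. Qed.

Lemma weylM w1 w2 : weyl C w1 -> weyl C w2 -> weyl C (w1 *m w2).
Proof. by move=> [s1 _ <-] [s2 _ <-]; exists (s1 ++ s2); rewrite ?word_refl_cat. Qed.

Lemma weyl_refl i : weyl C (simple_refl C i).
Proof. by exists [:: i]; rewrite // word_refl1. Qed.

Lemma weyl_ind (P : 'M[int]_n -> Prop) : P 1%:M ->
  (forall i w, weyl C w -> P w -> P (simple_refl C i *m w)) ->
  forall w, weyl C w -> P w.
Proof.
move=> P1 PM w [s _ <-]; elim: s => [|i s IH]; first by rewrite /word_refl big_nil.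
by rewrite word_refl_cons; apply: PM => //; exists s.
Qed.

Lemma root_lattice_root i : root_lattice C (simple_root C i).
Proof.
exists (fun j => (j == i)%:Z); rewrite (bigD1 i) //= big1 ?addr0 ?eqxx //.
by move=> j /negPf ->.
Qed.

Lemma root_lattice0 : root_lattice C 0.
Proof. by exists (fun=> 0); rewrite big1. Qed.

Lemma root_latticeD x y : root_lattice C x -> root_lattice C y -> root_lattice C (x + y).
Proof.
move=> [c ->] [c' ->]; exists (fun i => c i + c' i); rewrite -big_split.
by apply: eq_bigr => i _; rewrite mulrzDr.
Qed.

Lemma root_latticeN x : root_lattice C x -> root_lattice C (- x).
Proof.
move=> [c ->]; exists (fun i => - c i); rewrite -sumrN.
by apply: eq_bigr => i _; rewrite mulrNz.
Qed.

Lemma root_latticeMz x k : root_lattice C x -> root_lattice C (x *~ k).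
Proof.
move=> [c ->]; exists (fun i => c i * k); rewrite mulrz_suml.
by apply: eq_bigr => i _; rewrite mulrzA.
Qed.

Lemma root_lattice_weyl x w : root_lattice C x -> weyl C w -> root_lattice C (x *m w).
Proof.
move=> Lx Ww; elim/weyl_ind: w / Ww x Lx => [|i w _ IH] x Lx; first by rewrite mulmx1.
rewrite mulmxA; apply: IH; rewrite mul_simple_refl.
apply: root_latticeD => //; apply: root_latticeN; apply: root_latticeMz.
exact: root_lattice_root.
Qed.

Hypothesis C_diag : forall i, C i i = 2.

Lemma word_refl_rev s : word_refl C s *m word_refl C (rev s) = 1%:M.
Proof.
elim: s => [|i s IH]; first by rewrite /word_refl !big_nil mulmx1.
rewrite rev_cons -cats1 word_refl_cat word_refl_cons -mulmxA (mulmxA _ _ (word_refl C [:: i])).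
by rewrite IH mul1mx word_refl1 simple_reflK.
Qed.

Lemma weylV w : weyl C w -> exists2 v, weyl C v & w *m v = 1%:M /\ v *m w = 1%:M.
Proof.
move=> [s _ <-]; exists (word_refl C (rev s)); first by exists (rev s).
by split; [|apply: mulmx1C]; apply: word_refl_rev.
Qed.

Lemma det_word_refl s : \det (word_refl C s) = (-1) ^+ size s.
Proof.
elim: s => [|i s IH]; first by rewrite /word_refl big_nil det1.
by rewrite word_refl_cons det_mulmx IH det_simple_refl // exprS.
Qed.

(** All words for w have the parity given by its determinant, in particular a shortest one. Since a
    shortest word exists, [xget] does not return its default value. *)
Lemma sign_weyl_length w : weyl C w -> (-1) ^+ weyl_length C w = \det w :> int.
Proof.
move=> [s _ sw]; rewrite /weyl_length.
have ex : exists m, exists2 s, word_refl C s = w & size s = m.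
  by exists (size s), s.
have exb : exists m, `[< exists2 s, word_refl C s = w & size s = m >].
  by have [m ?] := ex; exists m; apply/asboolP.
case: (ex_minnP exb) => m /asboolP wm minm; case: xgetP => [l _ [] [t tw <-] _|].
  by rewrite -tw det_word_refl.
move=> /(_ m)[]; split=> // t tw; apply: minm; apply/asboolP.
by exists t.
Qed.

Lemma det_weyl w : weyl C w -> \det w = 1 \/ \det w = -1.
Proof.
move=> [s _ <-]; rewrite det_word_refl -signr_odd.
by case: (odd _); [right; rewrite expr1 | left].
Qed.
End Weyl.

Section Bilin.
Variables (n : nat) (B : 'M[rat]_n).
Implicit Types x y z : 'rV[rat]_n.

Lemma bilinDl x y z : bilin B (x + y) z = bilin B x z + bilin B y z.
Proof. by rewrite /bilin !mulmxDl mxE. Qed.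

Lemma bilinDr x y z : bilin B z (x + y) = bilin B z x + bilin B z y.
Proof. by rewrite /bilin linearD mulmxDr mxE. Qed.

Lemma bilinZl c x z : bilin B (c *: x) z = c * bilin B x z.
Proof. by rewrite /bilin -!scalemxAl mxE. Qed.

Lemma bilinZr c x z : bilin B z (c *: x) = c * bilin B z x.
Proof. by rewrite /bilin linearZ -scalemxAr mxE. Qed.

Lemma bilinNl x z : bilin B (- x) z = - bilin B x z.
Proof. by rewrite -scaleN1r bilinZl mulN1r. Qed.

Lemma bilinNr x z : bilin B z (- x) = - bilin B z x.
Proof. by rewrite -scaleN1r bilinZr mulN1r. Qed.

Lemma bilin0l z : bilin B 0 z = 0.
Proof. by rewrite /bilin !mul0mx mxE. Qed.

Lemma bilin0r z : bilin B z 0 = 0.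
Proof. by rewrite /bilin trmx0 mulmx0 mxE. Qed.

Lemma bilin_sumr (I : Type) (r : seq I) (P : pred I) (F : I -> 'rV[rat]_n) z :
  bilin B z (\sum_(i <- r | P i) F i) = \sum_(i <- r | P i) bilin B z (F i).
Proof. by rewrite /bilin linear_sum mulmx_sumr summxE. Qed.

Lemma bilinC x y : B^T = B -> bilin B x y = bilin B y x.
Proof.
move=> Bsym; rewrite /bilin -[LHS]/((x *m B *m y^T) 0 0).
by rewrite -[x *m B *m y^T]trmxK mxE trmx_mul trmxK trmx_mul Bsym mulmxA.
Qed.

Lemma bilin_sum x y : bilin B x y = \sum_i \sum_j x 0 i * B i j * y 0 j.
Proof.
rewrite /bilin mxE exchange_big /=; apply: eq_bigr => j _.
by rewrite !mxE mulr_suml.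
Qed.
End Bilin.

(* [B] is the Gram matrix, on fundamental weights, of an invariant form with    *)
(* [(alpha_i|alpha_i) = 2 del_i].                                               *)
Record finite_datum n (C : 'M[int]_n) (del : 'I_n -> rat) (B : 'M[rat]_n) : Prop :=
  FiniteDatum {
  fd_diag : forall i, C i i = 2;
  fd_off : forall i j, i != j -> C i j <= 0;
  fd_pos : forall i, 0 < del i;
  fd_sym : B^T = B;
  fd_root : forall x i, bilin B x (toQ (simple_root C i)) = del i * x 0 i;
  fd_posdef : forall x, x != 0 -> 0 < bilin B x x }.

Section FiniteDatum.
Variables (n : nat) (C : 'M[int]_n) (del : 'I_n -> rat) (B : 'M[rat]_n).
Hypothesis fd : finite_datum C del B.
Local Notation b := (bilin B).
Local Notation alpha i := (toQ (simple_root C i)).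
Implicit Types x y z : 'rV[rat]_n.

Lemma fdC x y : b x y = b y x.
Proof. exact: bilinC (fd_sym fd). Qed.

Lemma fd_ge0 x : 0 <= b x x.
Proof.
by have [->|/(fd_posdef fd)/ltW//] := eqVneq x 0; rewrite bilin0l.
Qed.

Lemma fd_eq0 x : b x x = 0 -> x = 0.
Proof. by have [//|/(fd_posdef fd)/lt0r_neq0/eqP] := eqVneq x 0. Qed.

(** The component of x orthogonal to y is nonzero and so has positive norm. *)
Lemma fd_CS_strict x y : y != 0 -> (forall c, x != c *: y) ->
  b x y ^+ 2 < b x x * b y y.
Proof.
move=> y0 xy; have byy := fd_posdef fd y0.
have := xy (b x y / b y y); rewrite -subr_eq0 => /(fd_posdef fd).
rewrite !(bilinDl, bilinDr, bilinNl, bilinNr, bilinZl, bilinZr) (fdC y x).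
move: (b x x) (b x y) (b y y) byy => p q r r0.
move/(mulr_gt0 r0); rewrite -[_ < p * r]subr_gt0.
by congr (0 < _); field; exact: lt0r_neq0.
Qed.

Lemma fd_CS x y : b x y ^+ 2 <= b x x * b y y.
Proof.
have [->|y0] := eqVneq y 0; first by rewrite !bilin0r expr0n mulr0.
have [[c ->]|xy] := EM (exists c, x = c *: y).
  by rewrite !(bilinZl, bilinZr) le_eqVlt; apply/orP; left; apply/eqP; ring.
by apply/ltW/fd_CS_strict => // c; apply/eqP => e; apply: xy; exists c.
Qed.

Lemma fd_C_sym i j : del i * (C i j)%:~R = del j * (C j i)%:~R.
Proof. by have := fdC (alpha i) (alpha j); rewrite !(fd_root fd) !mxE. Qed.

Lemma fd_root_norm i : b (alpha i) (alpha i) = del i * 2.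
Proof. by rewrite (fd_root fd) !mxE (fd_diag fd). Qed.

Lemma fd_root_comb (c : 'I_n -> rat) x :
  b x (\sum_i c i *: alpha i) = \sum_i c i * del i * x 0 i.
Proof.
rewrite bilin_sumr; apply: eq_bigr => i _.
by rewrite bilinZr (fd_root fd) mulrA.
Qed.

Lemma fd_root_free (c : 'I_n -> rat) : \sum_i c i *: alpha i = 0 -> forall i, c i = 0.
Proof.
move=> c0 i; have := fd_root_comb c (delta_mx 0 i).
rewrite c0 bilin0r (bigD1 i) //= big1 => [|j ji].
  move/esym; rewrite !mxE !eqxx /= mulr1 addr0 => /eqP; rewrite mulf_eq0.
  by rewrite (gt_eqF (fd_pos fd i)) orbF => /eqP.
by rewrite mxE (negPf ji) andbF mulr0.
Qed.

(** Distinct simple roots are not proportional, so strict Cauchy-Schwarz gives a_ij a_ji < 4. Both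
    entries are nonpositive integers that vanish together, which leaves the listed pairs. *)
Lemma fd_rank2 i j : i != j -> rank2_finite (C i j) (C j i).
Proof.
move=> ij; have di := fd_pos fd i; have dj := fd_pos fd j.
have : b (alpha i) (alpha j) ^+ 2 < b (alpha i) (alpha i) * b (alpha j) (alpha j).
  apply: fd_CS_strict => [|c].
    apply: contra_neq (lt0r_neq0 dj) => a0.
    by have := fd_root_norm j; rewrite a0 bilin0r => /esym/eqP; rewrite mulf_eq0 orbF => /eqP.
  apply/eqP => e; have := fd_root fd (delta_mx 0 i) i; rewrite e bilinZr (fd_root fd).
  rewrite !mxE (negPf (_ : j != i)) 1?eq_sym // andbF !mulr0 !eqxx /= mulr1 => /eqP.
  by rewrite eq_sym (gt_eqF di).
rewrite !fd_root_norm (fd_root fd) !mxE => lt4.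
have : (C i j)%:~R * (C j i)%:~R < 4 :> rat.
  rewrite -(ltr_pM2l (mulr_gt0 di dj)); apply: le_lt_trans (_ : _ <= (del j * (C j i)%:~R) ^+ 2) _.
    rewrite le_eqVlt -{1}[X in X ^+ 2](fd_C_sym i j) expr2 -{1}fd_C_sym.
    by apply/orP; left; apply/eqP; ring.
  by apply: lt_le_trans lt4 _; rewrite le_eqVlt; apply/orP; left; apply/eqP; ring.
have := fd_C_sym i j;
have := fd_off fd ij; have := @fd_off _ _ _ _ fd j i; rewrite eq_sym ij => /(_ isT).
rewrite -intrM (_ : 4 = 4%:~R) // ltr_int.
move: (C i j) (C j i) => p q q0 p0 e pq4.
have p_q : p = 0 <-> q = 0.
  split=> z; move: e; rewrite z mulr0; [move/esym|]; move/eqP.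
    by rewrite mulf_eq0 (gt_eqF dj) intr_eq0 => /eqP.
  by rewrite mulf_eq0 (gt_eqF di) intr_eq0 => /eqP.
rewrite /rank2_finite !inE !xpair_eqE.
have [p00|p0'] := eqVneq p 0; first by rewrite p00 (p_q.1 p00).
have q0' : q != 0 by apply: contra_neq p0' => /p_q.
have : -3 <= p /\ -3 <= q by nia.
by nia.
Qed.

Lemma fd_refl x i :
  x *m map_mx intr (simple_refl C i) = x - x 0 i *: alpha i.
Proof.
rewrite /simple_refl map_mxB map_mx1 map_mxM mulmxBr mulmx1 mulmxA.
by rewrite map_delta_mx mul_delta_col mul_scalar_mx.
Qed.

Lemma fd_weyl w x y : weyl C w -> b (x *m map_mx intr w) (y *m map_mx intr w) = b x y.
Proof.
move=> Ww; elim/weyl_ind: w / Ww x y => [|i w _ IH] x y.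
  by rewrite map_mx1 !mulmx1.
rewrite map_mxM !mulmxA IH !fd_refl !(bilinDl, bilinDr, bilinNl, bilinNr, bilinZl, bilinZr).
rewrite (fdC (alpha i) y) fd_root_norm !(fd_root fd); ring.
Qed.

Lemma fd_weyl_norm w x : weyl C w -> b (x *m map_mx intr w) (x *m map_mx intr w) = b x x.
Proof. exact: fd_weyl. Qed.

Lemma fd_coord_bound x i : x 0 i ^+ 2 <= b x x * 2 / del i.
Proof.
have di := fd_pos fd i; have := fd_CS x (alpha i).
rewrite fd_root_norm (fd_root fd) => le; rewrite ler_pdivlMr // -(ler_pM2r di).
by rewrite (_ : _ * _ * _ = (del i * x 0 i) ^+ 2) ?(le_trans le) //; [rewrite mulrCA mulrC|ring].
Qed.

Lemma finite_int_matrices m p (K : nat) :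
  finite_set [set w : 'M[int]_(m, p) | forall i j, `|w i j| <= K%:Z]%classic.
Proof.
pose f (v : 'M['I_(K + K).+1]_(m, p)) : 'M[int]_(m, p) :=
  map_mx (fun k : 'I_(K + K).+1 => (k : nat)%:Z - K%:Z) v.
apply: (@sub_finite_set _ _ (range f)); last exact/finite_image/finite_finset.
move=> w /= wK; exists (map_mx (fun z : int => inord (absz (z + K%:Z))) w) => //.
apply/matrixP=> i j; by rewrite !mxE inordK; move: (wK i j); lia.
Qed.

(** The rows of w are images of the fundamental weights, so their norms are fixed and
    [fd_coord_bound] bounds all entries; K exceeds the sum of these bounds. *)
Lemma fd_weyl_finite : finite_set (weyl C).
Proof.
pose q : rat := \sum_i \sum_j b (delta_mx 0 i) (delta_mx 0 i) * 2 / del j.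
have [K qK] : exists K : nat, q <= K%:R.
  exists (Num.bound `|q|); apply/ltW/(le_lt_trans (ler_norm _)).
  exact: archi_boundP (normr_ge0 q).
apply: sub_finite_set (finite_int_matrices n n K) => w Ww i j.
have tle i' j' : 0 <= b (delta_mx 0 i') (delta_mx 0 i') * 2 / del j'.
  by rewrite divr_ge0 ?mulr_ge0 ?fd_ge0 // ltW ?(fd_pos fd).
have := fd_coord_bound (delta_mx 0 i *m map_mx intr w) j.
rewrite fd_weyl_norm // -rowE !mxE => le1.
have {le1} : (w i j)%:~R ^+ 2 <= K%:R :> rat.
  apply: le_trans le1 (le_trans _ qK); rewrite /q (bigD1 i) //= (bigD1 j) //=.
  by rewrite -addrA lerDl addr_ge0 ?sumr_ge0 // => k _; rewrite ?sumr_ge0.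
rewrite -rmorphXn -[K%:R]/(K%:Z%:~R) ler_int; nia.
Qed.

End FiniteDatum.

(** * Positive definiteness *)

Definition connected_gcm n (C : 'M[int]_n) := forall S : pred 'I_n,
  (exists i, S i) -> (forall i j, S i -> C i j != 0 -> S j) -> forall i, S i.

Section PosDef.
Variables (n : nat) (C : 'M[int]_n) (del : 'I_n -> rat) (m : 'I_n -> rat).
Hypothesis C_diag : forall i, C i i = 2.
Hypothesis C_off : forall i j, i != j -> C i j <= 0.
Hypothesis C_conn : connected_gcm C.
Hypothesis del_pos : forall i, 0 < del i.
Hypothesis C_sym : forall i j, del i * (C i j)%:~R = del j * (C j i)%:~R.
Hypothesis m_pos : forall i, 0 < m i.
Hypothesis Cm_ge0 : forall j, 0 <= \sum_i (C j i)%:~R * m i.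
Hypothesis Cm_neq0 : exists j, 0 < \sum_i (C j i)%:~R * m i.

Let S i j := del i * (C i j)%:~R.

(* Kac: with [c = m x], the form is a sum of squares of [x_i] and [x_i - x_j].  *)
Lemma gcm_form_sos (x : 'I_n -> rat) :
  \sum_i \sum_j S i j * (m i * x i) * (m j * x j) =
  \sum_i del i * m i * (\sum_j (C i j)%:~R * m j) * x i ^+ 2 +
  \sum_i \sum_j - (S i j) * m i * m j / 2 * (x i - x j) ^+ 2.
Proof.
have e1 : \sum_i \sum_j S i j * (m i * x i) * (m j * x j) =
   \sum_i \sum_j S i j * m i * m j / 2 * x i ^+ 2
  + \sum_i \sum_j S i j * m i * m j / 2 * x j ^+ 2
  + \sum_i \sum_j - (S i j) * m i * m j / 2 * (x i - x j) ^+ 2.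
  rewrite -!big_split /=; apply: eq_bigr => i _; rewrite -!big_split /=.
  by apply: eq_bigr => j _; field.
rewrite e1; congr (_ + _); rewrite [X in _ + X = _]exchange_big /= -big_split /=.
apply: eq_bigr => i _; rewrite mulr_sumr mulr_suml -big_split /=.
by apply: eq_bigr => j _; rewrite [S j i]C_sym /S; field.
Qed.

(** If the form vanished, so would all squares: the positive coefficient at j0 gives x_j0 = 0, and
    the squares of differences spread this along the connected diagram. *)
Lemma gcm_form_gt0 (c : 'rV[rat]_n) : c != 0 ->
  0 < \sum_i \sum_j S i j * c 0 i * c 0 j.
Proof.
move=> c0; pose x i := c 0 i / m i.
have cx i : c 0 i = m i * x i by rewrite mulrC divfK // lt0r_neq0.
have S_le0 i j : 0 <= - S i j * m i * m j / 2 * (x i - x j) ^+ 2.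
  have [->|ij] := eqVneq i j; first by rewrite subrr expr0n mulr0.
  rewrite mulr_ge0 ?sqr_ge0 // divr_ge0 // mulr_ge0 ?(ltW (m_pos _)) //.
  rewrite mulr_ge0 ?(ltW (m_pos _)) //.
  by rewrite oppr_ge0 mulr_ge0_le0 ?(ltW (del_pos _)) // lerz0 C_off.
have t_ge0 i : 0 <= del i * m i * (\sum_j (C i j)%:~R * m j) * x i ^+ 2.
  by rewrite mulr_ge0 ?sqr_ge0 // mulr_ge0 // mulr_ge0 // ltW.
under eq_bigr => i _ do under eq_bigr => j _ do rewrite !cx.
rewrite gcm_form_sos lt_neqAle addr_ge0 ?sumr_ge0 // => [|i _]; last exact: sumr_ge0.
rewrite andbT eq_sym paddr_eq0 ?sumr_ge0 // => [|i _]; last exact: sumr_ge0.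
apply/negP => /andP[/eqP z1 /eqP z2]; case/eqP: c0.
have {}z1 i : del i * m i * (\sum_j (C i j)%:~R * m j) * x i ^+ 2 = 0.
  have := psumr_eq0P (fun i _ => t_ge0 i) z1; exact.
have {}z2 i j : - S i j * m i * m j / 2 * (x i - x j) ^+ 2 = 0.
  have := psumr_eq0P (fun i _ => sumr_ge0 _ (fun j _ => S_le0 i j)) z2 (i := i) isT.
  by move/psumr_eq0P; apply.
have [j0 j0gt] := Cm_neq0.
have x0 : forall i, x i == 0.
  apply: C_conn => [|i j /eqP xi Cij].
    exists j0; move/eqP: (z1 j0); rewrite mulf_eq0 => /orP[|]; last by rewrite sqrf_eq0.
    by rewrite !mulf_eq0 (gt_eqF (del_pos _)) (gt_eqF (m_pos _)) (gt_eqF j0gt).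
  move/eqP: (z2 i j); rewrite mulf_eq0 xi sub0r sqrrN => /orP[|]; last by rewrite sqrf_eq0.
  rewrite !mulf_eq0 oppr_eq0 mulf_eq0 intr_eq0 (negPf Cij).
  by rewrite (gt_eqF (del_pos _)) !(gt_eqF (m_pos _)).
by apply/rowP=> i; rewrite mxE cx (eqP (x0 i)) mulr0.
Qed.

(** The Gram matrix on the simple roots is D C. These are the rows of C^T in fundamental
    coordinates, so the change of basis gives (C^T)^-1 D on the fundamental weights. *)
Lemma finite_datum_exists : exists B, finite_datum C del B.
Proof.
pose CQ : 'M[rat]_n := map_mx intr C; pose D := diag_mx (\row_i del i).
have CS : CQ^T *m D = D *m CQ.
  apply/matrixP=> i j; rewrite mul_mx_diag mul_diag_mx !mxE mulrC.
  exact: C_sym.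
have form c : bilin (D *m CQ) c c = \sum_i \sum_j S i j * c 0 i * c 0 j.
  rewrite bilin_sum; apply: eq_bigr => i _; apply: eq_bigr => j _.
  by rewrite mul_diag_mx !mxE /S; ring.
have CU : CQ^T \in unitmx.
  rewrite -row_free_unit; apply: inj_row_free => c c0.
  apply/eqP; apply/negPn/negP => /gcm_form_gt0; rewrite -form -CS /bilin.
  by rewrite mulmxA c0 !mul0mx mxE ltxx.
have CU' : CQ \in unitmx by rewrite -unitmx_tr.
exists (invmx CQ^T *m D); have Bsym : (invmx CQ^T *m D)^T = invmx CQ^T *m D.
  rewrite trmx_mul tr_diag_mx trmx_inv trmxK.
  by apply: (canRL (mulKmx CU)); rewrite mulmxA CS mulmxK.
split=> // [x i|x x0].
  rewrite bilinC // /bilin (_ : toQ _ = delta_mx 0 i *m CQ^T); last first.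
    by rewrite -rowE; apply/rowP=> j; rewrite !mxE.
  rewrite !mulmxA mulmxK // -rowE row_diag_mx -scalemxAl mxE mxE.
  by rewrite -rowE !mxE.
have xE : x = (x *m invmx CQ^T) *m CQ^T by rewrite mulmxKV.
set c := x *m invmx CQ^T in xE.
have c0 : c != 0 by apply: contra_neq x0 => c0; rewrite xE c0 mul0mx.
rewrite (_ : bilin _ x x = bilin (D *m CQ) c c).
  by rewrite form; apply: gcm_form_gt0.
have xT : x^T = CQ *m c^T by rewrite {1}xE trmx_mul trmxK.
by rewrite /bilin xT !mulmxA.
Qed.
End PosDef.

Lemma common_denominator (I : finType) (f : I -> rat) :
  exists2 D : nat, (0 < D)%N & forall i, D%:R * f i \is a Num.int.
Proof.
exists (\prod_i `|denq (f i)|)%N => [|i].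
  by rewrite prodn_gt0 // => i; rewrite absz_gt0 denq_neq0.
rewrite (bigD1 i) //= natrM mulrAC rpredM ?natr_int //.
rewrite pmulrn gtz0_abs ?denq_gt0 // mulrC -{1}(divq_num_den (f i)) divfK ?intr_int //.
by rewrite intr_eq0 denq_neq0.
Qed.

(** On a lattice, the squared distance to a rational point has bounded denominators, so an integral
    multiple of it is a termination measure. The denominator of p counts twice, once for each
    argument of the form. *)
Lemma bilin_measure n (B : 'M[rat]_n) (p : 'rV[rat]_n) :
  exists mu : 'rV[int]_n -> nat, forall x y,
    0 <= bilin B (toQ x - p) (toQ x - p) < bilin B (toQ y - p) (toQ y - p) ->
    (mu x < mu y)%N.
Proof.
have [D1 D1gt0 D1p] := common_denominator (fun i => p 0 i).
have [D2 D2gt0 D2B] := common_denominator (fun ij : 'I_n * 'I_n => B ij.1 ij.2).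
pose D : rat := (D1 * D2 * D1)%:R; have D0 : 0 < D by rewrite ltr0n !muln_gt0 D1gt0 D2gt0.
pose q x := D * bilin B (toQ x - p) (toQ x - p).
have qint x : q x \is a Num.int.
  rewrite /q bilin_sum mulr_sumr rpred_sum // => i _; rewrite mulr_sumr rpred_sum // => j _.
  set u := (toQ x - p) 0 i; set v := (toQ x - p) 0 j.
  rewrite (_ : _ * _ = (D1%:R * u) * (D2%:R * B i j) * (D1%:R * v)); last first.
    by rewrite /D !natrM; ring.
  have Du k : D1%:R * (toQ x - p) 0 k \is a Num.int.
    by rewrite !mxE mulrBr rpredB // rpredM ?natr_int ?intr_int.
  exact: rpredM (rpredM (Du i) (D2B (i, j))) (Du j).
exists (fun x => Num.truncn (q x)) => x y /andP[x0 xy].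
have qx0 : 0 <= q x by rewrite mulr_ge0 // ltW.
have qxy : q x < q y by rewrite ltr_pM2l.
have nat_q z : 0 <= q z -> q z = (Num.truncn (q z))%:R.
  by move=> z0; rewrite truncnK // natrEint qint.
by rewrite -(ltr_nat rat) -!nat_q // (le_trans qx0) // ltW.
Qed.

Definition row_coord n (i : 'I_n) (x : 'rV[int]_n) := x 0 i.

Section FiniteSystem.
Variables (n : nat) (C : 'M[int]_n) (del : 'I_n -> rat) (B : 'M[rat]_n).
Hypothesis fd : finite_datum C del B.

Lemma fin_lev_shift i j (x : 'rV[int]_n) c :
  (x - simple_root C j *~ c) 0 i = x 0 i - c * C i j.
Proof. by rewrite -scaler_int intz !mxE. Qed.

(** Reflecting x in the wall i changes its squared distance to rho, the vector of ones, by 2 del_i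
    x_i, which is negative for a violated wall. *)
Lemma fin_measure : exists mu : 'rV[int]_n -> nat, forall i (x : 'rV[int]_n), x 0 i < 0 ->
  (mu (sys_refl (simple_root C) (@row_coord n) i x) < mu x)%N.
Proof.
have [mu muP] := bilin_measure B (const_mx 1); exists mu => i x xi.
apply: muP; rewrite (fd_ge0 fd) /=; set p := const_mx 1.
rewrite /sys_refl /row_coord toQB toQMz addrAC.
have : (toQ x - p) 0 i = (x 0 i)%:~R - 1 by rewrite !mxE.
move: (toQ x - p) => u ui.
rewrite !(bilinDl, bilinDr, bilinNl, bilinNr, bilinZl, bilinZr).
rewrite (fdC fd (toQ (simple_root C i)) u) (fd_root_norm fd) (fd_root fd).
rewrite ui -subr_lt0.
have di := fd_pos fd i; have xi' : (x 0 i)%:~R < 0 :> rat by rewrite ltrz0.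
rewrite (_ : _ - _ = 2 * (del i * (x 0 i)%:~R)); last by ring.
by rewrite pmulr_rlt0 // pmulr_rlt0.
Qed.

Lemma fin_rank2 i j : i != j -> rank2_finite (C i j) (C j i) \/
  forall x : 'rV[int]_n, x 0 i <= 0 -> x 0 j <= 0 -> False.
Proof. by move=> ij; left; apply: fd_rank2 fd _ _ ij. Qed.

Lemma fin_sys_refl i x :
  sys_refl (simple_root C) (@row_coord n) i x = x *m simple_refl C i.
Proof. by rewrite mul_simple_refl. Qed.

Lemma weyl_word_act w : weyl C w -> exists g, forall x,
  x *m w = sys_act (simple_root C) (@row_coord n) g x.
Proof.
move=> [s _ <-]; elim/last_ind: s => [|s i [g gP]].
  by exists [::] => x; rewrite /word_refl big_nil mulmx1.
exists (i :: g) => x /=; rewrite -cats1 word_refl_cat word_refl1 mulmxA.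
by rewrite -fin_sys_refl gP.
Qed.

Lemma dominant_weyl_eq x w : weyl C w -> dominant x -> dominant (x *m w) ->
  x *m w = x.
Proof.
move=> /weyl_word_act[g gP] xdom; rewrite gP; have [mu mu_decr] := fin_measure.
apply: (sys_act_dominant (a := C) (mu := mu)) xdom => //.
- exact: fin_lev_shift.
- exact: fd_diag fd.
- exact: fin_rank2.
Qed.

(** Each reflection in a violated wall adds a positive multiple of a simple root. *)
Lemma climb_dominant x : exists2 w, weyl C w &
  dominant (x *m w) /\ positive_root_cone C (x *m w - x).
Proof.
have [mu mu_decr] := fin_measure.
have [k] := ubnP (mu x); elim: k x => // k IH x mux.
case: (pickP (fun i => x 0 i < 0)) => [i xi|xdom]; last first.
  exists 1%:M; first exact: weyl1.
  rewrite mulmx1 subrr; split=> [i|]; first by rewrite leNgt xdom.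
  by exists (fun=> 0%N); rewrite big1.
have [|w Ww [wdom [c cP]]] := IH (x *m simple_refl C i).
  by rewrite -fin_sys_refl; apply: leq_trans (mu_decr _ _ xi) _; rewrite -ltnS.
rewrite -mulmxA in wdom cP; exists (simple_refl C i *m w).
  by apply: weylM => //; apply: weyl_refl.
split=> //; exists (fun j => c j + (j == i) * `|row_coord i x|)%N.
rewrite -[x *m (_ *m _)](subrK (x *m simple_refl C i)) -addrA cP mul_simple_refl.
under [RHS]eq_bigr do rewrite mulrnDr.
rewrite big_split /=; congr (_ + _).
rewrite (bigD1 i) //= big1 ?addr0 => [|j /negPf ->]; last by rewrite mul0n mulr0n.
by rewrite eqxx mul1n /row_coord addrC addKr pmulrn ltz0_abs // mulrNz.
Qed.
End FiniteSystem.

(** * Marks and the highest root *)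

Definition root_comb n (A : 'M[int]_n) (c : 'I_n -> int) : 'rV[int]_n :=
  \sum_i simple_root A i *~ c i.

(* [d] symmetrizes [A], [r] is its maximum, and the marks [m] are those of the  *)
(* highest root, whose half square length is [r] as well.                       *)
Record marked_gcm n (A : 'M[int]_n) (d m : 'I_n -> int) (r : int) : Prop :=
  MarkedGcm {
  mg_diag : forall i, A i i = 2;
  mg_off : forall i j, i != j -> A i j <= 0;
  mg_conn : connected_gcm A;
  mg_dpos : forall i, 0 < d i;
  mg_sym : forall i j, d i * A i j = d j * A j i;
  mg_mpos : forall i, 0 < m i;
  mg_dom : dominant (root_comb A m);
  mg_norm : \sum_j m j * d j * root_comb A m 0 j = 2 * r;
  mg_long : exists i, d i = r;
  mg_two : forall i, d i = r \/ d i = 1;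
  mg_dvd_long : forall j, (r %| d j * m j)%Z }.

Lemma root_combE n (A : 'M[int]_n) c i : root_comb A c 0 i = \sum_j A i j * c j.
Proof.
rewrite /root_comb summxE; apply: eq_bigr => j _.
by rewrite -scaler_int intz !mxE mulrC.
Qed.

Lemma root_comb_refl n (A : 'M[int]_n) c i : root_comb A c *m simple_refl A i =
  root_comb A (fun j => c j - (j == i)%:Z * root_comb A c 0 i).
Proof.
rewrite mul_simple_refl; set z := root_comb A c 0 i; rewrite [RHS]/root_comb.
under [RHS]eq_bigr do rewrite mulrzBr.
rewrite sumrB; congr (_ - _); rewrite (bigD1 i) //= big1 ?addr0 ?eqxx ?mul1r //.
by move=> j /negPf ->; rewrite mul0r mulr0z.
Qed.

Lemma toQ_root_comb n (A : 'M[int]_n) c :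
  toQ (root_comb A c) = \sum_i (c i)%:~R *: toQ (simple_root A i).
Proof.
rewrite /root_comb /toQ raddf_sum; apply: eq_bigr => i _.
exact: toQMz.
Qed.

(** The off-diagonal terms occur in equal pairs. *)
Lemma sum_sym_even (n : nat) (e : int) (f : 'I_n -> 'I_n -> int) :
    (forall i j, f i j = f j i) -> (forall i, (2 * e %| f i i)%Z) ->
    (forall i j, (e %| f i j)%Z) ->
  (2 * e %| \sum_i \sum_j f i j)%Z.
Proof.
move=> fC fD fE.
have -> : \sum_i \sum_j f i j =
    \sum_i f i i + 2 * \sum_(i < n) \sum_(j < n | (j < i)%N) f i j.
  have -> : \sum_i \sum_j f i j = \sum_(i < n) (f i i +
      (\sum_(j < n | (j < i)%N) f i j + \sum_(j < n | (i < j)%N) f i j)).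
    apply: eq_bigr => i _; rewrite (bigD1 i) //= (bigID (fun j : 'I_n => (j < i)%N)) /=.
    congr (_ + (_ + _)); apply: eq_bigl => j; rewrite -(inj_eq val_inj) /=; lia.
  rewrite big_split /= big_split /=; congr (_ + _).
  have -> : \sum_(i < n) \sum_(j < n | (i < j)%N) f i j =
      \sum_(i < n) \sum_(j < n | (j < i)%N) f i j.
    by rewrite (exchange_big_dep xpredT) //=; apply: eq_bigr => i _; apply: eq_bigr => j _.
  by rewrite mulr2n mulrDl mul1r.
apply: rpredD; first by apply: rpred_sum => i _; apply: fD.
apply: dvdz_mul => //; apply: rpred_sum => i _; apply: rpred_sum => j _.
exact: fE.
Qed.

Section HighestRoot.
Variables (n : nat) (A : 'M[int]_n) (d m : 'I_n -> int) (r : int).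
Hypothesis mg : marked_gcm A d m r.

Lemma mg_rpos : 0 < r.
Proof. by have [i <-] := mg_long mg; apply: mg_dpos mg i. Qed.

Lemma mg_le i : d i <= r.
Proof. by have := mg_rpos; case: (mg_two mg i) => ->; lia. Qed.

Lemma mg_dvd i j : (d i %| d j * m j)%Z.
Proof. by case: (mg_two mg i) => ->; [apply: mg_dvd_long mg j | apply: dvd1z]. Qed.

Lemma mg_gt0 : exists j, 0 < root_comb A m 0 j.
Proof.
apply/existsP; apply: contraT; rewrite negb_exists => /forallP le0.
have := mg_norm mg; rewrite big1 => [|j _].
  by have := mg_rpos; lia.
have -> : root_comb A m 0 j = 0; last by rewrite mulr0.
by apply/eqP; rewrite eq_le (mg_dom mg) // leNgt le0.
Qed.

Lemma mg_datum : exists B, finite_datum A (fun i => (d i)%:~R) B.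
Proof.
apply: (@finite_datum_exists _ _ _ (fun i => (m i)%:~R)).
- exact: mg_diag mg.
- exact: mg_off mg.
- exact: mg_conn mg.
- by move=> i; rewrite ltr0z; apply: mg_dpos mg i.
- by move=> i j; rewrite -!intrM (mg_sym mg).
- by move=> i; rewrite ltr0z; apply: mg_mpos mg i.
- move=> j; under eq_bigr do rewrite -intrM.
  by rewrite -rmorph_sum /= -root_combE ler0z; apply: mg_dom mg j.
- have [j j0] := mg_gt0; exists j; under eq_bigr do rewrite -intrM.
  by rewrite -rmorph_sum /= -root_combE ltr0z.
Qed.

Local Notation theta := (root_comb A m).
Local Notation comb := (root_comb A).

Section WithForm.
Variable B : 'M[rat]_n.
Hypothesis fd : finite_datum A (fun i => (d i)%:~R) B.

(** The form between a weight and the root combination with coefficients c. It is integral, and the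
    estimates on roots below are arithmetic in its values. *)
Definition iform (x : 'rV[int]_n) (c : 'I_n -> int) : int :=
  \sum_j c j * d j * x 0 j.

Lemma iformE x c : bilin B (toQ x) (toQ (comb c)) = (iform x c)%:~R.
Proof.
rewrite toQ_root_comb (fd_root_comb fd) /iform rmorph_sum /=.
by apply: eq_bigr => j _; rewrite !intrM mxE.
Qed.

Lemma iformC c c' : iform (comb c) c' = iform (comb c') c.
Proof. by apply: (@intr_inj rat); rewrite -!iformE (fdC fd). Qed.

Lemma iform_norm_ge0 c : 0 <= iform (comb c) c.
Proof. by rewrite -(ler0z rat) -iformE (fd_ge0 fd). Qed.

Lemma iform_norm_eq0 c : iform (comb c) c = 0 -> forall i, c i = 0.
Proof.
move=> c0 i; have := iformE (comb c) c; rewrite c0 => /(fd_eq0 fd).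
rewrite toQ_root_comb => /(fd_root_free fd)/(_ i)/eqP.
by rewrite intr_eq0 => /eqP.
Qed.

(* The coefficient vectors of the lattice spanned by the Weyl group orbit of a  *)
(* simple root with [d i = e].                                                  *)
Definition root_dvd (e : int) (c : 'I_n -> int) := forall j, (e %| d j * c j)%Z.

(** All norms in this sublattice are multiples of 2e by [sum_sym_even], and nonzero vectors have
    positive norm. *)
Lemma root_dvd_norm e c : 0 < e -> root_dvd e c -> (exists i, c i != 0) ->
  2 * e <= iform (comb c) c.
Proof.
move=> e0 ec [i ci]; have : (2 * e %| iform (comb c) c)%Z.
  rewrite /iform (_ : \sum_j _ = \sum_i \sum_j c i * d i * (A i j * c j)); last first.
    by apply: eq_bigr => j _; rewrite root_combE mulr_sumr.
  apply: sum_sym_even => [j k|j|j k].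
  - rewrite (_ : _ * _ * _ = c j * (d j * A j k) * c k); last by ring.
    by rewrite (mg_sym mg); ring.
  - rewrite (mg_diag mg) (_ : _ * _ = 2 * (d j * c j) * c j); last by ring.
    by rewrite dvdz_mulr // dvdz_mul.
  - by rewrite mulrC [c j * d j]mulrC dvdz_mull.
case/dvdzP=> k kE; have : iform (comb c) c != 0.
  by apply/eqP => /iform_norm_eq0/(_ i)/eqP; rewrite (negPf ci).
have := iform_norm_ge0 c; have e2 : 0 < 2 * e by lia.
rewrite kE mulf_eq0 negb_or pmulr_lge0 // => k0 /andP[k_neq0 _].
by rewrite ler_peMl ?(ltW e2) //; lia.
Qed.

Lemma root_dvd_refl e c i : root_dvd e c ->
  exists2 c', root_dvd e c' & comb c *m simple_refl A i = comb c'.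
Proof.
move=> ec; exists (fun j => c j - (j == i)%:Z * comb c 0 i); last exact: root_comb_refl.
move=> j; have [->|ji] := eqVneq j i; last by rewrite mul0r subr0.
rewrite mul1r mulrBr rpredB // root_combE mulr_sumr rpred_sum // => l _.
by rewrite mulrA (mg_sym mg) mulrAC dvdz_mulr.
Qed.

Lemma root_dvd_weyl e c w : root_dvd e c -> weyl A w ->
  exists2 c', root_dvd e c' & comb c *m w = comb c'.
Proof.
move=> ec Ww; elim/weyl_ind: w / Ww c ec => [|i w _ IH] c ec.
  by exists c; rewrite ?mulmx1.
have [c' ec' e1] := root_dvd_refl i ec; have [c'' ec'' e2] := IH _ ec'.
by exists c''; rewrite // mulmxA e1.
Qed.

Lemma simple_root_comb i : simple_root A i = comb (fun j => (j == i)%:Z).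
Proof.
rewrite /root_comb (bigD1 i) //= big1 ?addr0 ?eqxx //.
by move=> j /negPf ->.
Qed.

Lemma root_dvd_simple i : root_dvd (d i) (fun j => (j == i)%:Z).
Proof. by move=> j; have [->|_] := eqVneq j i; rewrite ?mulr1 ?mulr0 ?dvdzz ?dvdz0. Qed.

(** Only off-diagonal entries of A contribute, and these are nonpositive. *)
Lemma iform_disjoint c c' : (forall i, 0 <= c i) -> (forall i, 0 <= c' i) ->
  (forall i, c i = 0 \/ c' i = 0) -> iform (comb c) c' <= 0.
Proof.
move=> c0 c'0 cc'; rewrite /iform sumr_le0 // => j _.
have [cj|->] := cc' j; last by rewrite !mul0r.
rewrite mulr_ge0_le0 ?mulr_ge0 ?(ltW (mg_dpos mg _)) // root_combE sumr_le0 // => i _.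
have [<-|ji] := eqVneq j i; first by rewrite cj mulr0.
by rewrite mulr_le0_ge0 ?(mg_off mg).
Qed.

Lemma iformDl x y c : iform (x + y) c = iform x c + iform y c.
Proof. by rewrite /iform -big_split /=; apply: eq_bigr => j _; rewrite mxE mulrDr. Qed.

Lemma iformNl x c : iform (- x) c = - iform x c.
Proof. by rewrite /iform -sumrN; apply: eq_bigr => j _; rewrite mxE mulrN. Qed.

Lemma iformD x c c' : iform x (fun i => c i + c' i) = iform x c + iform x c'.
Proof. by rewrite /iform -big_split /=; apply: eq_bigr => j _; rewrite !mulrDl. Qed.

Lemma iformN x c : iform x (fun i => - c i) = - iform x c.
Proof. by rewrite /iform -sumrN; apply: eq_bigr => j _; rewrite !mulNr. Qed.

Lemma combD c c' : comb (fun i => c i + c' i) = comb c + comb c'.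
Proof. by rewrite /root_comb -big_split; apply: eq_bigr => i _; rewrite mulrzDr. Qed.

Lemma combN c : comb (fun i => - c i) = - comb c.
Proof. by rewrite /root_comb -sumrN; apply: eq_bigr => i _; rewrite mulrNz. Qed.

(** Write theta - c = u+ - u- with disjoint supports, where c is the dominant root. Its norm is at
    most 2 d_i, while u+ and u- have norm at least 2 d_i if nonzero and (u+|u-) <= 0; hence one of
    them is zero. If u+ = 0 and u- is nonzero, then c = theta + u- is too long for a root. So u- =
    0, and if c is long, comparison with the norm of theta gives u+ = 0 as well. *)
Lemma dominant_root i w : weyl A w -> dominant (simple_root A i *m w) ->
  positive_root_cone A (theta - simple_root A i *m w) /\
  (d i = r -> simple_root A i *m w = theta).
Proof.
move=> Ww dom; have dpos := mg_dpos mg; have r0 := mg_rpos.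
have [c ec cE] : exists2 c, root_dvd (d i) c & simple_root A i *m w = comb c.
  by rewrite simple_root_comb; apply: root_dvd_weyl => //; apply: root_dvd_simple.
have norm_c : iform (comb c) c = 2 * d i.
  apply: (@intr_inj rat); rewrite -iformE -cE toQM (fd_weyl_norm fd) //.
  by rewrite (fd_root_norm fd) intrM mulrC.
have norm_t : iform theta m = 2 * r := mg_norm mg.
rewrite cE in dom *; pose u j := m j - c j.
have thetaE : theta = comb c + comb u.
  by rewrite -combD; congr root_comb; apply/funext => j; rewrite /u addrC subrK.
(* This number is a multiple of r by [mg_dvd_long], and it is positive because c is dominant and
   nonzero and all marks are positive. *)
have ct : r <= iform (comb c) m.
  have : (r %| iform (comb c) m)%Z.
    rewrite /iform rpred_sum // => j _.
    by rewrite dvdz_mulr // mulrC (mg_dvd_long mg).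
  have : 0 < iform (comb c) m.
    have [j cj] : exists j, 0 < comb c 0 j.
      apply/existsP; apply: contraT; rewrite negb_exists => /forallP le0.
      have : iform (comb c) c = 0.
        rewrite /iform big1 // => j _; have -> : comb c 0 j = 0; last by rewrite mulr0.
        by apply/eqP; rewrite eq_le dom // leNgt le0.
      by have := dpos i; lia.
    rewrite /iform (bigD1 j) //= ltr_wpDr ?mulr_gt0 ?(mg_mpos mg) //.
    by rewrite sumr_ge0 // => k _; rewrite !mulr_ge0 // ltW // (mg_mpos mg).
  move=> + /dvdzP[k kE]; rewrite kE pmulr_lgt0 // => k0.
  by rewrite ler_peMl ?(ltW r0) //; lia.
pose up j := Num.max (u j) 0; pose um j := Num.max (- u j) 0.
have uE j : u j = up j - um j by rewrite /up /um; lia.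
have up0 j : 0 <= up j by rewrite /up; lia.
have um0 j : 0 <= um j by rewrite /um; lia.
have disj : iform (comb up) um <= 0.
  by apply: iform_disjoint => // j; rewrite /up /um; lia.
have eu : root_dvd (d i) u by move=> j; rewrite mulrBr rpredB // mg_dvd.
have eup : root_dvd (d i) up.
  by move=> j; rewrite /up; case: (leP (u j) 0) => _; rewrite ?mulr0 ?dvdz0 ?eu.
have eum : root_dvd (d i) um.
  move=> j; rewrite /um; case: (leP (- u j) 0) => _; rewrite ?mulr0 ?dvdz0 //.
  by rewrite mulrN rpredN; apply: eu.
have combu : comb u = comb up - comb um.
  by rewrite -combN -combD; congr root_comb; apply/funext.
have iform_u x : iform x u = iform x up - iform x um.
  by rewrite -iformN -iformD; congr iform; apply/funext.
have iform_m x : iform x m = iform x c + iform x u.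
  by rewrite -iformD; congr iform; apply/funext => j; rewrite /u addrC subrK.
have norm_u : iform (comb u) u = iform (comb up) up + iform (comb um) um
    - 2 * iform (comb up) um.
  by rewrite combu !(iformDl, iformNl, iform_u) (iformC um up); ring.
have le_r := mg_le i.
have norm_u2 : iform (comb u) u = 2 * r + 2 * d i - 2 * iform (comb c) m.
  move: norm_t ct; rewrite thetaE iformDl !iform_m norm_c (iformC u c); lia.
have um_eq0 : forall j, um j = 0.
  move=> j; apply/eqP; apply: contraT => umj.
  have um2 := root_dvd_norm (dpos i) eum (ex_intro _ j umj).
  have upz : forall k, up k = 0.
    move=> k; apply/eqP; apply: contraT => upk.
    have up2 := root_dvd_norm (dpos i) eup (ex_intro _ k upk).
    by have := dpos i; lia.
  have : iform theta um >= 0.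
    by rewrite sumr_ge0 // => k _; rewrite !mulr_ge0 ?(mg_dom mg) // ltW.
  have combup : comb up = 0 by rewrite /root_comb big1 // => k _; rewrite upz mulr0z.
  have iformup x : iform x up = 0 by rewrite /iform big1 // => k _; rewrite upz !mul0r.
  move: norm_t; rewrite thetaE combu combup sub0r !(iformDl, iformNl) iform_m.
  rewrite norm_c !iform_m !iform_u !iformup (iformC um c).
  by have := dpos i; lia.
have combum : comb um = 0 by rewrite /root_comb big1 // => k _; rewrite um_eq0 mulr0z.
have iformum x : iform x um = 0 by rewrite /iform big1 // => k _; rewrite um_eq0 !mul0r.
split=> [|dr].
  exists (fun j => `|up j|%N); rewrite thetaE addrAC subrr add0r combu combum subr0.
  by apply: eq_bigr => j _; rewrite pmulrn gez0_abs.
have : iform (comb up) up = 0.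
  have : 0 <= iform (comb c) up.
    by rewrite sumr_ge0 // => k _; rewrite !mulr_ge0 // ltW.
  have := iform_norm_ge0 up.
  move: norm_t; rewrite thetaE combu combum subr0 !iformDl !iform_m norm_c.
  by rewrite !iform_u !iformum (iformC up c); lia.
move/iform_norm_eq0 => up_eq0; rewrite thetaE combu combum subr0.
by rewrite [comb up]big1 ?addr0 // => k _; rewrite up_eq0 mulr0z.
Qed.
End WithForm.

Lemma long_root_weyl i : d i = r -> exists2 w, weyl A w & simple_root A i *m w = theta.
Proof.
move=> dir; have [B fd] := mg_datum.
have [w Ww [dom _]] := climb_dominant fd (simple_root A i).
by exists w => //; have [_ ->] := dominant_root fd Ww dom.
Qed.

(** Climbing from y to a dominant root adds only positive combinations, and dominant roots are
    covered by [dominant_root]. *)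
Lemma root_system_le y : root_system A y -> positive_root_cone A (theta - y).
Proof.
move=> [i [w Ww ->]]; have [B fd] := mg_datum.
have [v Wv [dom [c cE]]] := climb_dominant fd (simple_root A i *m w).
rewrite -mulmxA in dom cE; have [[c' c'E] _] := dominant_root fd (weylM Ww Wv) dom.
exists (fun j => c' j + c j)%N; under eq_bigr do rewrite mulrnDr.
by rewrite big_split /= -c'E -cE addrA subrK.
Qed.

(** A long simple root is conjugate to theta, so theta is a root, and it dominates all others. Two
    roots that dominate each other coincide by independence of the simple roots. *)
Lemma highest_rootE : highest_root A = theta.
Proof.
have [B fd] := mg_datum; apply: xget_unique.
  split; last exact: root_system_le.
  have [i ir] := mg_long mg; have [w Ww wE] := long_root_weyl ir.
  by exists i; exists w.
move=> y [yroot ymax]; have [i ir] := mg_long mg; have [w Ww wE] := long_root_weyl ir.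
have [|c cE] := ymax theta; first by exists i; exists w.
have [c' c'E] := root_system_le yroot.
have : toQ (y - theta) + toQ (theta - y) = 0 by rewrite -toQD addrA subrK subrr toQ0.
rewrite -toQD cE c'E -big_split /=.
pose s i : int := (c i + c' i)%N.
rewrite (_ : \sum_i _ = root_comb A s); last first.
  by apply: eq_bigr => j _; rewrite -mulrnDr.
rewrite toQ_root_comb => /(fd_root_free fd) s0.
apply/eqP; rewrite eq_sym -subr_eq0 c'E big1 // => j _.
move: (s0 j) => /eqP; rewrite intr_eq0 /s; case: (c' j) => // *; lia.
Qed.
End HighestRoot.

(** * The fundamental alcove *)

Section Alcove.
Variables (n : nat) (A : 'M[int]_n) (d m : 'I_n -> int) (r : int).
Hypothesis mg : marked_gcm A d m r.
Variable N : int.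
Hypothesis N_gt0 : 0 < N.

Local Notation C := A^T.
Local Notation theta := (root_comb A m).
Implicit Types y z : 'rV[int]_n.

Let r0 : 0 < r. Proof. exact: mg_rpos mg. Qed.
Let dpos := mg_dpos mg.
Let mpos := mg_mpos mg.

(** Here y is a coweight in fundamental coordinates, on which the Weyl group of the transpose acts,
    and [level] is its pairing with theta. *)
Definition level y : int := \sum_i m i * y 0 i.

(** The coefficients of the coroot theta^vee in the simple coroots. *)
Let k i := (d i * m i %/ r)%Z.

Definition theta_coroot : 'rV[int]_n := root_comb C k.
Local Notation beta := theta_coroot.

Lemma levelD y z : level (y + z) = level y + level z.
Proof. by rewrite /level -big_split; apply: eq_bigr => i _; rewrite mxE mulrDr. Qed.

Lemma levelMz y c : level (y *~ c) = level y * c.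
Proof.
by rewrite /level mulr_suml; apply: eq_bigr => i _; rewrite -scaler_int intz !mxE; ring.
Qed.

Lemma levelN y : level (- y) = - level y.
Proof. by rewrite /level -sumrN; apply: eq_bigr => i _; rewrite mxE mulrN. Qed.

Let kE i : k i * r = d i * m i.
Proof. exact: divzK (mg_dvd_long mg i). Qed.

Let kpos i : 0 < k i.
Proof. by rewrite -(pmulr_lgt0 _ r0) kE mulr_gt0. Qed.

Lemma level_simple_coroot j : level (simple_root C j) = theta 0 j.
Proof. by rewrite /level root_combE; apply: eq_bigr => i _; rewrite !mxE mulrC. Qed.

Lemma theta_corootE j : r * beta 0 j = d j * theta 0 j.
Proof.
rewrite /beta !root_combE !mulr_sumr; apply: eq_bigr => i _.
by rewrite mxE mulrCA [r * _]mulrC kE mulrCA mulrA (mg_sym mg) mulrA.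
Qed.

Lemma level_theta_coroot : level beta = 2.
Proof.
apply: (mulfI (lt0r_neq0 r0)); rewrite [RHS]mulrC -(mg_norm mg) mulr_sumr.
by apply: eq_bigr => j _; rewrite mulrCA theta_corootE mulrA.
Qed.

(** The simple coroots have half square length 1 / d_i. The criterion applies to the vector d_i m_i,
    which is r times the coefficient vector of theta^vee. *)
Lemma dual_datum : exists B, finite_datum C (fun i => (d i)%:~R^-1) B.
Proof.
have dQ i : 0 < (d i)%:~R :> rat by rewrite ltr0z.
apply: (@finite_datum_exists _ _ _ (fun i => (d i * m i)%:~R)).
- by move=> i; rewrite mxE (mg_diag mg).
- by move=> i j ij; rewrite mxE (mg_off mg) // eq_sym.
- move=> S S0 SC; apply: (mg_conn mg) S0 _ => i j Si Aij; apply: (SC i) => //.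
  rewrite mxE; apply: contra_neq Aij => Aji.
  by have := mg_sym mg i j; rewrite Aji mulr0 => /eqP; rewrite mulf_eq0 gt_eqF // => /eqP.
- by move=> i; rewrite invr_gt0.
- move=> i j; rewrite !mxE.
  have := congr1 (fun z : int => z%:~R : rat) (mg_sym mg i j); rewrite !intrM => e.
  move: e; set p := (A i j)%:~R; set q := (A j i)%:~R => e.
  have -> : p = (d j)%:~R * q / (d i)%:~R by rewrite -e mulrAC mulfV ?mul1r // lt0r_neq0.
  by field; rewrite !lt0r_neq0.
- by move=> i; rewrite ltr0z mulr_gt0.
- move=> j; have -> : \sum_i (C j i)%:~R * (d i * m i)%:~R = (d j * theta 0 j)%:~R :> rat.
    rewrite root_combE mulr_sumr rmorph_sum /=; apply: eq_bigr => i _.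
    by rewrite -intrM mxE mulrCA mulrA (mg_sym mg) mulrA.
  by rewrite ler0z mulr_ge0 ?(mg_dom mg) // ltW.
- have [j j0] := mg_gt0 mg; exists j.
  have -> : \sum_i (C j i)%:~R * (d i * m i)%:~R = (d j * theta 0 j)%:~R :> rat.
    rewrite root_combE mulr_sumr rmorph_sum /=; apply: eq_bigr => i _.
    by rewrite -intrM mxE mulrCA mulrA (mg_sym mg) mulrA.
  by rewrite ltr0z mulr_gt0.
Qed.

Let Cdiag i : C i i = 2. Proof. by rewrite mxE (mg_diag mg). Qed.

Definition theta_refl : 'M[int]_n := 1%:M - (\col_i m i) *m beta.

Lemma mul_theta_refl y : y *m theta_refl = y - beta *~ level y.
Proof.
rewrite /theta_refl mulmxBr mulmx1 mulmxA; congr (_ - _).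
apply/rowP=> j; rewrite -[in RHS]scaler_int intz [LHS]mxE big_ord1 !mxE.
by congr (_ * _); apply: eq_bigr => i _; rewrite mxE mulrC.
Qed.

(* [\sum_i c i * y 0 i] is the pairing of [root_comb A c] with the coweight [y]. *)
Lemma weyl_adjoint w : weyl A w -> exists2 v, weyl C v &
  forall c, exists2 c', root_comb A c *m w = root_comb A c' &
    forall y, \sum_i c' i * y 0 i = \sum_i c i * (y *m v) 0 i.
Proof.
elim/weyl_ind: w / => [|i w _ [v Wv vP]].
  by exists 1%:M => [|c]; [apply: weyl1 | exists c => [|y]; rewrite mulmx1].
exists (v *m simple_refl C i) => [|c]; first exact: weylM Wv (weyl_refl _ _).
pose c1 j := c j - (j == i)%:Z * root_comb A c 0 i.
have [c2 c2E c2P] := vP c1; exists c2 => [|y]; first by rewrite mulmxA root_comb_refl.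
rewrite c2P mulmxA mul_simple_refl; move: (y *m v) => x.
rewrite /c1; under eq_bigr do rewrite mulrBl; rewrite sumrB.
under [RHS]eq_bigr do rewrite -scaler_int intz !mxE mulrBr.
rewrite sumrB; congr (_ - _); rewrite (bigD1 i) //= big1 ?addr0.
  by rewrite eqxx mul1r root_combE mulr_suml; apply: eq_bigr => j _; ring.
by move=> j /negPf ->; rewrite !mul0r.
Qed.

(** Since theta is conjugate to the long simple root alpha_i, pairing with theta is the i-th
    coordinate after a Weyl group element. *)
Lemma level_long i : d i = r -> exists2 v, weyl C v & forall y, level y = (y *m v) 0 i.
Proof.
move=> dir; have [w Ww wE] := long_root_weyl mg dir.
have [v Wv vP] := weyl_adjoint Ww; exists v => // y.
have [c' c'E c'P] := vP (fun j => (j == i)%:Z).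
have -> : (y *m v) 0 i = \sum_j (j == i)%:Z * (y *m v) 0 j.
  rewrite (bigD1 i) //= big1 ?eqxx ?mul1r ?addr0 // => j /negPf ->.
  by rewrite mul0r.
rewrite -c'P; apply: eq_bigr => j _; congr (_ * _).
have [B fd] := mg_datum mg; move: c'E; rewrite -simple_root_comb wE => e.
have := congr1 (@toQ n) e; rewrite !toQ_root_comb => /eqP; rewrite -subr_eq0 -sumrB.
under eq_bigr do rewrite -scalerBl.
by move=> /eqP/(fd_root_free fd)/(_ j)/eqP; rewrite subr_eq0 => /eqP/intr_inj.
Qed.

Section DualForm.
Variable B : 'M[rat]_n.
Hypothesis fd : finite_datum C (fun i => (d i)%:~R^-1) B.
Local Notation b := (bilin B).

Lemma form_theta_coroot y : b (toQ y) (toQ beta) = (level y)%:~R / r%:~R.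
Proof.
rewrite toQ_root_comb (fd_root_comb fd) /level rmorph_sum mulr_suml /=.
apply: eq_bigr => i _; rewrite mxE intrM.
have rQ : r%:~R != 0 :> rat by rewrite intr_eq0 lt0r_neq0.
have dQ : (d i)%:~R != 0 :> rat by rewrite intr_eq0 lt0r_neq0.
have -> : (k i)%:~R = (d i)%:~R * (m i)%:~R / r%:~R :> rat.
  by rewrite -intrM -kE intrM mulfK.
by field; rewrite dQ rQ.
Qed.

Lemma long_coroot_weyl i : d i = r ->
  exists v u, [/\ weyl C v, weyl C u, v *m u = 1%:M, u *m v = 1%:M &
    simple_root C i *m u = beta /\ forall y, level y = (y *m v) 0 i].
Proof.
move=> dir; have [v Wv vP] := level_long dir.
have [u Wu [vu uv]] := weylV Cdiag Wv; exists v, u; split=> //; split=> //.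
set x := _ *m u; have levx : level x = 2 by rewrite vP -mulmxA uv mulmx1 !mxE (mg_diag mg).
(* Both vectors have norm 2 / r, and so has their product; thus their difference has norm zero. *)
apply/toQ_inj/eqP; rewrite -subr_eq0; apply/eqP/(fd_eq0 fd).
rewrite bilinDl !bilinDr !(bilinNl, bilinNr) (fdC fd (toQ beta) (toQ x)) !form_theta_coroot.
rewrite levx level_theta_coroot {1 2}/x !toQM (fd_weyl_norm fd) // (fd_root_norm fd) dir.
by field; rewrite intr_eq0 lt0r_neq0.
Qed.

(** The reflection in theta is conjugate to the simple reflection of a long root. *)
Lemma theta_refl_weyl : weyl C theta_refl /\ \det theta_refl = -1.
Proof.
have [i dir] := mg_long mg; have [v [u [Wv Wu vu uv [ui vi]]]] := long_coroot_weyl dir.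
have -> : theta_refl = v *m (simple_refl C i *m u).
  apply/row_matrixP=> j; rewrite !rowE mul_theta_refl !mulmxA mul_simple_refl -vi.
  rewrite mulmxBl -!mulmxA vu mulmx1; congr (_ - _).
  by rewrite -ui -!scaler_int -scalemxAl.
split; first exact: weylM Wv (weylM (weyl_refl _ _) Wu).
rewrite !det_mulmx det_simple_refl // mulrCA -det_mulmx vu det1 mulr1.
by [].
Qed.

(** Strict Cauchy-Schwarz for theta^vee and a simple coroot, the rank two condition at the affine
    vertex. *)
Lemma dual_pair_bound j : (forall c, toQ beta != c *: toQ (simple_root C j)) ->
  theta 0 j * beta 0 j < 4.
Proof.
move=> indep; have aj : toQ (simple_root C j) != 0.
  apply: contraTneq (fd_pos fd j) => a0; have := fd_root_norm fd j.
  by rewrite a0 bilin0r => /esym/eqP; rewrite mulf_eq0 orbF => /eqP ->; rewrite ltxx.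
have := fd_CS_strict fd aj indep; rewrite (fdC fd) form_theta_coroot level_simple_coroot.
rewrite form_theta_coroot level_theta_coroot (fd_root_norm fd).
have rQ : 0 < r%:~R :> rat by rewrite ltr0z.
have dQ : 0 < (d j)%:~R :> rat by rewrite ltr0z.
move=> lt; rewrite -(ltr_int rat) -(ltr_pM2l rQ).
have -> : r%:~R * (theta 0 j * beta 0 j)%:~R =
    ((theta 0 j)%:~R / r%:~R) ^+ 2 * (r%:~R * r%:~R * (d j)%:~R) :> rat.
  rewrite -intrM mulrCA theta_corootE !intrM; field; exact: lt0r_neq0.
have -> : r%:~R * 4%:~R = 2 / r%:~R * ((d j)%:~R^-1 * 2) * (r%:~R * r%:~R * (d j)%:~R) :> rat.
  by field; rewrite !lt0r_neq0.
by rewrite ltr_pM2r // !mulr_gt0.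
Qed.

(** All coefficients of theta^vee are positive, so proportionality to one simple coroot leaves no
    vertex besides j. *)
Lemma dual_pair_rank1 j c : toQ beta = c *: toQ (simple_root C j) ->
  forall y, level y = m j * y 0 j.
Proof.
move=> e y; rewrite /level (bigD1 j) //= big1 ?addr0 // => i ij.
move: e; rewrite toQ_root_comb => /eqP; rewrite -subr_eq0 (bigD1 j) //= addrAC -scalerBl.
have := kpos i => /[swap] /eqP e0.
have := fd_root_free fd (c := fun l => if l == j then (k j)%:~R - c else (k l)%:~R).
rewrite (bigD1 j) //= eqxx; under eq_bigr => l /negPf lj do rewrite lj.
by rewrite e0 => /(_ erefl i); rewrite (negPf ij) => /eqP; rewrite intr_eq0 => /eqP ->.
Qed.

(** [None] is the affine vertex: its wall is level N, and its reflection takes y to y + (N - level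
    y) theta^vee. *)
Definition alc_al (i : option 'I_n) : 'rV[int]_n :=
  if i is Some i then simple_root C i else - beta.

Definition alc_lev (i : option 'I_n) y : int :=
  if i is Some i then y 0 i else N - level y.

Definition alc_gcm (i j : option 'I_n) : int :=
  match i, j with
  | Some i, Some j => C i j
  | Some i, None => - beta 0 i
  | None, Some j => - theta 0 j
  | None, None => 2
  end.

Lemma alc_lev_shift i j y c :
  alc_lev i (y - alc_al j *~ c) = alc_lev i y - c * alc_gcm i j.
Proof.
case: i j => [i|] [j|] /=.
- exact: fin_lev_shift.
- by rewrite -scaler_int intz !mxE.
- by rewrite levelD levelN levelMz level_simple_coroot; ring.
- by rewrite levelD levelN levelMz levelN level_theta_coroot; ring.
Qed.

Lemma beta_ge0 j : 0 <= beta 0 j.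
Proof.
by rewrite -(pmulr_rge0 _ r0) theta_corootE mulr_ge0 ?(ltW (dpos _)) ?(mg_dom mg).
Qed.

(* The exception is A_1^(1), whose two reflections generate an infinite group;  *)
(* a point violates at most one of the two walls.                               *)
Lemma dual_pair_rank2 j :
  (rank2_finite (- theta 0 j) (- beta 0 j) && rank2_finite (- beta 0 j) (- theta 0 j)) \/
  forall y, 0 < N - level y \/ 0 < y 0 j.
Proof.
have [[c e]|indep] := EM (exists c, toQ beta = c *: toQ (simple_root C j)).
  right=> y; rewrite (dual_pair_rank1 e); have := mpos j; nia.
left; have : theta 0 j * beta 0 j < 4.
  by apply: dual_pair_bound => c; apply/eqP => e; apply: indep; exists c.
have := beta_ge0 j; have := mg_dom mg j; have := theta_corootE j; have := dpos j; have := r0.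
rewrite /rank2_finite !inE !xpair_eqE.
move: (theta 0 j) (beta 0 j) (d j) => t s e; rewrite /= => rp ep eq t0 s0 ts.
have ts0 : t = 0 <-> s = 0.
  split=> z; move: eq; rewrite z mulr0; [|move/esym] => /eqP;
    by rewrite mulf_eq0 gt_eqF //= => /eqP.
have [t00|t1] := eqVneq t 0; first by rewrite t00 (ts0.1 t00).
have s1 : s != 0 by apply: contra_neq t1 => /ts0.
have : t <= 3 /\ s <= 3 by nia.
nia.
Qed.

Lemma alc_rank2 i j : i != j -> rank2_finite (alc_gcm i j) (alc_gcm j i) \/
  forall y, alc_lev i y <= 0 -> alc_lev j y <= 0 -> False.
Proof.
case: i j => [i|] [j|] //= ij.
- by left; apply: fd_rank2 fd _ _ ij.
- have [/andP[_ ->]|h] := dual_pair_rank2 i; first by left.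
  by right=> y; have := h y; lia.
- have [/andP[-> _]|h] := dual_pair_rank2 j; first by left.
  by right=> y; have := h y; lia.
Qed.

Lemma alc_measure : exists mu : 'rV[int]_n -> nat, forall i y, alc_lev i y < 0 ->
  (mu (sys_refl alc_al alc_lev i y) < mu y)%N.
Proof.
pose M : rat := \sum_i (m i)%:~R; have M0 : 0 <= M.
  by apply: sumr_ge0 => i _; rewrite ler0z ltW.
(* The point with all coordinates e is interior to the alcove: e > 0, and its level e M is less than
   N. *)
pose e : rat := N%:~R / (M + 1); have NQ : 0 < N%:~R :> rat by rewrite ltr0z.
have e0 : 0 < e by rewrite divr_gt0 // ltr_wpDl.
have [mu muP] := bilin_measure B (const_mx e); exists mu => i y yi.
apply: muP; rewrite (fd_ge0 fd) /= -subr_lt0; case: i yi => [i|] /= yi.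
  rewrite /sys_refl /= toQB toQMz addrAC.
  have : (toQ y - const_mx e) 0 i = (y 0 i)%:~R - e by rewrite !mxE.
  move: (toQ y - const_mx e) => u ui.
  rewrite !(bilinDl, bilinDr, bilinNl, bilinNr, bilinZl, bilinZr).
  rewrite (fdC fd (toQ (simple_root C i)) u) (fd_root_norm fd) (fd_root fd) ui.
  have yQ : (y 0 i)%:~R < 0 :> rat by rewrite ltrz0.
  rewrite (_ : _ - _ = 2 * ((d i)%:~R^-1 * (e * (y 0 i)%:~R))); last by ring.
  by rewrite !pmulr_rlt0 // invr_gt0 ltr0z.
rewrite /sys_refl /= toQB toQMz toQN addrAC scalerN opprK.
have lev_e : bilin B (const_mx e) (toQ beta) = e * M / r%:~R.
  rewrite toQ_root_comb (fd_root_comb fd) /M mulr_sumr mulr_suml.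
  apply: eq_bigr => i _; rewrite mxE.
  have rQ : r%:~R != 0 :> rat by rewrite intr_eq0 lt0r_neq0.
  have dQ : (d i)%:~R != 0 :> rat by rewrite intr_eq0 lt0r_neq0.
  have -> : (k i)%:~R = (d i)%:~R * (m i)%:~R / r%:~R :> rat.
    by rewrite -intrM -kE intrM mulfK.
  by field; rewrite dQ rQ.
have ub : b (toQ y - const_mx e) (toQ beta) = ((level y)%:~R - e * M) / r%:~R.
  by rewrite bilinDl bilinNl form_theta_coroot lev_e mulrBl.
move: (toQ y - const_mx e) ub => u ub; set t := (N - level y)%:~R.
rewrite !(bilinDl, bilinDr, bilinNl, bilinNr, bilinZl, bilinZr).
rewrite (fdC fd (toQ beta) u) form_theta_coroot level_theta_coroot ub.
have rQ : 0 < r%:~R :> rat by rewrite ltr0z.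
have eM : e * M < N%:~R.
  by rewrite /e mulrAC ltr_pdivrMr ?ltr_wpDl // ltr_pM2l // ltrDl.
have tlt : t < 0 by rewrite ltrz0.
rewrite (_ : _ - _ = 2 / r%:~R * (t * (N%:~R - e * M))); last first.
  by rewrite /t intrB; field; exact: lt0r_neq0.
by rewrite pmulr_rlt0 ?divr_gt0 // nmulr_rlt0 // subr_gt0.
Qed.
End DualForm.
End Alcove.

Section AlcoveGroup.
Variables (n : nat) (A : 'M[int]_n) (d m : 'I_n -> int) (r : int).
Hypothesis mg : marked_gcm A d m r.
Variable N : int.
Hypothesis N_gt0 : 0 < N.

Local Notation C := A^T.
Local Notation beta := (theta_coroot A d m r).
Local Notation lev := (alc_lev m N).
Local Notation act := (sys_act (alc_al A d m r) lev).
Local Notation lev_m := (level m).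
Implicit Types y z q : 'rV[int]_n.

Let Cdiag i : C i i = 2. Proof. by rewrite mxE (mg_diag mg). Qed.

Definition in_alcove y := (forall i, 0 < y 0 i) /\ lev_m y < N.

Lemma root_lattice_beta : root_lattice C beta.
Proof. by eexists. Qed.

Lemma alc_act_affine g : exists w q, [/\ weyl C w, root_lattice C q &
  forall y, act g y = y *m w + q *~ N].
Proof.
elim: g => [|i g [w [q [Ww Lq gP]]]].
  exists 1%:M, 0; split; [exact: weyl1|exact: root_lattice0|].
  by move=> y; rewrite mulmx1 mul0rz addr0.
case: i => [i|].
  exists (w *m simple_refl C i), (q *m simple_refl C i); split.
  - exact: weylM Ww (weyl_refl _ _).
  - exact: root_lattice_weyl (weyl_refl _ _).
  move=> y; rewrite /= gP /sys_refl /= -mul_simple_refl mulmxDl -mulmxA.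
  by congr (_ + _); rewrite -!scaler_int -scalemxAl.
have [B fd] := dual_datum mg; have [Wt _] := theta_refl_weyl mg fd.
exists (w *m theta_refl A d m r), (q *m theta_refl A d m r + beta); split.
- exact: weylM.
- by apply: root_latticeD root_lattice_beta; apply: root_lattice_weyl.
move=> y; rewrite /= gP /sys_refl /=; set z := y *m w + _.
rewrite mulNrz opprK mulrzBr addrCA addrC -mul_theta_refl mulrzDl addrA; congr (_ + _).
by rewrite /z mulmxDl mulmxA; congr (_ + _); rewrite -!scaler_int -scalemxAl.
Qed.

(** Freeness is known for words in the wall reflections, so the Weyl group and the translations by N
    times the coroot lattice must be realized by such words. *)
Definition alc_reached (f : 'rV[int]_n -> 'rV[int]_n) := exists g, forall y, act g y = f y.

Lemma alc_reached_comp f1 f2 : alc_reached f1 -> alc_reached f2 ->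
  alc_reached (f2 \o f1).
Proof.
move=> [g1 g1P] [g2 g2P]; exists (g2 ++ g1) => y.
by rewrite /sys_act foldr_cat -/(act _ _) -/(act _ _) g1P g2P.
Qed.

Lemma alc_reached_ext f1 f2 : f1 =1 f2 -> alc_reached f1 -> alc_reached f2.
Proof. by move=> e [g gP]; exists g => y; rewrite gP e. Qed.

Lemma alc_reached_inv f f' : cancel f' f -> alc_reached f -> alc_reached f'.
Proof.
move=> ff' [g gP]; exists (rev g) => y; rewrite -{1}(ff' y) -gP.
have refK i x : sys_refl (alc_al A d m r) lev i (sys_refl (alc_al A d m r) lev i x) = x.
  have [B fd] := dual_datum mg.
  apply: (sys_reflK (a := alc_gcm A d m r)); first exact: (alc_lev_shift mg).
  by case=> [j|] /=; rewrite ?Cdiag.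
elim: g (f' y) {gP ff'} => [|i g IH] x //=.
by rewrite rev_cons -cats1 /sys_act foldr_cat /= refK -/(act _ _) -/(act _ _) IH.
Qed.

Lemma alc_reached_weyl w : weyl C w -> alc_reached (fun y => y *m w).
Proof.
move=> Ww; elim/weyl_ind: w / Ww => [|i w _ IH].
  by exists [::] => y; rewrite mulmx1.
apply: alc_reached_ext (alc_reached_comp _ IH) => [y|]; first by rewrite /= mulmxA.
by exists [:: Some i] => y; rewrite mul_simple_refl.
Qed.

Local Notation reached_shift q := (alc_reached (fun y => y + q *~ N)).

Lemma reached_shift_weyl q w : weyl C w -> reached_shift q -> reached_shift (q *m w).
Proof.
move=> Ww rq; have [v Wv [wv vw]] := weylV Cdiag Ww.
apply: alc_reached_ext (alc_reached_comp (alc_reached_weyl Wv)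
  (alc_reached_comp rq (alc_reached_weyl Ww))) => y /=.
rewrite mulmxDl -mulmxA vw mulmx1; congr (_ + _).
by rewrite -!scaler_int -scalemxAl.
Qed.

Lemma reached_shiftN q : reached_shift q -> reached_shift (- q).
Proof.
apply: alc_reached_inv => y; by rewrite mulNrz subrK.
Qed.

Lemma reached_shiftD q q' : reached_shift q -> reached_shift q' -> reached_shift (q + q').
Proof.
move=> rq rq'; apply: alc_reached_ext (alc_reached_comp rq rq') => y /=.
by rewrite mulrzDl addrA.
Qed.

(** The reflection in theta followed by the affine reflection is the translation by N theta^vee. *)
Lemma reached_shift_beta : reached_shift beta.
Proof.
have [B fd] := dual_datum mg; have [Wt _] := theta_refl_weyl mg fd.
apply: alc_reached_ext (alc_reached_comp (alc_reached_weyl Wt) _) => [y|]; last first.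
  by exists [:: None] => y; reflexivity.
rewrite /= mul_theta_refl; set z := y - _.
rewrite /sys_refl /= mulNrz opprK levelD levelN levelMz (level_theta_coroot mg).
rewrite /z -addrA; congr (_ + _); rewrite -mulrNz -mulrzDr.
by congr (_ *~ _); ring.
Qed.

(** Long simple roots have coroots conjugate to theta^vee. The property then spreads along bonds
    from i to j: if d_j = 1 then a_ij = -1, so s_j moves alpha_i^vee by exactly alpha_j^vee. *)
Lemma reached_shift_root i : reached_shift (simple_root C i).
Proof.
have [B fd] := dual_datum mg.
have long j : d j = r -> reached_shift (simple_root C j).
  move=> dj; have [v [u [Wv Wu vu uv [ui _]]]] := long_coroot_weyl mg fd dj.
  rewrite -[simple_root C j]mulmx1 -uv mulmxA ui.
  exact: reached_shift_weyl reached_shift_beta.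
apply/asboolP; move: i; apply: (mg_conn mg (S := fun i => `[< reached_shift (simple_root C i) >])).
  by have [j dj] := mg_long mg; exists j; apply/asboolP/long.
move=> i j /asboolP ri Aij; apply/asboolP.
have [dj|dj] := mg_two mg j; first exact: long.
have [->//|ij] := eqVneq j i.
have [B' fd'] := mg_datum mg; rewrite eq_sym in ij; have := fd_rank2 fd' ij.
have := mg_sym mg i j; have := mg_dpos mg i; rewrite dj mul1r.
rewrite /rank2_finite !inE !xpair_eqE => di e r2.
have {}Aij : A i j = -1.
  move: e r2 Aij di; move: (A i j) (A j i) (d i) => p q e; clear; move=> pq r2 p0 e0; nia.
have := reached_shiftD (reached_shift_weyl (weyl_refl _ j) ri) (reached_shiftN ri).
rewrite mul_simple_refl !mxE Aij mulrNz opprK mulr1z addrAC subrr add0r.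
exact.
Qed.

Lemma reached_shift_lattice q : root_lattice C q -> reached_shift q.
Proof.
move=> [c ->]; elim/big_ind: _ => [|q1 q2|i _].
- by exists [::] => y; rewrite mul0rz addr0.
- exact: reached_shiftD.
have rn (j : nat) : reached_shift (simple_root C i *+ j).
  elim: j => [|j IH]; last by rewrite mulrS; apply: reached_shiftD (reached_shift_root i) IH.
  by exists [::] => y; rewrite mul0rz addr0.
case: (c i) => j; first exact: rn.
by rewrite NegzE mulrNz; apply/reached_shiftN/rn.
Qed.

Lemma in_alcoveP y : in_alcove y <-> forall i, 0 < lev i y.
Proof.
split=> [[y0 yN] [i|] /=|ypos]; rewrite ?subr_gt0 //.
by split=> [i|]; [apply: (ypos (Some i)) | rewrite -subr_gt0; apply: (ypos None)].
Qed.

(** The map is a word in the wall reflections that keeps a point of the open alcove in it, so it is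
    the identity; its value at 0 shows that the translation is trivial. *)
Lemma in_alcove_free y w q : weyl C w -> root_lattice C q ->
  in_alcove y -> in_alcove (y *m w + q *~ N) -> w = 1%:M /\ y *m w + q *~ N = y.
Proof.
move=> Ww Lq /in_alcoveP ypos /in_alcoveP ypos'.
have [g gP] := alc_reached_comp (alc_reached_weyl Ww) (reached_shift_lattice Lq).
have [B fd] := dual_datum mg; have [mu mu_decr] := alc_measure mg N_gt0 fd.
have gid : act g =1 id.
  apply: (sys_act_free (a := alc_gcm A d m r) (mu := mu)) ypos _ => //.
  - exact: alc_lev_shift.
  - by case=> [i|] /=.
  - exact: alc_rank2 fd.
  - by move=> i; rewrite gP; apply/ltW/ypos'.
split; last by rewrite -[LHS]/(((fun y => y + q *~ N) \o (fun y => y *m w)) y) -gP gid.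
have q0 : q *~ N = 0 by have := gid 0; rewrite gP /= mul0mx add0r.
apply/row_matrixP=> i; rewrite !rowE mulmx1 -[RHS]gid gP /= q0 addr0.
by [].
Qed.

(** Move y into the closed alcove. If it lands on a wall, the reflection in that wall, conjugated
    back, fixes y. *)
Lemma alcove_representative y :
  (exists y0 w q, [/\ in_alcove y0, weyl C w, root_lattice C q & y = y0 *m w + q *~ N]) \/
  (exists w q, [/\ weyl C w, root_lattice C q, \det w = -1 & y *m w + q *~ N = y]).
Proof.
have [B fd] := dual_datum mg; have [mu mu_decr] := alc_measure mg N_gt0 fd.
have [g gtop] := sys_act_to_dominant mu_decr y.
have [w [q [Ww Lq gP]]] := alc_act_affine g; have [v Wv [wv vw]] := weylV Cdiag Ww.
have mulN z u : z *~ N *m u = (z *m u) *~ N by rewrite -!scaler_int -scalemxAl.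
set y1 := act g y in gtop; have y1E : y1 = y *m w + q *~ N by rewrite /y1 gP.
have yw : y *m w = y1 - q *~ N by rewrite y1E addrK.
have yE : y = y1 *m v - q *m v *~ N.
  by rewrite -[LHS]mulmx1 -wv mulmxA yw mulmxBl mulN.
case: (pickP (fun i => lev i y1 == 0)) => [i /eqP yi|y1n0]; last first.
  left; exists y1, v, (- (q *m v)); split=> //; last by rewrite mulNrz.
    by apply/in_alcoveP => i; rewrite lt_neqAle eq_sym y1n0 gtop.
  exact/root_latticeN/root_lattice_weyl.
have [w1 [q1 [Ww1 Lq1 dw1 e1]]] : exists w1 q1, [/\ weyl C w1, root_lattice C q1,
    \det w1 = -1 & y1 *m w1 + q1 *~ N = y1].
  case: i yi => [j|] /= yj.
    exists (simple_refl C j), 0; split; [exact: weyl_refl|exact: root_lattice0| |].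
      exact: det_simple_refl.
    by rewrite mul_simple_refl yj mulr0z mul0rz subr0 addr0.
  have [Wt dt] := theta_refl_weyl mg fd.
  exists (theta_refl A d m r), beta; split=> //; first exact: root_lattice_beta.
  have -> : N = lev_m y1 by apply/eqP; rewrite -subr_eq0 yj.
  by rewrite mul_theta_refl subrK.
right; exists (w *m w1 *m v), (q1 *m v + q *m w1 *m v - q *m v); split.
- by apply: weylM => //; apply: weylM.
- apply: root_latticeD; last exact/root_latticeN/root_lattice_weyl.
  by apply: root_latticeD; do ?apply: root_lattice_weyl.
- by rewrite !det_mulmx dw1 mulrAC -det_mulmx wv det1 mul1r.
rewrite !mulmxA yw mulmxBl mulN (canRL (addrK _) e1) !mulmxBl !mulN.
rewrite [RHS]yE !mulrzDl mulNrz.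
move: (y1 *m v) (q1 *m v *~ N) (q *m w1 *m v *~ N) (q *m v *~ N) => a b c e.
by rewrite addrA -[a - b - c + _]addrA [- c + _]addrCA addNr addr0 subrK.
Qed.
End AlcoveGroup.

(* [alc] is the set of lattice points of an open alcove of the group of maps    *)
(* [x |-> x w + N c G], [w] in the Weyl group and [c] integral.                 *)
Record alcove_data n (C G : 'M[int]_n) (N : int) (alc : set 'rV[int]_n) : Prop :=
  AlcoveData {
  alc_free : forall x w c, weyl C w -> alc x -> alc (x *m w + (c *m G) *~ N) ->
    w = 1%:M /\ x *m w + (c *m G) *~ N = x;
  alc_repr : forall x,
    (exists x0 w c, [/\ alc x0, weyl C w & x = x0 *m w + (c *m G) *~ N]) \/
    (exists w c, [/\ weyl C w, \det w = -1 & x *m w + (c *m G) *~ N = x]) }.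

(** * Transfer of the alcove along a diagonal matrix *)

Section Pullback.
Variables (n : nat) (A C G : 'M[int]_n) (d m e : 'I_n -> int) (r t N : int).
Hypothesis mg : marked_gcm A d m r.
Hypotheses (N_gt0 : 0 < N) (t_gt0 : 0 < t) (e_gt0 : forall i, 0 < e i).
Hypothesis Ce : forall i j, C j i * e j = e i * A i j.
Hypothesis Ge : forall i j, G i j * e j = t * A i j.

Let D : 'M[int]_n := diag_mx (\row_i e i).

Let D_inj p : injective (fun x : 'M[int]_(p, n) => x *m D).
Proof.
move=> x y /matrixP xy; apply/matrixP=> i j; have := xy i j.
by rewrite !mul_mx_diag !mxE => /(mulIf (lt0r_neq0 (e_gt0 j))).
Qed.

Let refl_D i : simple_refl C i *m D = D *m simple_refl A^T i.
Proof.
apply/row_matrixP=> k; rewrite !rowE !mulmxA mul_simple_refl mulmxBl -rowE row_diag_mx.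
rewrite -scalemxAl mul_simple_refl; apply/rowP=> j.
rewrite -[_ *~ _]scaler_int -[in RHS]scaler_int !intz -scalemxAl mul_mx_diag.
rewrite !mxE Ce /= [i == k]eq_sym; have [->|_] := eqVneq k i; last first.
  by rewrite !mul0r !subr0 !mulr_natr; ring.
by rewrite !mul1r mulrBr.
Qed.

Let weyl_D w : weyl C w -> exists2 v, weyl A^T v & w *m D = D *m v.
Proof.
elim/weyl_ind: w / => [|i w _ [v Wv wv]].
  by exists 1%:M; [exact: weyl1 | rewrite mul1mx mulmx1].
exists (simple_refl A^T i *m v); first exact: weylM (weyl_refl _ _) Wv.
by rewrite -mulmxA wv !mulmxA refl_D.
Qed.

Let weyl_D' v : weyl A^T v -> exists2 w, weyl C w & w *m D = D *m v.
Proof.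
elim/weyl_ind: v / => [|i v _ [w Ww wv]].
  by exists 1%:M; [exact: weyl1 | rewrite mul1mx mulmx1].
exists (simple_refl C i *m w); first exact: weylM (weyl_refl _ _) Ww.
by rewrite -mulmxA wv !mulmxA refl_D.
Qed.

Let G_D (c : 'rV[int]_n) : (c *m G) *~ N *m D = (c *m A) *~ (t * N).
Proof.
have GD : G *m D = t *: A.
  by apply/matrixP=> i j; rewrite mul_mx_diag !mxE Ge.
rewrite -!scaler_int -scalemxAl -mulmxA GD -scalemxAr scalerA.
by rewrite !intz mulrC.
Qed.

Let lattice_A (c : 'rV[int]_n) : root_lattice A^T (c *m A).
Proof.
exists (fun i => c 0 i); apply/rowP=> j; rewrite summxE !mxE; apply: eq_bigr => i _.
by rewrite -scaler_int intz !mxE.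
Qed.

Let lattice_A' q : root_lattice A^T q -> exists c : 'rV[int]_n, q = c *m A.
Proof.
move=> [c ->]; exists (\row_i c i); apply/rowP=> j; rewrite summxE !mxE; apply: eq_bigr => i _.
by rewrite -scaler_int intz !mxE.
Qed.

Let det_D w v : w *m D = D *m v -> \det w = \det v.
Proof.
move/(congr1 determinant); rewrite !det_mulmx [RHS]mulrC; apply: mulIf.
by rewrite det_diag; apply/prodf_neq0 => i _; rewrite mxE lt0r_neq0.
Qed.

(** The diagonal matrix D intertwines the Weyl groups of C and A^T and carries N times the lattice
    of G onto t N times the coroot lattice; being injective, it reflects both properties of the
    alcove at t N. *)
Lemma pullback_alcove (alc : set 'rV[int]_n) :
  (forall x, alc x <-> (forall i, 0 < x 0 i) /\ \sum_i m i * e i * x 0 i < t * N) ->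
  alcove_data C G N alc.
Proof.
move=> alcP; have Cdiag i : C i i = 2.
  by apply: (mulIf (lt0r_neq0 (e_gt0 i))); rewrite Ce (mg_diag mg) mulrC.
have {}alcP x : alc x <-> in_alcove m (t * N) (x *m D).
  have levE : level m (x *m D) = \sum_i m i * e i * x 0 i.
    by apply: eq_bigr => i _; rewrite mul_mx_diag !mxE -mulrA [e i * _]mulrC.
  rewrite /in_alcove levE; apply: (iff_trans (alcP x)).
  by split=> -[x0 lx]; split=> // i; move: (x0 i); rewrite mul_mx_diag !mxE pmulr_lgt0.
have tN : 0 < t * N by rewrite mulr_gt0.
have free := in_alcove_free mg tN; have repr := alcove_representative mg tN.
split=> [x w c Ww /alcP alcx /alcP alcx'|x].
  have [v Wv wv] := weyl_D Ww; move: alcx'.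
  rewrite mulmxDl G_D -mulmxA wv mulmxA => alcx'.
  have [v1 vx] := free _ _ _ Wv (lattice_A c) alcx alcx'.
  have w1 : w = 1%:M by apply: (@D_inj n); rewrite wv v1 mulmx1 mul1mx.
  split=> //; apply: (@D_inj 1); rewrite -[RHS]vx mulmxDl G_D v1 w1.
  by rewrite !mulmx1.
case: (repr (x *m D)) => [[y0 [v [q [y0alc Wv /lattice_A'[c ->] e0]]]]|].
  left; have [w Ww wv] := weyl_D' Wv; have [u Wu [wu uw]] := weylV Cdiag Ww.
  (* D need not be surjective, but y0 lies in its image because the affine map from y0 to x D lifts
     through D. *)
  exists ((x - (c *m G) *~ N) *m u), w, c; split=> //; last first.
    by rewrite -mulmxA uw mulmx1 subrK.
  apply/alcP; rewrite (_ : _ *m D = y0) //; have ATdiag i : A^T i i = 2.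
    by rewrite mxE (mg_diag mg).
  have [u' _ [vu' u'v]] := weylV ATdiag Wv.
  have uD : u *m D = D *m u'.
    by rewrite -[LHS]mulmx1 -vu' !mulmxA -[u *m D *m v]mulmxA -wv mulmxA uw mul1mx.
  rewrite -mulmxA uD mulmxA mulmxBl G_D e0 addrK -mulmxA vu' mulmx1.
  by [].
move=> [v [q [Wv /lattice_A'[c ->] dv e0]]]; right.
have [w Ww wv] := weyl_D' Wv; exists w, c; split=> //; first by rewrite (det_D wv).
by apply: (@D_inj 1); rewrite mulmxDl G_D -mulmxA wv mulmxA.
Qed.
End Pullback.

(** * Roots of unity *)

Section Expo.
Variables (R : realType) (N : nat).
Hypothesis N_gt0 : (0 < N)%N.

Lemma expiD (x y : R) : expi (x + y) = expi x * expi y.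
Proof.
by rewrite /expi cosD sinD; apply/eqP; rewrite eq_complex /= [cos x * sin y + _]addrC !eqxx.
Qed.

Lemma expi0 : expi (0 : R) = 1.
Proof. by rewrite /expi cos0 sin0. Qed.

Lemma expiN (x : R) : expi (- x) = Num.conj (expi x).
Proof. by rewrite /expi cosN sinN. Qed.

Lemma expi_2pi_int (z : int) : expi (2 * pi * z%:~R : R) = 1.
Proof.
have expi_nat (k : nat) : expi (2 * pi * k%:R : R) = 1.
  elim: k => [|k IH]; first by rewrite mulr0 expi0.
  rewrite -[k.+1]addn1 natrD mulrDr expiD IH mul1r mulr1 mulr_natl /expi cos2pi sin2pi.
  by [].
case: z => k; first exact: expi_nat.
by rewrite NegzE intrN mulrN expiN expi_nat conjC1.
Qed.

Definition expo (q : rat) : R[i] := expi (2 * pi / N%:R * ratr q).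

Lemma expoD p q : expo (p + q) = expo p * expo q.
Proof. by rewrite /expo rmorphD mulrDr expiD. Qed.

Lemma expo0 : expo 0 = 1.
Proof. by rewrite /expo rmorph0 mulr0 expi0. Qed.

Lemma expoN q : expo (- q) = Num.conj (expo q).
Proof. by rewrite /expo rmorphN mulrN expiN. Qed.

Lemma expo_neq0 q : expo q != 0.
Proof.
have : expo q * expo (- q) = 1 by rewrite -expoD subrr expo0.
by apply: contra_eq_neq => ->; rewrite mul0r eq_sym oner_neq0.
Qed.

(** Only the fractional part f of q / N matters; if 0 < f < 1 then sin(pi f) > 0, so cos(2 pi f) <
    1. *)
Lemma expo_eq1 q : expo q = 1 <-> q / N%:R \is a Num.int.
Proof.
have N0 : N%:R != 0 :> rat by rewrite pnatr_eq0 -lt0n.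
have NR : N%:R != 0 :> R by rewrite pnatr_eq0 -lt0n.
have expoE p : expo (p * N%:R) = expi (2 * pi * ratr p).
  by rewrite /expo rmorphM /= ratr_nat; congr expi; field.
split=> [|/intrP[z qE]]; last first.
  by rewrite -[q](divfK N0) qE expoE ratr_int expi_2pi_int.
set x := q / N%:R => e1; pose z := Num.floor x; pose f := x - z%:~R.
have /andP[f0 f1] : 0 <= f < 1.
  by rewrite /f subr_ge0 ltrBlDl ge_floor /= -[1]/(1%:~R) -intrD lt_succ_floor.
have : expi (2 * pi * ratr f : R) = 1.
  rewrite rmorphB /= ratr_int mulrBr expiD expiN expi_2pi_int conjC1 mulr1.
  by rewrite -expoE divfK.
have [f00|f_neq0] := eqVneq f 0.
  by move/eqP: f00; rewrite subr_eq0 => /eqP ->; rewrite intr_int.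
have g0 : 0 < (ratr f : R) by rewrite ltr0q lt_neqAle eq_sym f_neq0.
have g1 : (ratr f : R) < 1 by rewrite -(rmorph1 (ratr : rat -> R)) ltr_rat.
have sin_pos : 0 < sin (pi * ratr f : R).
  apply: sin_gt0_pi.
  by rewrite mulr_gt0 ?pi_gt0 //= gtr_pMr ?pi_gt0.
move=> /(congr1 (@complex.Re _)) /=.
have -> : 2 * pi * ratr f = pi * ratr f + pi * ratr f :> R by ring.
rewrite cosD => e; have := cos2Dsin2 (pi * ratr f : R); move: e; rewrite -!expr2 => e.
have : 0 < sin (pi * ratr f : R) ^+ 2 by rewrite exprn_gt0.
by lra.
Qed.
End Expo.

Section Box.
Variables (n K : nat).
Local Notation box := 'rV['I_K.+2]_n.

(** The box is the lattice modulo K + 2, with representatives in [0, K + 1]. Sums of periodic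
    functions over this finite group stand for sums over the quotients of the lattices. *)
Definition box_rep (z : box) : 'rV[int]_n := map_mx (fun k : 'I_K.+2 => (k : nat)%:Z) z.
Definition box_red (x : 'rV[int]_n) : box := map_mx (fun k : int => k%:~R : 'I_K.+2) x.

Lemma box_repK : cancel box_rep box_red.
Proof. by move=> z; apply/rowP=> i; rewrite !mxE /= -pmulrn natr_Zp. Qed.

Lemma box_redD x y : box_red (x + y) = box_red x + box_red y.
Proof. by apply/rowP=> i; rewrite !mxE intrD. Qed.

Lemma intr_Zp_eq0 (a : int) : (a%:~R = 0 :> 'I_K.+2) -> (K.+2 %| a)%Z.
Proof.
have nat_eq0 (k : nat) : (k%:R = 0 :> 'I_K.+2) -> (K.+2 %| k)%N.
  move=> k0; rewrite /dvdn -(@val_Zp_nat K.+2 isT k); apply/eqP.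
  exact: (congr1 val k0).
case: a => k; first by rewrite -pmulrn => /nat_eq0.
rewrite NegzE intrN => /eqP; rewrite oppr_eq0 => /eqP; rewrite -pmulrn => /nat_eq0.
by rewrite rpredN.
Qed.

Lemma box_redP x y : box_red x = box_red y -> exists c, x = y + c *~ K.+2.
Proof.
move=> /rowP xy; exists (\row_i (row_coord i (x - y) %/ K.+2)%Z); apply/rowP=> i.
rewrite -scaler_int intz /row_coord !mxE mulrC divzK; first by rewrite addrC subrK.
apply: intr_Zp_eq0; have := xy i; rewrite !mxE intrB => ->.
by rewrite subrr.
Qed.

Lemma box_red_rep x : exists c, box_rep (box_red x) = x + c *~ K.+2.
Proof. by apply: box_redP; rewrite box_repK. Qed.

Definition box_periodic (V : Type) (f : 'rV[int]_n -> V) :=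
  forall x c, f (x + c *~ K.+2) = f x.

Lemma sum_box_shift (V : nmodType) (f : 'rV[int]_n -> V) a : box_periodic f ->
  \sum_z f (box_rep z + a) = \sum_z f (box_rep z).
Proof.
move=> fK; rewrite [RHS](reindex_inj (addIr (box_red a))) /=.
apply: eq_bigr => z _; rewrite -{2}[z]box_repK -box_redD.
by have [c ->] := box_red_rep (box_rep z + a).
Qed.
End Box.

(** * Alternating sums of characters on dual lattices *)

(* [F] is the Gram matrix of the pairing of two lattices, on which the Weyl     *)
(* groups of [A] and [A'] act; the rows of [G] and [G'] span the lattices that  *)
(* are dual to them under this pairing.                                         *)
Record duality n (A A' : 'M[int]_n) (F : 'M[rat]_n) (G G' : 'M[int]_n) (N : nat)
  (alc alc' : set 'rV[int]_n) : Prop := Duality {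
  du_N : (0 < N)%N;
  du_diag : forall i, A i i = 2;
  du_diag' : forall i, A' i i = 2;
  du_refl : forall i, map_mx intr (simple_refl A i) *m F =
                      F *m (map_mx intr (simple_refl A' i))^T;
  du_G : map_mx intr G *m F = 1%:M;
  du_G' : F *m (map_mx intr G')^T = 1%:M;
  du_fin : finite_set (weyl A);
  du_fin' : finite_set (weyl A');
  du_alc : alcove_data A G N alc;
  du_alc' : alcove_data A' G' N alc' }.

Lemma duality_sym n (A A' : 'M[int]_n) F G G' N alc alc' :
  duality A A' F G G' N alc alc' -> duality A' A F^T G' G N alc' alc.
Proof.
case=> N0 dA dA' FA GF FG fA fA' aA aA'; split=> //.
- by move=> i; have := congr1 trmx (FA i); rewrite !trmx_mul trmxK => ->.
- by have := congr1 trmx FG; rewrite trmx_mul trmxK trmx1.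
- by have := congr1 trmx GF; rewrite trmx_mul trmx1.
Qed.

(** The solution w' of w F = F w'^T, as G F = 1; [numq] turns its entries, integral for w in the
    Weyl group, into integers. *)
Definition adjoint_mx n (G : 'M[int]_n) (F : 'M[rat]_n) (w : 'M[int]_n) : 'M[int]_n :=
  map_mx numq (map_mx intr G *m map_mx intr w *m F)^T.

Definition lattice_char (R : realType) n (F : 'M[rat]_n) (N : nat) (x l : 'rV[int]_n) : R[i] :=
  expo R N (bilin F (toQ x) (toQ l)).

Definition alt_sum (R : realType) n (A : 'M[int]_n) (F : 'M[rat]_n) (N : nat)
    (x l : 'rV[int]_n) : R[i] :=
  \sum_(w \in weyl A) (\det w)%:~R * lattice_char R F N (x *m w) l.

Lemma bilin_tr n (F : 'M[rat]_n) x y : bilin F^T x y = bilin F y x.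
Proof.
rewrite /bilin -[RHS]/((y *m F *m x^T) 0 0) -[y *m F *m x^T]trmxK [RHS]mxE.
by rewrite !trmx_mul trmxK mulmxA.
Qed.

Section Duality.
Variables (R : realType) (n : nat) (A A' : 'M[int]_n) (F : 'M[rat]_n).
Variables (G G' : 'M[int]_n) (N : nat) (alc alc' : set 'rV[int]_n).
Hypothesis du : duality A A' F G G' N alc alc'.
Local Notation psi := (lattice_char R F N).
Local Notation adj := (adjoint_mx G F).
Implicit Types (x y l : 'rV[int]_n) (w : 'M[int]_n).

Lemma lattice_char_sym x l : lattice_char R F^T N l x = psi x l.
Proof. by rewrite /lattice_char bilin_tr. Qed.

Lemma lattice_charDl x y l : psi (x + y) l = psi x l * psi y l.
Proof. by rewrite /lattice_char toQD bilinDl expoD. Qed.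

Lemma lattice_charDr x l l' : psi x (l + l') = psi x l * psi x l'.
Proof. by rewrite /lattice_char toQD bilinDr expoD. Qed.

Lemma lattice_charNl x l : psi (- x) l = Num.conj (psi x l).
Proof. by rewrite /lattice_char toQN bilinNl expoN. Qed.

Lemma lattice_char0 l : psi 0 l = 1.
Proof. by rewrite /lattice_char toQ0 bilin0l expo0. Qed.

Lemma lattice_char_eq1 x l : psi x l = 1 <-> bilin F (toQ x) (toQ l) / N%:R \is a Num.int.
Proof. exact: expo_eq1 (du_N du) _. Qed.

Lemma adjP w : weyl A w ->
  weyl A' (adj w) /\ map_mx intr w *m F = F *m (map_mx intr (adj w))^T.
Proof.
move=> Ww; have [w' Ww' ww'] : exists2 w', weyl A' w' &
    map_mx intr w *m F = F *m (map_mx intr w')^T.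
  elim/weyl_ind: w / Ww => [|i w _ [w' Ww' ww']].
    by exists 1%:M; [exact: weyl1 | rewrite !map_mx1 trmx1 mul1mx mulmx1].
  exists (w' *m simple_refl A' i); first exact: weylM Ww' (weyl_refl _ _).
  by rewrite !map_mxM -mulmxA ww' mulmxA (du_refl du) trmx_mul mulmxA.
suff -> : adj w = w' by [].
rewrite /adjoint_mx -mulmxA ww' mulmxA (du_G du) mul1mx trmxK.
by apply/matrixP=> i j; rewrite !mxE numq_int.
Qed.

Lemma lattice_char_adj x l w : weyl A w -> psi (x *m w) l = psi x (l *m adj w).
Proof.
move=> /adjP[_ ww']; rewrite /lattice_char /bilin !toQM trmx_mul.
by rewrite -[toQ x *m _ *m F]mulmxA ww' !mulmxA.
Qed.

Lemma det_adj w : weyl A w -> \det (adj w) = \det w.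
Proof.
move=> /adjP[_ /(congr1 determinant)]; rewrite !det_mulmx det_tr mulrC => e.
have F0 : \det F != 0.
  have := congr1 determinant (du_G du); rewrite det_mulmx det1.
  by apply: contra_eq_neq => ->; rewrite mulr0 eq_sym oner_neq0.
by apply: (@intr_inj rat); rewrite -!det_map_mx; apply: (mulfI F0); rewrite -e.
Qed.

Lemma adjK w : weyl A w -> adjoint_mx G' F^T (adj w) = w.
Proof.
move=> /adjP[_]; move: (adj w) => w' ww'; rewrite /adjoint_mx.
have e : F^T *m (map_mx intr w)^T = map_mx intr w' *m F^T.
  by have /(congr1 trmx) := ww'; rewrite !trmx_mul trmxK.
have GF : map_mx intr G' *m F^T = 1%:M.
  by have /(congr1 trmx) := du_G' du; rewrite trmx_mul trmxK trmx1.
rewrite -mulmxA -e mulmxA GF mul1mx trmxK.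
by apply/matrixP=> i j; rewrite !mxE numq_int.
Qed.
End Duality.

Section Orthogonality.
Variables (R : realType) (n : nat) (A A' : 'M[int]_n) (F : 'M[rat]_n).
Variables (G G' : 'M[int]_n) (N : nat) (alc alc' : set 'rV[int]_n).
Hypothesis du : duality A A' F G G' N alc alc'.
Let du' := duality_sym du.
Local Notation psi := (lattice_char R F N).
Local Notation adj := (adjoint_mx G F).
Local Notation J := (alt_sum R A F N).
Implicit Types (x y l : 'rV[int]_n) (w : 'M[int]_n).

Lemma adj_bij : set_bij (weyl A) (weyl A') adj.
Proof.
split=> [w Ww|w1 w2 /set_mem W1 /set_mem W2 e|w Ww]; first by have [] := adjP du Ww.
  by rewrite -(adjK du W1) e (adjK du W2).
exists (adjoint_mx G' F^T w); first by have [] := adjP du' Ww.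
by have := adjK du' Ww; rewrite trmxK.
Qed.

(** Moving each w across the pairing turns the sum over one Weyl group into that over the other.
    Orthogonality of columns rests on this. *)
Lemma alt_sum_sym x l : alt_sum R A' F^T N l x = J x l.
Proof.
rewrite /alt_sum (reindex_fsbig _ _ _ _ adj_bij); apply: eq_fsbigr => w /set_mem Ww.
by rewrite lattice_char_sym (lattice_char_adj R du) ?(det_adj du).
Qed.

Lemma alt_sum_mulr x l w : weyl A w -> J (x *m w) l = (\det w)%:~R * J x l.
Proof.
move=> Ww; have [v Wv [wv vw]] := weylV (du_diag du) Ww.
have bij : set_bij (weyl A) (weyl A) (fun u => v *m u).
  split=> [u Wu|u1 u2 _ _ /(congr1 (mulmx w))|u Wu]; first exact: weylM.
    by rewrite !mulmxA wv !mul1mx.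
  by exists (w *m u); [exact: weylM | rewrite mulmxA vw mul1mx].
have fW := du_fin du.
rewrite /alt_sum (reindex_fsbig _ _ _ _ bij) !fsbig_finite // big_distrr /=.
apply: eq_big_seq => u; rewrite in_fset_set // => /set_mem Wu.
rewrite -mulmxA (mulmxA w) wv mul1mx mulrA; congr (_ * _).
rewrite det_mulmx intrM; congr (_ * _); congr (_ %:~R).
have := congr1 determinant wv; rewrite det_mulmx det1.
have [->|->] := det_weyl (du_diag du) Ww; have [->|->] := det_weyl (du_diag du) Wv => //.
Qed.
End Orthogonality.

Section Fourier.
Variables (R : realType) (n : nat) (A A' : 'M[int]_n) (F : 'M[rat]_n).
Variables (G G' : 'M[int]_n) (N : nat) (alc alc' : set 'rV[int]_n).
Hypothesis du : duality A A' F G G' N alc alc'.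
Local Notation psi := (lattice_char R F N).
Local Notation adj := (adjoint_mx G F).
Local Notation J := (alt_sum R A F N).
Implicit Types (x y l : 'rV[int]_n) (w : 'M[int]_n).

Definition trivial_char x := forall l, psi x l = 1.

(** Testing on unit vectors shows that x F / N is integral, and G inverts F. *)
Lemma trivial_charP x : trivial_char x <-> exists c, x = (c *m G) *~ N.
Proof.
have N0 : N%:R != 0 :> rat by rewrite pnatr_eq0 -lt0n (du_N du).
have FG : F *m map_mx intr G = 1%:M := mulmx1C (du_G du).
split=> [tx|[c ->] l]; last first.
  apply/(lattice_char_eq1 R du); rewrite toQMz bilinZl mulrAC -pmulrn mulfV // mul1r.
  rewrite toQM /bilin -[toQ c *m _ *m F]mulmxA (du_G du) mulmx1 mxE.
  by apply: rpred_sum => i _; rewrite !mxE rpredM ?intr_int.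
have xint j : (toQ x *m F) 0 j / N%:R \is a Num.int.
  have /(lattice_char_eq1 R du) := tx (delta_mx 0 j).
  rewrite /bilin /toQ map_delta_mx trmx_delta mul_delta_col.
  by rewrite mxE eqxx mulr1n.
exists (\row_j Num.floor ((toQ x *m F) 0 j / N%:R)).
apply: toQ_inj; rewrite toQMz toQM -[LHS]mulmx1 -FG mulmxA -pmulrn scalemxAl.
congr (_ *m _); apply/rowP=> j; rewrite !mxE.
have := floorK (xint j); rewrite mxE => ->.
by rewrite mulrC divfK.
Qed.

Lemma trivial_charD x y : trivial_char x -> trivial_char y -> trivial_char (x + y).
Proof. by move=> tx ty l; rewrite lattice_charDl tx ty mulr1. Qed.

Lemma trivial_charN x : trivial_char x -> trivial_char (- x).
Proof. by move=> tx l; rewrite lattice_charNl tx conjC1. Qed.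

Lemma trivial_char_weyl x w : weyl A w -> trivial_char x -> trivial_char (x *m w).
Proof. by move=> Ww tx l; rewrite (lattice_char_adj R du) // tx. Qed.

Lemma alt_sum_trivial x y l : trivial_char y -> J (x + y) l = J x l.
Proof.
move=> ty; apply: eq_fsbigr => w /set_mem Ww; congr (_ * _).
by rewrite mulmxDl lattice_charDl (trivial_char_weyl Ww ty) mulr1.
Qed.

Lemma alt_sum_wall x w y l : weyl A w -> \det w = -1 -> trivial_char y ->
  x *m w + y = x -> J x l = 0.
Proof.
move=> Ww dw ty e; have : J x l = - J x l.
  by rewrite -{1}e alt_sum_trivial // (alt_sum_mulr R du) // dw mulrN1z mulNr mul1r.
by move/eqP; rewrite -addr_eq0 -mulr2n mulrn_eq0 /= => /eqP.
Qed.

Lemma alcove_unique x y w v : alc x -> alc y -> weyl A w -> weyl A v ->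
  trivial_char (x *m w - y *m v) -> x = y /\ w = v.
Proof.
move=> ax ay Ww Wv t; have [u Wu [vu uv]] := weylV (du_diag du) Wv.
have /trivial_charN/trivial_charP[c cE] := trivial_char_weyl Wu t.
have yE : y = x *m (w *m u) + (c *m G) *~ N.
  rewrite -cE mulmxBl opprB -[y *m v *m u]mulmxA vu mulmx1 mulmxA.
  by rewrite addrC subrK.
have [wu xE] := alc_free (du_alc du) (weylM Ww Wu) ax (eq_ind _ alc ay _ yE).
split; first by rewrite yE xE.
by rewrite -[w]mulmx1 -uv mulmxA wu mul1mx.
Qed.

Lemma box_period : exists K, forall x l,
  psi (x *~ K.+2) l = 1 /\ psi x (l *~ K.+2) = 1.
Proof.
have [D D0 DF] := common_denominator (fun ij : 'I_n * 'I_n => F ij.1 ij.2).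
(* The factor 2 makes the period at least 2, as the form [K.+2] requires. *)
have N0 := du_N du; exists (2 * N * D).-2 => x l.
have K2 : (2 * N * D).-2.+2 = (2 * N * D)%N.
  have : (0 < N * D)%N by rewrite muln_gt0 N0 D0.
  by rewrite -mulnA; move: (N * D)%N => k; lia.
have NQ : N%:R != 0 :> rat by rewrite pnatr_eq0 -lt0n.
have bint : D%:R * bilin F (toQ x) (toQ l) \is a Num.int.
  rewrite bilin_sum mulr_sumr; apply: rpred_sum => i _; rewrite mulr_sumr.
  apply: rpred_sum => j _; rewrite !mxE.
  rewrite (_ : _ * _ = D%:R * F i j * (x 0 i)%:~R * (l 0 j)%:~R); last by ring.
  apply: rpredM; last exact: intr_int.
  by apply: rpredM (DF (i, j)) _; apply: intr_int.
have kint : (2 * N * D)%N%:R * bilin F (toQ x) (toQ l) / N%:R \is a Num.int.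
  rewrite (_ : _ / _ = 2 * (D%:R * bilin F (toQ x) (toQ l))).
    by rewrite rpredM.
  by rewrite !natrM; field.
rewrite K2; split; apply/(lattice_char_eq1 R du); rewrite toQMz.
  by rewrite bilinZl -pmulrn.
by rewrite bilinZr -pmulrn.
Qed.

Section Period.
Variable K : nat.
Hypothesis KP : forall x l, psi (x *~ K.+2) l = 1 /\ psi x (l *~ K.+2) = 1.
Local Notation box := 'rV['I_K.+2]_n.
Local Notation rep := (@box_rep n K).

(** Shifting the sum by l0 multiplies it by psi(x, l0), which is not 1 for a suitable l0 if the
    character is nontrivial. *)
Lemma sum_lattice_char x :
  \sum_(z : box) psi x (rep z) = if `[< trivial_char x >] then #|box|%:R else 0.
Proof.
case: asboolP => [tx|ntx]; first by under eq_bigr do rewrite tx; rewrite sumr_const.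
have [l0 l01] : exists l0, psi x l0 != 1.
  by apply: contrapT => h; apply: ntx => l; apply/eqP/negPn/negP => ?; apply: h; exists l.
have per : box_periodic K (psi x).
  by move=> l c; rewrite lattice_charDr (KP _ _).2 mulr1.
have := sum_box_shift l0 per; under eq_bigr do rewrite lattice_charDr.
rewrite -big_distrl /= => /eqP; rewrite -subr_eq0 -[X in _ - X]mulr1 -mulrBr mulf_eq0.
by rewrite subr_eq0 (negPf l01) orbF => /eqP.
Qed.

Definition trivial_count := #|[pred z : box | `[< trivial_char (rep z) >]]|.

Lemma trivial_char_periodic : box_periodic K (fun y => `[< trivial_char y >]).
Proof.
move=> y c; have tc : trivial_char (c *~ K.+2) by move=> l; apply: (KP _ _).1.
apply: asbool_equiv_eq; split=> [t|t]; last exact: trivial_charD.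
by rewrite -[y](addrK (c *~ K.+2)); apply: trivial_charD => //; apply: trivial_charN.
Qed.

Lemma finite_alcove : finite_set alc.
Proof.
pose g (z : box) := xget 0 [set x | alc x /\ box_red K x = z]%classic.
apply: (@sub_finite_set _ _ (range g)); last exact/finite_image/finite_finset.
move=> x ax; exists (box_red K x) => //; rewrite /g; case: xgetP => [y _ [ay e]|/(_ x)[]//].
have [c cE] := box_redP e.
have [|//] := @alcove_unique y x 1%:M 1%:M ay ax (weyl1 _) (weyl1 _).
by rewrite !mulmx1 cE addrC addKr => l; apply: (KP _ _).1.
Qed.

(** A point of the box is either congruent to x w modulo the kernel for exactly one pair of an
    alcove point x and w in the Weyl group, or fixed by an element of determinant -1, where f
    vanishes. Each pair accounts for [trivial_count] points. *)
Lemma sum_box_orbits (V : numDomainType) (f : 'rV[int]_n -> V) :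
    (forall x w, weyl A w -> f (x *m w) = f x) ->
    (forall x y, trivial_char y -> f (x + y) = f x) ->
    (forall x w y, weyl A w -> \det w = -1 -> trivial_char y -> x *m w + y = x -> f x = 0) ->
  \sum_(z : box) f (rep z) =
  (size (finmap.enum_fset (fset_set (weyl A))) * trivial_count)%:R *
    \sum_(x <- finmap.enum_fset (fset_set alc)) f x.
Proof.
have finW := du_fin du; have finA := finite_alcove; move=> fW ft f0.
set Ws := finmap.enum_fset _; set alcs := finmap.enum_fset (fset_set alc).
have WsP w : w \in Ws -> weyl A w by rewrite in_fset_set // => /set_mem.
have alcsP x : x \in alcs -> alc x by rewrite in_fset_set // => /set_mem.
have sumE (z : box) : f (rep z) = \sum_(x <- alcs) \sum_(w <- Ws)
    (`[< trivial_char (rep z - x *m w) >])%:R * f x.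
  have fx x w : w \in Ws -> trivial_char (rep z - x *m w) -> f x = f (rep z).
    move=> /WsP Ww t; rewrite -[rep z](subrK (x *m w)) addrC.
    by rewrite ft // fW.
  case: (alc_repr (du_alc du) (rep z)) => [[x0 [w0 [c [ax0 Ww0 zE]]]]|]; last first.
    move=> [w [c [Ww dw zE]]].
    have z0 : f (rep z) = 0 by apply: (f0 _ w _ _ dw _ zE) => //; apply/trivial_charP; exists c.
    rewrite z0 big1_seq // => x _; rewrite big1_seq // => v /andP[_ vW].
    by case: asboolP => [/(fx _ _ vW) ->|_]; rewrite ?z0 ?mulr0 ?mul0r.
  have tc : trivial_char ((c *m G) *~ N) by apply/trivial_charP; exists c.
  have fz : f (rep z) = f x0 by rewrite zE ft // fW.
  have x0in : x0 \in alcs by rewrite in_fset_set //; apply/mem_set.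
  have w0in : w0 \in Ws by rewrite in_fset_set //; apply/mem_set.
  have uniq_xw x w : x \in alcs -> w \in Ws -> trivial_char (rep z - x *m w) ->
      x = x0 /\ w = w0.
    move=> /alcsP ax /WsP Ww t; apply: alcove_unique => //.
    have := trivial_charD (trivial_charN t) tc.
    by rewrite zE opprB opprD addrA subrK.
  rewrite (bigD1_seq x0) ?finmap.fset_uniq //= [X in _ + X]big1_seq ?addr0.
    rewrite (bigD1_seq w0) ?finmap.fset_uniq //= [X in _ + X]big1_seq ?addr0.
      case: asboolP => [_|[]]; first by rewrite mul1r fz.
      by rewrite zE addrC addKr.
    move=> w /andP[nw win]; case: asboolP => [t|]; last by rewrite mul0r.
    by have [_ ww0] := uniq_xw _ _ x0in win t; rewrite ww0 eqxx in nw.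
  move=> x /andP[nx xin]; rewrite big1_seq // => w /andP[_ win].
  case: asboolP => [t|]; last by rewrite mul0r.
  by have [xx0 _] := uniq_xw _ _ xin win t; rewrite xx0 eqxx in nx.
under eq_bigr do rewrite sumE.
rewrite exchange_big /= big_distrr /=; apply: eq_bigr => x _.
rewrite exchange_big /=.
have cnt w : \sum_(z : box) (`[< trivial_char (rep z - x *m w) >])%:R * f x =
    trivial_count%:R * f x.
  rewrite -big_distrl /=; congr (_ * _).
  have per : box_periodic K (fun y => (`[< trivial_char y >])%:R : V).
    by move=> y c; rewrite trivial_char_periodic.
  rewrite (sum_box_shift (- (x *m w)) per) -natr_sum; congr (_ %:R).
  rewrite /trivial_count -sum1_card [RHS]big_mkcond; apply: eq_bigr => z _.
  by rewrite inE /=; case: asboolP.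
under eq_bigr do rewrite cnt.
by rewrite big_const_seq count_predT iter_addr_0 -[LHS]mulr_natl natrM -mulrA.
Qed.

(** After expansion only terms with x w congruent to y v survive; [alcove_unique] then forces x = y
    and w = v, and each such term gives the size of the box. *)
Lemma sum_alt_sum_box x y : alc x -> alc y ->
  \sum_(z : box) J x (rep z) * Num.conj (J y (rep z)) =
  (x == y)%:R * (#|box| * size (finmap.enum_fset (fset_set (weyl A))))%:R.
Proof.
have finW := du_fin du; move=> ax ay; set Ws := finmap.enum_fset _.
have WsP w : w \in Ws -> weyl A w by rewrite in_fset_set // => /set_mem.
have JE u l : J u l = \sum_(w <- Ws) (\det w)%:~R * psi (u *m w) l.
  by rewrite /alt_sum fsbig_finite.
have termE z : J x (rep z) * Num.conj (J y (rep z)) =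
   \sum_(w <- Ws) \sum_(v <- Ws) (\det w * \det v)%:~R * psi (x *m w - y *m v) (rep z).
  rewrite !JE rmorph_sum /= big_distrlr /=; apply: eq_bigr => w _; apply: eq_bigr => v _.
  rewrite rmorphM /= rmorph_int lattice_charDl lattice_charNl intrM; ring.
under eq_bigr do rewrite termE.
rewrite exchange_big /=; under eq_bigr do rewrite exchange_big /=.
under eq_bigr => w _ do under eq_bigr => v _ do rewrite -big_distrr /= sum_lattice_char.
have [<-|nxy] := eqVneq x y; last first.
  rewrite mul0r big1_seq // => w /andP[_ /WsP Ww]; rewrite big1_seq // => v /andP[_ /WsP Wv].
  case: asboolP => [/(alcove_unique ax ay Ww Wv)[xy _]|]; last by rewrite mulr0.
  by rewrite xy eqxx in nxy.
have inner w : w \in Ws -> \sum_(v <- Ws) (\det w * \det v)%:~R *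
    (if `[< trivial_char (x *m w - x *m v) >] then #|box|%:R else 0) = #|box|%:R :> R[i].
  move=> win; rewrite (bigD1_seq w) ?finmap.fset_uniq //= [X in _ + X]big1_seq ?addr0.
    rewrite subrr; case: asboolP => [_|[]]; last exact: lattice_char0.
    by have [->|->] := det_weyl (du_diag du) (WsP _ win); rewrite ?mulrNN mulr1 mul1r.
  move=> v /andP[vw /WsP Wv]; case: asboolP => [t|]; last by rewrite mulr0.
  by have [_ wv] := alcove_unique ax ax (WsP _ win) Wv t; rewrite wv eqxx in vw.
rewrite mul1r (eq_big_seq _ inner) big_const_seq count_predT iter_addr_0.
by rewrite natrM mulr_natr.
Qed.
End Period.
End Fourier.

Section DualOrthogonality.
Variables (R : realType) (n : nat) (A A' : 'M[int]_n) (F : 'M[rat]_n).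
Variables (G G' : 'M[int]_n) (N : nat) (alc alc' : set 'rV[int]_n).
Hypothesis du : duality A A' F G G' N alc alc'.
Let du' := duality_sym du.
Local Notation psi := (lattice_char R F N).
Local Notation J := (alt_sum R A F N).

Section Period.
Variable K : nat.
Hypothesis KP : forall x l, psi (x *~ K.+2) l = 1 /\ psi x (l *~ K.+2) = 1.
Local Notation box := 'rV['I_K.+2]_n.
Local Notation rep := (@box_rep n K).

Let KP' l x : lattice_char R F^T N (l *~ K.+2) x = 1 /\ lattice_char R F^T N l (x *~ K.+2) = 1.
Proof. by rewrite !lattice_char_sym; have [] := KP x l. Qed.

Let box0 : #|{: box}|%:R != 0 :> R[i].
Proof. by rewrite pnatr_eq0 -lt0n; apply/card_gt0P; exists 0. Qed.

(** Summing psi over pairs of box points in the two orders counts either kernel. *)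
Lemma trivial_count_tr : trivial_count R F^T N K = trivial_count R F N K.
Proof.
have count_sum (F0 : 'M[rat]_n) : \sum_(z : box) (if `[< trivial_char R F0 N (rep z) >]
    then #|{: box}|%:R else 0) = #|{: box}|%:R * (trivial_count R F0 N K)%:R :> R[i].
  by rewrite -big_mkcond sumr_const mulr_natr; congr (_ *+ _).
apply/eqP; rewrite -(eqr_nat R[i]) -(inj_eq (mulfI box0)) -!count_sum; apply/eqP.
under eq_bigr do rewrite -(sum_lattice_char KP').
rewrite exchange_big /=; apply: eq_bigr => z _.
by rewrite -(sum_lattice_char KP); apply: eq_bigr => z' _; rewrite lattice_char_sym.
Qed.

(** The two evaluations of the sum over the box are compared; the orders of the two Weyl groups
    agree by [adj_bij] and cancel. *)
Lemma alt_sum_orthogonal x y : alc x -> alc y ->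
  (trivial_count R F N K)%:R *
    (\sum_(l <- finmap.enum_fset (fset_set alc')) J x l * Num.conj (J y l)) =
  (x == y)%:R * #|{: box}|%:R.
Proof.
have fW := du_fin du; have fW' := du_fin' du; move=> ax ay.
have := sum_alt_sum_box du KP ax ay.
have JE u l : J u l = alt_sum R A' F^T N l u by rewrite (alt_sum_sym R du).
have dsq w : weyl A' w -> (\det w)%:~R * (\det w)%:~R = 1 :> R[i].
  by move=> Ww; have [->|->] := det_weyl (du_diag du') Ww; rewrite -intrM ?mulrNN mulr1.
rewrite (sum_box_orbits du' KP' (f := fun l => J x l * Num.conj (J y l))).
- have -> : size (finmap.enum_fset (fset_set (weyl A'))) =
            size (finmap.enum_fset (fset_set (weyl A))).
    have := reindex_fsbig (op := addn) _ _ _ (fun=> 1%N) (adj_bij du).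
    by rewrite !fsbig_finite // !big_const_seq !count_predT !iter_addn_0 !mul1n.
  have W0 : (size (finmap.enum_fset (fset_set (weyl A))))%:R != 0 :> R[i].
    rewrite pnatr_eq0 size_eq0; apply/eqP => e.
    have : 1%:M \in finmap.enum_fset (fset_set (weyl A)).
      by rewrite in_fset_set //; apply/mem_set/weyl1.
    by rewrite e.
  rewrite !natrM trivial_count_tr => e; apply: (mulfI W0); rewrite mulrA e.
  by rewrite mulrA mulrC.
- move=> l w Ww; rewrite !JE !(alt_sum_mulr R du') // rmorphM /= rmorph_int.
  by rewrite mulrACA dsq // mul1r.
- by move=> l l' tl; rewrite !JE !(alt_sum_trivial du').
- by move=> l w l' Ww dw tl e; rewrite JE (alt_sum_wall du' _ Ww dw tl e) mul0r.
Qed.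
End Period.
End DualOrthogonality.

Section NonVanishing.
Variables (R : realType) (n : nat) (A A' : 'M[int]_n) (F : 'M[rat]_n).
Variables (G G' : 'M[int]_n) (N : nat) (alc alc' : set 'rV[int]_n).
Hypothesis du : duality A A' F G G' N alc alc'.
Variables (del : 'I_n -> rat) (B : 'M[rat]_n).
Hypothesis fd : finite_datum A del B.
Let du' := duality_sym du.
Local Notation psi := (lattice_char R F N).
Local Notation J := (alt_sum R A F N).
Local Notation rho := (sum_fundamental n).
Local Notation b x y := (bilin B (toQ x) (toQ y)).
Implicit Types (x y l : 'rV[int]_n).

(** For each v in the alternating sum, substitute u v for u in the orbit sum. *)
Lemma orbit_sum_mul x l :
  (\sum_(u \in weyl A) psi (x *m u) l) * J rho l = \sum_(u \in weyl A) J (x *m u + rho) l.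
Proof.
have fW := du_fin du; rewrite /alt_sum !fsbig_finite //.
set Ws := finmap.enum_fset _.
have WsP w : w \in Ws -> weyl A w by rewrite in_fset_set // => /set_mem.
under [RHS]eq_bigr do rewrite fsbig_finite //.
rewrite -/Ws big_distrlr /= exchange_big [RHS]exchange_big /=; apply: eq_big_seq => v vW.
have Wv := WsP _ vW; have [v' Wv' [vv' v'v]] := weylV (du_diag du) Wv.
have bij : set_bij (weyl A) (weyl A) (fun u => u *m v).
  split=> [u Wu|u1 u2 _ _ /(congr1 (mulmx^~ v'))|u Wu]; first exact: weylM.
    by rewrite -!mulmxA vv' !mulmx1.
  by exists (u *m v'); [exact: weylM | rewrite -mulmxA v'v mulmx1].
have := reindex_fsbig (op := GRing.add) _ _ _
  (fun u => psi (x *m u) l * ((\det v)%:~R * psi (rho *m v) l)) bij.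
rewrite !fsbig_finite // => ->; apply: eq_bigr => u _.
by rewrite mulmxDl lattice_charDl mulmxA mulrCA.
Qed.

(** The vector x - x u is a nonzero positive combination of simple roots, so the pairing with rho
    drops while the norm of x stays. *)
Lemma dominant_orbit_norm x u : weyl A u -> dominant x -> x *m u <> x ->
  b (x *m u + rho) (x *m u + rho) < b (x + rho) (x + rho).
Proof.
move=> Wu xdom xu; have [w Ww [dom [c cE]]] := climb_dominant fd (x *m u).
rewrite -mulmxA in dom cE; rewrite (dominant_weyl_eq fd (weylM Wu Ww) xdom dom) in cE.
have xE : x = x *m u + \sum_i simple_root A i *+ c i by rewrite -cE addrC subrK.
have : 0 < b rho (\sum_i simple_root A i *+ c i).
  rewrite (_ : toQ (\sum_i _) = \sum_i (c i)%:R *: toQ (simple_root A i)).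
    rewrite (fd_root_comb fd); have t_ge0 i : 0 <= (c i)%:R * del i * toQ rho 0 i.
      by rewrite !mxE mulr1 mulr_ge0 // ltW // (fd_pos fd).
    rewrite lt_neqAle sumr_ge0 // andbT eq_sym; apply/eqP => s0.
    apply: xu; rewrite [RHS]xE [X in _ + X]big1 ?addr0 // => i _.
    have /eqP := psumr_eq0P (fun i _ => t_ge0 i) s0 (i := i) isT.
    rewrite !mxE mulr1 mulf_eq0 (gt_eqF (fd_pos fd i)) orbF pnatr_eq0 => /eqP ->.
    by rewrite mulr0n.
  rewrite /toQ raddf_sum; apply: eq_bigr => i _ /=.
  by rewrite raddfMn scaler_nat.
rewrite -cE toQB bilinDr bilinNr subr_gt0 => lt.
rewrite !toQD !bilinDl !bilinDr toQM (fd_weyl_norm fd) // -toQM.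
by rewrite !(fdC fd _ (toQ rho)); lra.
Qed.

(** Induction on the norm of x, taken dominant. On a wall J_x vanishes by antisymmetry. Otherwise
    the product of the orbit sum of x - rho with J_rho is zero; its terms outside the stabilizer of
    x - rho are shorter, hence zero, and the others add up to a positive multiple of J_x. *)
Lemma alt_sum_vanish l : J rho l = 0 -> forall x, J x l = 0.
Proof.
move=> rho0; have [mu muP] := bilin_measure B 0.
have {}muP x y : b x x < b y y -> (mu x < mu y)%N.
  by move=> xy; apply: muP; rewrite !subr0 (fd_ge0 fd).
move=> x; have [k] := ubnP (mu x); elim: k x => // k IH x mux.
have [w Ww [dom _]] := climb_dominant fd x; have norm := fd_weyl_norm fd (toQ x) Ww.
rewrite -toQM in norm; suff : J (x *m w) l = 0.
  rewrite (alt_sum_mulr R du) //.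
  have [->|->] := det_weyl (du_diag du) Ww; rewrite ?mul1r // mulN1r => /eqP.
  by rewrite oppr_eq0 => /eqP.
move: (x *m w) dom norm => y ydom yx.
case: (pickP (fun i => y 0 i == 0)) => [i /eqP yi|yn0].
  apply: (alt_sum_wall (y := 0) du l (weyl_refl A i)).
  - by apply: det_simple_refl; apply: du_diag du i.
  - exact: lattice_char0.
  - by rewrite mul_simple_refl yi mulr0z subr0 addr0.
have ldom : dominant (y - rho).
  move=> i; rewrite /sum_fundamental !mxE; have := ydom i; have /eqP := negbT (yn0 i).
  by move: (y 0 i) => t; lia.
have fW := du_fin du; have := orbit_sum_mul (y - rho) l; rewrite rho0 mulr0 fsbig_finite //.
set Ws := finmap.enum_fset _ => /esym.
have WsP u : u \in Ws -> weyl A u by rewrite in_fset_set // => /set_mem.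
have termE u : u \in Ws -> J ((y - rho) *m u + rho) l =
    if (y - rho) *m u == y - rho then J y l else 0.
  move=> /WsP Wu; case: eqP => [->|ne]; first by rewrite subrK.
  apply: IH; rewrite -ltnS; apply: leq_trans (mux); rewrite ltnS; apply: muP.
  by rewrite -yx; have := dominant_orbit_norm Wu ldom ne; rewrite subrK.
rewrite (eq_big_seq _ termE) -big_mkcond big_const_seq iter_addr_0 => /eqP.
(* The number of stabilizing elements is not zero, as it counts the identity. *)
rewrite mulrn_eq0 => /orP[|/eqP//]; rewrite -leqn0 leqNgt -has_count => /hasPn/(_ 1%:M).
rewrite in_fset_set // mulmx1 eqxx => h; have : false by apply/h/mem_set/weyl1.
by [].
Qed.

(** Otherwise the whole column of l would vanish, against the orthogonality relation for the
    exchanged lattices. *)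
Lemma alt_sum_rho_neq0 l : alc' l -> J rho l != 0.
Proof.
move=> al; apply/eqP => /alt_sum_vanish J0.
have [K KP] := box_period R du.
have KP' l' x : lattice_char R F^T N (l' *~ K.+2) x = 1 /\
    lattice_char R F^T N l' (x *~ K.+2) = 1.
  by rewrite !lattice_char_sym; have [] := KP x l'.
have := alt_sum_orthogonal du' KP' al al.
rewrite big1 => [|x _]; last by rewrite (alt_sum_sym R du) J0 mul0r.
rewrite mulr0 eqxx mul1r => /esym/eqP; rewrite pnatr_eq0 => /eqP c0.
have : (0 < #|{: 'rV['I_K.+2]_n}|)%N by apply/card_gt0P; exists 0.
by rewrite c0.
Qed.
End NonVanishing.

(** * Marks of the finite Dynkin diagrams *)

Definition bond_mx n (bs : seq bond) : 'M[int]_n :=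
  \matrix_(i, j) bond_entry bs i.+1 j.+1.

Lemma cartan_bond_mx X : cartan X = bond_mx (affine_rank X) (dynkin_diagram X).
Proof. by apply/matrixP=> i j; rewrite !mxE. Qed.

(** The contribution of a bond to the sum of - a_qp m_p over the vertices p other than q. *)
Definition bond_weight (m : nat -> nat) (q : nat) (b : bond) : nat :=
  ((if b.1.1 == q then m b.1.2 else 0) + (if b.1.2 == q then b.2 * m b.1.1 else 0))%N.

(* [d], [m] and [f] are symmetrizer, marks and Dynkin labels of the highest     *)
(* root, as functions of the vertex number; the vertex 0 is to be deleted.      *)
Definition bond_check n (bs : seq bond) (d m f : nat -> nat) (r : nat) : bool :=
  [&& all (fun b : bond => [&& b.1.1 != b.1.2, b.1.1 <= n, b.1.2 <= n &
        [|| b.1.1 == 0, b.1.2 == 0 | d b.1.1 == b.2 * d b.1.2]])%N bs,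
      m 0 == 0,
      all (fun q => [&& 0 < d q, 0 < m q, (d q == r) || (d q == 1), r %| d q * m q &
        2 * m q == f q + sumn (map (bond_weight m q) bs)])%N (iota 1 n),
      has (fun q => d q == r) (iota 1 n),
      sumn [seq m q * d q * f q | q <- iota 1 n] == 2 * r &
      (* Connectedness: each vertex above 1 is bonded to a smaller positive one. *)
      all (fun q => has (fun b : bond => (0 < b.2) &&
        (((b.1.1 == q) && (0 < b.1.2 < q)) || ((b.1.2 == q) && (0 < b.1.1 < q)))) bs)
        (iota 2 n.-1)]%N.

Section BondCheck.
Variables (n : nat) (bs : seq bond) (d m f : nat -> nat) (r : nat).
Hypothesis chk : bond_check n bs d m f r.

Let pair_weight (p q : nat) (b : bond) : nat :=
  ((b.1 == (p, q)) + (b.1 == (q, p)) * b.2)%N.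

Let bond_ok (b : bond) : b \in bs -> [/\ b.1.1 != b.1.2, (b.1.1 <= n)%N, (b.1.2 <= n)%N &
  [|| b.1.1 == 0%N, b.1.2 == 0%N | d b.1.1 == (b.2 * d b.1.2)%N]].
Proof. by case/and5P: chk => /allP h _ _ _ _ /h /and4P. Qed.

Let vertex_ok q : (0 < q <= n)%N -> [/\ (0 < d q)%N, (0 < m q)%N, (d q == r) || (d q == 1%N),
  (r %| d q * m q)%N & (2 * m q = f q + sumn (map (bond_weight m q) bs))%N].
Proof.
move=> qn; case/and5P: chk => _ _ /allP/(_ q) h _ _; move: h.
by rewrite mem_iota add1n ltnS => /(_ qn)/and5P[? ? ? ? /eqP ?].
Qed.

Let Posz_sumn (T : Type) (s : seq T) (g : T -> nat) :
  (sumn (map g s))%:Z = \sum_(b <- s) (g b)%:Z.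
Proof. by rewrite sumnE big_map (big_morph Posz PoszD (erefl _)). Qed.

Lemma bond_mxE (i j : 'I_n) : bond_mx n bs i j =
  2 * (i == j)%:Z - \sum_(b <- bs) (pair_weight i.+1 j.+1 b)%:Z.
Proof.
rewrite mxE /bond_entry eqSS (inj_eq val_inj) Posz_sumn; case: eqVneq => [->|ij].
  rewrite big1_seq ?subr0 // => -[[p q] w] /andP[_ /bond_ok[/= npq _ _ _]].
  rewrite /pair_weight /= !xpair_eqE; case: eqP => [<-|//]; rewrite [_ == p]eq_sym (negPf npq).
  by [].
by rewrite mulr0 sub0r.
Qed.

Let dZ (i : 'I_n) := (d i.+1)%:Z.
Let mZ (i : 'I_n) := (m i.+1)%:Z.

Let vP (i : 'I_n) : (0 < i.+1 <= n)%N. Proof. by rewrite ltn_ord. Qed.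

Let m00 : m 0 = 0%N. Proof. by case/and5P: chk => _ /eqP. Qed.

Let pick_sum (p : nat) : (p <= n)%N -> \sum_(i < n) (p == i.+1)%:Z * mZ i = (m p)%:Z.
Proof.
case: p => [|p] pn; first by rewrite big1 ?m00.
rewrite (bigD1 (Ordinal pn)) //= eqxx mul1r big1 ?addr0 // => i.
by rewrite -(inj_eq val_inj) /= eqSS eq_sym => /negPf ->; rewrite mul0r.
Qed.

Lemma bond_mx_marks (j : 'I_n) : root_comb (bond_mx n bs) mZ 0 j = (f j.+1)%:Z.
Proof.
have [_ _ _ _ e] := vertex_ok (vP j).
rewrite root_combE; under eq_bigr => i _ do rewrite bond_mxE mulrBl mulr_suml.
rewrite sumrB exchange_big /= (bigD1 j) //= eqxx mulr1 [X in _ + X - _]big1 => [|i ij]; last first.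
  by rewrite eq_sym (negPf ij) mulr0 mul0r.
apply/eqP; rewrite addr0 subr_eq.
have -> : 2 * mZ j = (2 * m j.+1)%N%:Z by rewrite PoszM.
rewrite e PoszD Posz_sumn; apply/eqP; congr (_ + _).
apply: eq_big_seq => -[[p q] w] /bond_ok[/= _ pn qn _]; rewrite /bond_weight /pair_weight /=.
have term (i : 'I_n) : (((p, q) == (j.+1, i.+1)) + ((p, q) == (i.+1, j.+1)) * w)%N%:Z * mZ i =
    (p == j.+1)%:Z * ((q == i.+1)%:Z * mZ i) + (q == j.+1)%:Z * w%:Z * ((p == i.+1)%:Z * mZ i).
  rewrite !xpair_eqE PoszD PoszM.
  by case: (p == _); case: (q == _); case: (p == _); case: (q == _); rewrite /=; ring.
under [RHS]eq_bigr do rewrite term.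
rewrite big_split /= -!mulr_sumr !pick_sum // PoszD.
by case: (p == _); case: (q == _); rewrite ?PoszM /=; ring.
Qed.

Lemma bond_mx_sym (i j : 'I_n) : dZ i * bond_mx n bs i j = dZ j * bond_mx n bs j i.
Proof.
rewrite !bond_mxE !mulrBr; congr (_ - _).
  by rewrite [j == i]eq_sym; case: eqVneq => [->//|_]; rewrite !mulr0.
rewrite !mulr_sumr; apply: eq_big_seq => -[[p q] w] /bond_ok[/= _ _ _ ok].
have swt (k l : nat) : (p, q) == (k.+1, l.+1) -> d k.+1 = (w * d l.+1)%N.
  by case/eqP=> pk ql; move: ok; rewrite pk ql => /or3P[//|//|/eqP].
rewrite /pair_weight /dZ /= -!PoszM; congr Posz.
case: (boolP (_ == (i.+1, j.+1))) => [/swt e1|_];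
  case: (boolP (_ == (j.+1, i.+1))) => [/swt e2|_]; lia.
Qed.

Lemma bond_mx_le0 (i j : 'I_n) : i != j -> bond_mx n bs i j <= 0.
Proof.
move=> ij; rewrite bond_mxE (negPf ij) mulr0 sub0r oppr_le0.
by apply: sumr_ge0.
Qed.

(** Descend along bonds to vertex 1; since nonzero entries are symmetric, every vertex is reached
    back from there. *)
Lemma bond_mx_conn : connected_gcm (bond_mx n bs).
Proof.
have dpos (i : 'I_n) : 0 < dZ i by have [] := vertex_ok (vP i).
have sym0 (i j : 'I_n) : bond_mx n bs i j != 0 -> bond_mx n bs j i != 0.
  apply: contra_neq => ji; have /eqP := bond_mx_sym i j; rewrite ji mulr0 mulf_eq0.
  by rewrite gt_eqF // => /eqP.
have down (i : 'I_n) : (0 < i)%N -> exists2 j : 'I_n, (j < i)%N & bond_mx n bs i j != 0.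
  move=> i0; case/and5P: chk => _ _ _ _ /andP[_ /allP h].
  have := h i.+1; rewrite mem_iota => /(_ _)/hasP[|[[p q] w] bin /= /andP[w0 pq]].
    by have := ltn_ord i; lia.
  have nonzero (j : 'I_n) : i != j -> (0 < pair_weight i.+1 j.+1 (p, q, w))%N ->
      bond_mx n bs i j != 0.
    move=> ij pos; rewrite bond_mxE (negPf ij) mulr0 sub0r oppr_eq0 gt_eqF //.
    rewrite (big_rem _ bin) ltr_pwDl ?ltz_nat //.
    by apply: sumr_ge0.
  case/orP: pq => /andP[/eqP e /andP[r0 ri]].
    have jn : (q.-1 < n)%N by have := ltn_ord i; lia.
    have qE : q = q.-1.+1 by lia.
    exists (Ordinal jn) => /=; first lia.
    apply: nonzero; first by rewrite -(inj_eq val_inj) /=; lia.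
    by rewrite /pair_weight /= e -qE eqxx.
  have jn : (p.-1 < n)%N by have := ltn_ord i; lia.
  have pE : p = p.-1.+1 by lia.
  exists (Ordinal jn) => /=; first lia.
  apply: nonzero; first by rewrite -(inj_eq val_inj) /=; lia.
  by rewrite /pair_weight /= e -pE eqxx mul1n addn_gt0 w0 orbT.
move=> S [i0 Si0] Sstep.
have n0 : (0 < n)%N by apply: leq_trans (ltn_ord i0).
have Sz : S (Ordinal n0).
  have [k] := ubnP i0; elim: k i0 Si0 => // k IH i Si ik.
  have [i00|i0] := posnP i; first by rewrite (_ : Ordinal n0 = i) //; apply: val_inj.
  have [j ji Aij] := down i i0; apply: (IH j); first exact: Sstep Si Aij.
  by apply: leq_trans ji _; rewrite -ltnS.
move=> i; have [k] := ubnP i; elim: k i => // k IH i ik.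
have [i00|ipos] := posnP i; first by rewrite (_ : i = Ordinal n0) //; apply: val_inj.
have [j ji Aij] := down i ipos; apply: (Sstep j); last exact: sym0.
by apply: IH; apply: leq_trans ji _; rewrite -ltnS.
Qed.

Lemma bond_marked : marked_gcm (bond_mx n bs) dZ mZ r%:Z.
Proof.
split.
- by move=> i; rewrite mxE /bond_entry eqxx.
- exact: bond_mx_le0.
- exact: bond_mx_conn.
- by move=> i; have [] := vertex_ok (vP i).
- exact: bond_mx_sym.
- by move=> i; have [] := vertex_ok (vP i).
- by move=> j; rewrite bond_mx_marks.
- case/and5P: chk => _ _ _ _ /andP[/eqP e _].
  rewrite -PoszM -e Posz_sumn -[iota 1 n]/(iota (1 + 0) n) iotaDl big_map.
  rewrite -[X in iota 0 X]subn0 -/(index_iota 0 n) big_mkord.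
  by apply: eq_bigr => j _; rewrite bond_mx_marks !PoszM.
- case/and5P: chk => _ _ _ /hasP[q]; rewrite mem_iota => qn /eqP dq _.
  have jn : (q.-1 < n)%N by lia.
  by exists (Ordinal jn); rewrite /dZ /= (_ : q.-1.+1 = q) ?dq //; lia.
- move=> i; have [_ _ /orP[]/eqP e _ _] := vertex_ok (vP i); rewrite /dZ e; by [left|right].
- by move=> i; have [_ _ _ h _] := vertex_ok (vP i); rewrite /dZ /mZ -PoszM.
Qed.
End BondCheck.

Definition swap_bond (b : bond) : bond := (b.1.2, b.1.1, b.2).

Lemma tr_bond_mx n bs : (bond_mx n bs)^T = bond_mx n (map swap_bond bs).
Proof.
apply/matrixP=> i j; rewrite !mxE /bond_entry eq_sym; case: eqP => // _.
congr (- _%:Z); congr sumn; rewrite -map_comp; apply: eq_map => -[[p q] w] /=.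
by rewrite !xpair_eqE /=; congr (_ + _ * _)%N; rewrite andbC.
Qed.

(** The reversed orientation occurs in diagrams of transposed matrices. *)
Definition chain_bond (e : bool) (i : nat) : bond :=
  if e then (i.+1, i, 1%N) else (i, i.+1, 1%N).

Lemma chainE p q : chain p q = map (chain_bond false) (iota p (q - p)).
Proof. by []. Qed.

Lemma swap_chainE p q : map swap_bond (chain p q) = map (chain_bond true) (iota p (q - p)).
Proof. by rewrite /chain -map_comp. Qed.

Lemma chain_weight m v e p k :
  sumn (map (bond_weight m v) (map (chain_bond e) (iota p k))) =
  ((if p <= v < p + k then m v.+1 else 0) + (if p < v <= p + k then m v.-1 else 0))%N.
Proof.
elim: k p => [|k IH] p /=.
  by rewrite addn0; case: ifPn => [|_]; [lia|]; case: ifPn => //; lia.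
have -> : bond_weight m v (chain_bond e p) =
    ((if p == v then m v.+1 else 0) + (if p.+1 == v then m v.-1 else 0))%N.
  rewrite /bond_weight; case: e {IH} => /=; rewrite mul1n; last first.
    by congr (_ + _)%N; case: eqP => [<-|].
  by rewrite addnC; congr (_ + _)%N; case: eqP => [<-|].
rewrite IH; move: (m v.+1) (m v.-1) => x y.
have ifE (c : bool) (z : nat) : (if c then z else 0%N) = (c * z)%N.
  by case: c; rewrite ?mul1n.
rewrite !ifE addnACA -!mulnDl; congr (_ * _ + _ * _)%N; lia.
Qed.

Lemma sumn_pick (g : nat -> nat) c s n : (0 < s <= n)%N ->
  sumn [seq (g q * (c * (q == s)))%N | q <- iota 1 n] = (g s * c)%N.
Proof.
move=> sn; rewrite sumnE big_map (bigD1_seq s) ?iota_uniq ?mem_iota ?add1n ?ltnS //=.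
by rewrite eqxx muln1 big1 ?addn0 // => q /negPf ->; rewrite !muln0.
Qed.

Definition zero_bond n (b : bond) : bool :=
  [&& (b.1.1 == 0) || (b.1.2 == 0), b.1.1 != b.1.2, b.1.1 <= n & b.1.2 <= n]%N.

(** The common shape of B, C and D: a bond z at the vertex 0, a simple chain from 1 to n - 1, and a
    bond x that attaches n. *)
Lemma chain_check n z x e (d m f : nat -> nat) r :
    (2 <= n)%N -> zero_bond n z ->
    [&& x.1.1 != x.1.2, x.1.1 <= n, x.1.2 <= n, 0 < x.2 & d x.1.1 == x.2 * d x.1.2]%N ->
    ((x.1.1 == n) && (0 < x.1.2 < n) || (x.1.2 == n) && (0 < x.1.1 < n))%N ->
    (forall i, (0 < i < n.-1)%N -> d i = d i.+1) ->
    m 0%N = 0%N ->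
    (forall q, (0 < q <= n)%N -> [&& 0 < d q, 0 < m q, (d q == r) || (d q == 1), r %| d q * m q &
      2 * m q == f q + (bond_weight m q x + ((if 0 < q < n.-1 then m q.+1 else 0) +
         (if 1 < q <= n.-1 then m q.-1 else 0)))]%N) ->
    (exists2 q, (0 < q <= n)%N & d q = r) ->
    sumn [seq m q * d q * f q | q <- iota 1 n]%N = (2 * r)%N ->
  bond_check n (z :: x :: map (chain_bond e) (iota 1 (n.-1 - 1))) d m f r.
Proof.
move=> n2 /and4P[z0 z1 z2 z3] /and5P[x1 x2 x3 x4 /eqP x5] xn dchain m0 vert [q0 q0n dq0] norm.
have nE : (1 + (n.-1 - 1) = n.-1)%N by lia.
apply/and5P; split=> //=; [|by rewrite m0| | |rewrite norm eqxx /=].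
- rewrite z1 z2 z3 x1 x2 x3 x5 eqxx !orbT /=.
  have -> : [|| z.1.1 == 0, z.1.2 == 0 | d z.1.1 == z.2 * d z.1.2]%N.
    by case/orP: z0 => ->; rewrite ?orbT.
  rewrite /= all_map; apply/allP => i; rewrite mem_iota nE => i1.
  have di := dchain i i1; case: e => /=; rewrite ?mul1n di ?eqxx ?orbT /=; lia.
- apply/allP=> q; rewrite mem_iota add1n ltnS => qn.
  have := vert q qn; rewrite chain_weight nE.
  have -> // : bond_weight m q z = 0%N.
  rewrite /bond_weight; case: eqP => [e1|_]; case: eqP => [e2|_] //=; move: z0; rewrite ?e1 ?e2.
  - by case/andP: qn; case: (q).
  - by case/andP: qn; case: (q) => //= q' _ _ /eqP ->; rewrite m0.
  - by case/andP: qn; case: (q) => //= q' _ _; rewrite orbF => /eqP ->; rewrite m0 muln0.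
- by apply/hasP; exists q0; rewrite ?mem_iota ?add1n ?ltnS // dq0.
apply/allP => q; rewrite mem_iota => qn; have [qe|qne] := eqVneq q n.
  by rewrite qe x4 xn orbT.
apply/orP; right; apply/orP; right; apply/hasP; exists (chain_bond e q.-1).
  by apply: map_f; rewrite mem_iota; lia.
by case: e => /=; lia.
Qed.

(** The highest root is omega_1 + omega_n; for n = 1 both terms of the label fall on the single
    vertex and give 2. *)
Lemma bond_check_A n : (1 <= n)%N ->
  bond_check n ((n, 0%N, 1%N) :: chain 0 n) (fun=> 1%N) (fun q => (0 < q <= n)%N : nat)
    (fun q => (q == 1%N) + (q == n))%N 1.
Proof.
set d := fun _ : nat => 1%N; move=> n1; rewrite chainE; apply/and5P; split=> //=.
- rewrite leqnn orbT !andbT -lt0n n1 /= all_map; apply/allP=> i.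
  by rewrite mem_iota /= /d; lia.
- apply/allP=> q; rewrite mem_iota add1n ltnS => qn.
  by rewrite chain_weight /bond_weight /d /= dvd1n; do !case: ifPn; lia.
- by apply/hasP; exists 1%N; rewrite ?mem_iota //; lia.
apply/andP; split.
  have -> : [seq (0 < q <= n) * d q * ((q == 1%N) + (q == n)) | q <- iota 1 n]%N =
     [seq ((0 < q <= n) * d q * (1 * (q == 1%N)) + (0 < q <= n) * d q * (1 * (q == n)))%N
       | q <- iota 1 n].
    by apply: eq_map => q; rewrite !mul1n mulnDr.
  have sumD (g h : nat -> nat) s : sumn [seq (g q + h q)%N | q <- s] =
      (sumn (map g s) + sumn (map h s))%N.
    by elim: s => //= a s ->; lia.
  rewrite sumD !sumn_pick /d; lia.
apply/allP=> q; rewrite mem_iota => qn; apply/orP; right; apply/hasP.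
exists (chain_bond false q.-1); first by apply: map_f; rewrite mem_iota; lia.
by rewrite /=; lia.
Qed.

(** The highest root is omega_2, as for D below; for C it is 2 omega_1. *)
Lemma bond_check_B n z e : (3 <= n)%N -> zero_bond n z ->
  bond_check n (z :: (n.-1, n, 2%N) :: map (chain_bond e) (iota 1 (n.-1 - 1)))
    (fun q => (q < n).+1) (fun q => (0 < q) + (1 < q))%N (fun q => 1 * (q == 2))%N 2.
Proof.
move=> n3 z0; apply: chain_check => //=.
- lia.
- by rewrite ltnn leqnn; lia.
- lia.
- by move=> i; lia.
- move=> q qn; have -> : (2 %| (q < n).+1 * ((0 < q) + (1 < q)))%N.
    have [qn'|] := ltnP q n; first by rewrite dvdn_mulr.
    by move=> ?; have -> : ((0 < q) + (1 < q) = 2)%N by lia.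
  by rewrite /bond_weight /=; do !case: ifPn; lia.
- by exists 1%N; lia.
- by rewrite sumn_pick; lia.
Qed.

Lemma bond_check_C n z e : (2 <= n)%N -> zero_bond n z ->
  bond_check n (z :: (n, n.-1, 2%N) :: map (chain_bond e) (iota 1 (n.-1 - 1)))
    (fun q => (n <= q).+1) (fun q => (0 < q) + (0 < q < n))%N (fun q => 2 * (q == 1))%N 2.
Proof.
move=> n2 z0; apply: chain_check => //=.
- by rewrite leqnn; lia.
- lia.
- by move=> i; lia.
- move=> q qn; have -> : (2 %| (n <= q).+1 * ((0 < q) + (0 < q < n)))%N.
    case nq : (n <= q)%N; first by rewrite dvdn_mulr.
    by have -> : ((0 < q) + (0 < q < n) = 2)%N by lia.
  by rewrite /bond_weight /=; do !case: ifPn; lia.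
- by exists n; lia.
- by rewrite sumn_pick; lia.
Qed.

Lemma bond_check_D n z e : (4 <= n)%N -> zero_bond n z ->
  bond_check n (z :: (n.-2, n, 1%N) :: map (chain_bond e) (iota 1 (n.-1 - 1)))
    (fun=> 1%N) (fun q => (0 < q) + (1 < q < n.-1))%N (fun q => 1 * (q == 2))%N 1.
Proof.
move=> n4 z0; apply: chain_check => //=.
- lia.
- by rewrite leqnn; lia.
- lia.
- by move=> q qn; rewrite /bond_weight dvd1n /=; do !case: ifPn; lia.
- by exists 1%N; lia.
- by rewrite sumn_pick; lia.
Qed.

Lemma sum_vertices n (g : nat -> nat) :
  \sum_(i < n) (g i.+1)%:Z = (sumn (map g (iota 1 n)))%:Z.
Proof.
rewrite sumnE big_map -[iota 1 n]/(iota (1 + 0) n) iotaDl big_map.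
rewrite -[X in iota 0 X]subn0 -/(index_iota 0 n) big_mkord.
by rewrite (big_morph Posz PoszD (erefl _)).
Qed.

Lemma sumn_const_on (g : nat -> nat) (c k l : nat) :
  (forall q, k <= q < k + l -> g q = c)%N -> sumn (map g (iota k l)) = (c * l)%N.
Proof.
elim: l k => [|l IH] k gc /=; first by rewrite muln0.
by rewrite IH => [|q qk]; rewrite ?gc ?mulnS //; lia.
Qed.

Lemma sumn_blocks (g : nat -> nat) n p a b c : (2 <= p <= n)%N -> g 1%N = a ->
    (forall q, 1 < q < p -> g q = b)%N -> (forall q, p <= q <= n -> g q = c)%N ->
  sumn (map g (iota 1 n)) = (a + b * (p - 2) + c * (n.+1 - p))%N.
Proof.
move=> pn ga gb gc; have -> : iota 1 n = 1%N :: iota 2 (p - 2) ++ iota p (n.+1 - p).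
  have -> : n = (1 + ((p - 2) + (n.+1 - p)))%N by lia.
  by rewrite iotaD /= iotaD; congr (_ :: _ ++ iota _ _); lia.
rewrite /= map_cat sumn_cat ga (sumn_const_on (c := b)) => [|q qp].
  by rewrite (sumn_const_on (c := c)) ?addnA // => q qp; apply: gc; lia.
by apply: gb; lia.
Qed.

(* The normalized invariant form has [(alpha_i|alpha_i) = 2 d_i / t].           *)
Definition untwisted_marks X (d m : 'I_(affine_rank X) -> int) (r t : int) : Prop :=
  [/\ marked_gcm (cartan X) d m r, 0 < t, t%:~R * theta_norm X = (2 * r)%:~R,
      (forall i j, (d i %| t * cartan X j i)%Z) /\ (forall i, (t %| m i * d i)%Z) &
      \sum_i m i * d i + t = t * (dual_coxeter X)%:Z].

(** With (theta|theta) = 2 the scale t is r, and m_i d_i / r are the comarks, whose sum is h^vee -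
    1. *)
Lemma bond_untwisted_marks X d m f r :
    bond_check (affine_rank X) (dynkin_diagram X) d m f r ->
    theta_norm X = 2 -> (0 < dual_coxeter X)%N ->
    sumn [seq (m q * d q)%N | q <- iota 1 (affine_rank X)] = (r * (dual_coxeter X).-1)%N ->
  exists d m r t, @untwisted_marks X d m r t.
Proof.
move=> /bond_marked mg tn h0 sm; rewrite -cartan_bond_mx in mg.
do 2 eexists; exists r, r; split.
- exact: mg.
- exact: mg_rpos mg.
- by rewrite tn intrM mulrC.
- split=> [i j|i]; last by rewrite mulrC; apply: mg_dvd_long mg i.
  by case: (mg_two mg i) => ->; [rewrite dvdz_mulr | rewrite dvd1z].
under eq_bigr do rewrite -PoszM.
rewrite (sum_vertices _ (fun q => (m q * d q)%N)) sm -PoszD -PoszM; congr Posz.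
by move: h0; case: (dual_coxeter X) => // h _; rewrite /= mulnS addnC.
Qed.

Lemma untwisted_marks_A n (n1 : (1 <= n)%N) : exists d m r t, @untwisted_marks (A_1 n1) d m r t.
Proof.
have chk : bond_check (affine_rank (A_1 n1)) (dynkin_diagram (A_1 n1)) _ _ _ _ := bond_check_A n1.
apply: (bond_untwisted_marks chk) => //.
by rewrite /= (sumn_const_on (c := 1%N)) => [|q]; lia.
Qed.

Lemma untwisted_marks_B n (n3 : (3 <= n)%N) : exists d m r t, @untwisted_marks (B_1 n3) d m r t.
Proof.
have z : zero_bond n (0%N, 2%N, 1%N) by rewrite /zero_bond /=; lia.
have chk : bond_check (affine_rank (B_1 n3)) (dynkin_diagram (B_1 n3)) _ _ _ _ :=
  bond_check_B false n3 z.
apply: (bond_untwisted_marks chk) => //=; first lia.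
by rewrite (@sumn_blocks _ n n 2 4 2); lia.
Qed.

Lemma untwisted_marks_C n (n2 : (2 <= n)%N) : exists d m r t, @untwisted_marks (C_1 n2) d m r t.
Proof.
have z : zero_bond n (0%N, 1%N, 2%N) by rewrite /zero_bond /=; lia.
have chk : bond_check (affine_rank (C_1 n2)) (dynkin_diagram (C_1 n2)) _ _ _ _ :=
  bond_check_C false n2 z.
apply: (bond_untwisted_marks chk) => //=.
by rewrite (@sumn_blocks _ n n 2 2 2); lia.
Qed.

Lemma untwisted_marks_D n (n4 : (4 <= n)%N) : exists d m r t, @untwisted_marks (D_1 n4) d m r t.
Proof.
have z : zero_bond n (0%N, 2%N, 1%N) by rewrite /zero_bond /=; lia.
have chk : bond_check (affine_rank (D_1 n4)) (dynkin_diagram (D_1 n4)) _ _ _ _ :=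
  bond_check_D false n4 z.
apply: (bond_untwisted_marks chk) => //=; first lia.
by rewrite (@sumn_blocks _ n n.-1 1 2 1); lia.
Qed.

(* For A_{2n}^(2) the long root has square length 4, so that [t = 1].           *)
Lemma untwisted_marks_Aeven n (n2 : (2 <= n)%N) :
  exists d m r t, @untwisted_marks (Aeven_2 n2) d m r t.
Proof.
have z : zero_bond n (1%N, 0%N, 2%N) by rewrite /zero_bond /=; lia.
have chk : bond_check (affine_rank (Aeven_2 n2)) (dynkin_diagram (Aeven_2 n2)) _ _ _ _ :=
  bond_check_C false n2 z.
have mg := bond_marked chk; rewrite -cartan_bond_mx in mg.
do 2 eexists; exists 2, 1; split; first exact: mg.
- by [].
- by [].
- split=> [i j|i]; last exact: dvd1z.
  rewrite mul1r /=; have [ni|_] := leqP n i.+1; last exact: dvd1z.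
  have [->|ij] := eqVneq j i; first by rewrite (mg_diag mg).
  have := mg_sym mg j i; rewrite /= ni; case: leqP => [nj|_].
    have il : (i < n)%N := ltn_ord i; have jl : (j < n)%N := ltn_ord j.
    by case/eqP: ij; apply: val_inj; rewrite /= in ni nj il jl *; lia.
  by rewrite mul1r => ->; rewrite dvdz_mulr.
under eq_bigr do rewrite -PoszM.
rewrite (sum_vertices _ (fun q => ((0 < q) + (0 < q < n)) * (n <= q).+1)%N).
by rewrite (@sumn_blocks _ n n 2 2 2); rewrite /=; lia.
Qed.

Lemma untwisted_marks_exceptional X :
  match X with E6_1 | E7_1 | E8_1 | F4_1 | G2_1 => True | _ => False end ->
  exists d m r t, @untwisted_marks X d m r t.
Proof.
case: X => // _.
- have chk : bond_check 6 (dynkin_diagram E6_1) (fun=> 1%N) (nth 0 [:: 0; 1; 2; 3; 2; 1; 2])%N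
    (fun q => (q == 6)%N) 1 by vm_compute.
  exact: (@bond_untwisted_marks E6_1 _ _ _ _ chk).
- have chk : bond_check 7 (dynkin_diagram E7_1) (fun=> 1%N) (nth 0 [:: 0; 2; 3; 4; 3; 2; 1; 2])%N
    (fun q => (q == 1)%N) 1 by vm_compute.
  exact: (@bond_untwisted_marks E7_1 _ _ _ _ chk).
- have chk : bond_check 8 (dynkin_diagram E8_1) (fun=> 1%N) (nth 0 [:: 0; 2; 3; 4; 5; 6; 4; 2; 3])%N
    (fun q => (q == 1)%N) 1 by vm_compute.
  exact: (@bond_untwisted_marks E8_1 _ _ _ _ chk).
- have chk : bond_check 4 (dynkin_diagram F4_1) (nth 0 [:: 0; 2; 2; 1; 1])%N
    (nth 0 [:: 0; 2; 3; 4; 2])%N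
    (fun q => (q == 1)%N) 2 by vm_compute.
  exact: (@bond_untwisted_marks F4_1 _ _ _ _ chk).
- have chk : bond_check 2 (dynkin_diagram G2_1) (nth 0 [:: 0; 3; 1])%N (nth 0 [:: 0; 2; 3])%N
    (fun q => (q == 1)%N) 3 by vm_compute.
  exact: (@bond_untwisted_marks G2_1 _ _ _ _ chk).
Qed.

Lemma untwisted_marks_exist X : untwisted_or_Aeven X ->
  exists d m r t, @untwisted_marks X d m r t.
Proof.
case: X => [n h|n h|n h|n h||||||n h|n h|n h||] //;
  try by move=> _; apply: untwisted_marks_exceptional.
- by move=> _; apply: untwisted_marks_A.
- by move=> _; apply: untwisted_marks_B.
- by move=> _; apply: untwisted_marks_C.
- by move=> _; apply: untwisted_marks_D.
- by move=> _; apply: untwisted_marks_Aeven.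
Qed.

Lemma bond_twisted_marks X bs d m f r : bond_check (affine_rank X) bs d m f r ->
    (sumn [seq m q | q <- iota 1 (affine_rank X)]).+1 = dual_coxeter X ->
  exists d m r, marked_gcm (bond_mx (affine_rank X) bs) d m r /\
    \sum_i m i + 1 = (dual_coxeter X)%:Z.
Proof.
move=> /bond_marked mg sm; do 2 eexists; exists r; split; first exact: mg.
by rewrite (sum_vertices _ m) -sm intS addrC.
Qed.

(** The coweight alcove is bounded by the highest root and the weight alcove by the highest coroot,
    the highest root of the transpose; in both cases the marks add up to h^vee - 1. *)
Lemma twisted_marks_exist X : ~~ untwisted_or_Aeven X ->
  (exists d m r, marked_gcm (cartan X) d m r /\ \sum_i m i + 1 = (dual_coxeter X)%:Z) /\
  (exists d m r, marked_gcm (cartan X)^T d m r /\ \sum_i m i + 1 = (dual_coxeter X)%:Z).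
Proof.
rewrite cartan_bond_mx tr_bond_mx.
case: X => [n h|n h|n h|n h||||||n h|n n3|n n3||] // _.
- have z : zero_bond n (0%N, 2%N, 1%N) by rewrite /zero_bond /=; lia.
  have z' : zero_bond n (2%N, 0%N, 1%N) by rewrite /zero_bond /=; lia.
  split.
    apply: (@bond_twisted_marks (Aodd_2 n3) _ _ _ _ _ (bond_check_C false (ltnW n3) z)).
    by rewrite /= (@sumn_blocks _ n n 2 2 1); lia.
  rewrite [dynkin_diagram _]/= /= swap_chainE.
  apply: (@bond_twisted_marks (Aodd_2 n3) _ _ _ _ _ (bond_check_B true n3 z')).
  by rewrite /= (@sumn_blocks _ n n 1 2 2); lia.
- have z : zero_bond n (1%N, 0%N, 2%N) by rewrite /zero_bond /=; lia.
  have z' : zero_bond n (0%N, 1%N, 2%N) by rewrite /zero_bond /=; lia.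
  split.
    apply: (@bond_twisted_marks (D_2 n3) _ _ _ _ _ (bond_check_B false n3 z)).
    by rewrite /= (@sumn_blocks _ n n 1 2 2); lia.
  rewrite [dynkin_diagram _]/= /= swap_chainE.
  apply: (@bond_twisted_marks (D_2 n3) _ _ _ _ _ (bond_check_C true (ltnW n3) z')).
  by rewrite /= (@sumn_blocks _ n n 2 2 1); lia.
- have chk : bond_check 4 (dynkin_diagram E6_2) (nth 0 [:: 0; 1; 1; 2; 2])%N
    (nth 0 [:: 0; 2; 4; 3; 2])%N (fun q => (q == 4)%N) 2 by vm_compute.
  have chk' : bond_check 4 (map swap_bond (dynkin_diagram E6_2)) (nth 0 [:: 0; 2; 2; 1; 1])%N
    (nth 0 [:: 0; 2; 3; 4; 2])%N (fun q => (q == 1)%N) 2 by vm_compute.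
  by split; [exact: (@bond_twisted_marks E6_2 _ _ _ _ _ chk) |
             exact: (@bond_twisted_marks E6_2 _ _ _ _ _ chk')].
- have chk : bond_check 2 (dynkin_diagram D4_3) (nth 0 [:: 0; 1; 3])%N
    (nth 0 [:: 0; 3; 2])%N (fun q => (q == 2)%N) 3 by vm_compute.
  have chk' : bond_check 2 (map swap_bond (dynkin_diagram D4_3)) (nth 0 [:: 0; 3; 1])%N
    (nth 0 [:: 0; 2; 3])%N (fun q => (q == 1)%N) 3 by vm_compute.
  by split; [exact: (@bond_twisted_marks D4_3 _ _ _ _ _ chk) |
             exact: (@bond_twisted_marks D4_3 _ _ _ _ _ chk')].
Qed.

(** * Inner product and orthonormal basis from a duality *)

Lemma inner_product_intro (C : numClosedFieldType) (V : lmodType C) (form : V -> V -> C) :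
  (forall u v w a, form (a *: u + v) w = a * form u w + form v w) ->
  (forall u v, form u v = Num.conj (form v u)) ->
  (forall u, u != 0 -> 0 < form u u) -> is_inner_product form.
Proof.
move=> lin herm pos.
have linr u v w a : form w (a *: u + v) = Num.conj a * form w u + form w v.
  by rewrite herm lin rmorphD rmorphM /= -!herm.
have herm0 u v : form u v = (-1) ^+ false * Num.conj (form v u) by rewrite expr0 mul1r -herm.
pose mH := isHermitianSesquilinear.Build C V false Num.conj form herm0.
pose mD := isDotProduct.Build C V form pos.
have l1 u : zmod_morphism (form ^~ u).
  by move=> x y; rewrite -scaleN1r addrC lin mulN1r addrC.
have l2 u : zmod_morphism (form u).
  by move=> x y; rewrite -scaleN1r addrC linr rmorphN rmorph1 mulN1r addrC.
have form0 u : form 0 u = 0 by have := l1 u 0 0; rewrite !subrr.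
have form0r u : form u 0 = 0 by have := l2 u 0 0; rewrite !subrr.
have l3 u : scalable_for ( *%R) (form ^~ u) by move=> a x; rewrite -[a *: x]addr0 lin form0 addr0.
have l4 u : scalable_for (Num.conj \; *%R) (form u).
  by move=> a x; rewrite -[a *: x]addr0 linr form0r addr0.
pose mB := isBilinear.Build C V V C ( *%R) (Num.conj \; *%R) form l1 l2 l3 l4.
pose phi : {dot V for (@Num.conj C)} := HB.pack form mB mH mD.
by exists phi.
Qed.

Section Conclusion.
Variables (R : realType) (X : affine_type) (k : nat).
Let n := affine_rank X.
Let A := cartan X.
Let N := (k + dual_coxeter X)%N.
Local Notation rho := (sum_fundamental n).
Variables (A' G G' : 'M[int]_n) (F : 'M[rat]_n) (alc' : set 'rV[int]_n).
Let alc : set 'rV[int]_n := [set x | Pk X k (x - rho)]%classic.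
Hypothesis du : duality A A' F G G' N alc alc'.
Variables (del : 'I_n -> rat) (B : 'M[rat]_n).
Hypothesis fd : finite_datum A del B.
Local Notation psi := (lattice_char R F N).
Local Notation alt := (alt_sum R A F N).
Hypothesis SigmaP : forall t, Sigma R X k t <->
  exists2 l, alc' l & forall x, torus_val t x = psi x l.
Hypothesis latMP : forall q, latM X q <-> exists c : 'rV[int]_n, q = toQ (c *m G).
Let du' := duality_sym du.

Section Card.
Variable K : nat.
Hypothesis KP : forall x l, psi (x *~ K.+2) l = 1 /\ psi x (l *~ K.+2) = 1.
Local Notation box := 'rV['I_K.+2]_n.
Local Notation rep := (@box_rep n K).

Let coset (x : 'rV[int]_n) : set 'rV[rat]_n :=
  [set toQ x + N%:R *: m | m in latM X]%classic.

Let cosetP x y : coset x = coset y <-> trivial_char R F N (x - y).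
Proof.
have cE c : N%:R *: toQ (c *m G) = toQ ((c *m G) *~ N) by rewrite toQMz -pmulrn.
split=> [e|/(trivial_charP R du)[c cP]].
  have : coset x (toQ x).
    by exists 0; [apply/latMP; exists 0; rewrite mul0mx toQ0 | rewrite scaler0 addr0].
  rewrite e => -[q /latMP[c ->]]; rewrite cE -toQD => /toQ_inj xE.
  by apply/(trivial_charP R du); exists c; rewrite -xE addrC addKr.
have xE : x = y + (c *m G) *~ N by rewrite -cP addrC subrK.
apply/seteqP; split=> z [q /latMP[c' ->] <-].
  exists (toQ ((c + c') *m G)); first by apply/latMP; exists (c + c').
  by rewrite xE !cE -!toQD mulmxDl mulrzDl addrA.
exists (toQ ((c' - c) *m G)); first by apply/latMP; exists (c' - c).
rewrite xE !cE -!toQD mulmxBl mulrzBl; congr toQ.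
by rewrite -addrA; congr (_ + _); rewrite addrC subrK.
Qed.

(** Every coset of N M meets the box in a translate of the kernel of psi. *)
Lemma card_quotient_mul :
  (card_quotient X k * trivial_count R F N K = #|{: box}|)%N.
Proof.
rewrite /card_quotient -/N; set Cs := [set coset x | x in [set: 'rV[int]_n]]%classic.
have finC : finite_set Cs.
  apply: (@sub_finite_set _ _ (range (fun z : box => coset (rep z)))).
    move=> C [x _ <-]; exists (box_red K x) => //; apply/cosetP.
    by have [c ->] := box_red_rep K x; rewrite addrC addKr => l; apply: (KP _ _).1.
  exact/finite_image/finite_finset.
set Cl := finmap.enum_fset (fset_set Cs).
have count C : C \in Cl -> (\sum_(z : box) (coset (rep z) == C : nat) =
    trivial_count R F N K)%N.
  rewrite in_fset_set // => /set_mem[x _ <-].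
  have per : box_periodic K (fun y => (`[< trivial_char R F N y >] : nat)).
    by move=> y c; rewrite (trivial_char_periodic KP).
  transitivity (\sum_(z : box) (`[< trivial_char R F N (rep z - x) >] : nat))%N.
    by apply: eq_bigr => z _; congr nat_of_bool; apply/eqP/asboolP => /cosetP.
  rewrite (sum_box_shift (- x) per) /trivial_count -sum1_card [RHS]big_mkcond.
  by apply: eq_bigr => z _; rewrite inE /=; case: asboolP.
have : (\sum_(z : box) \sum_(C <- Cl) (coset (rep z) == C : nat) = #|{: box}|)%N.
  rewrite -sum1_card; apply: eq_bigr => z _.
  have zin : coset (rep z) \in Cl by rewrite in_fset_set //; apply/mem_set; exists (rep z).
  rewrite (bigD1_seq _ zin) ?finmap.fset_uniq //= eqxx big1 ?addn0 // => C.
  by rewrite eq_sym => /negPf ->.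
rewrite exchange_big /= (eq_big_seq _ count) big_const_seq count_predT iter_addn_0.
by rewrite mulnC.
Qed.
End Card.

Let lab (t : set_type (Sigma R X k)) : 'rV[int]_n :=
  xget 0 [set l | alc' l /\ forall x, torus_val (val t) x = psi x l]%classic.

Let labP t : alc' (lab t) /\ forall x, torus_val (val t) x = psi x (lab t).
Proof.
rewrite /lab; case: xgetP => [l _ //|h].
by have /SigmaP[l al lx] := set_valP t; case: (h l).
Qed.

Let KPtr K : (forall x l, psi (x *~ K.+2) l = 1 /\ psi x (l *~ K.+2) = 1) ->
  forall l x, lattice_char R F^T N (l *~ K.+2) x = 1 /\ lattice_char R F^T N l (x *~ K.+2) = 1.
Proof. by move=> KP l x; rewrite !lattice_char_sym; have [] := KP x l. Qed.

(** The label determines the character; conversely a point of the alcove is determined by its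
    character, by [alcove_unique]. *)
Let lab_bij : set_bij [set: set_type (Sigma R X k)]%classic alc' lab.
Proof.
split=> [t _|t t' _ _ e|l al]; first by have [] := labP t.
  apply/val_inj/val_inj/funext => x.
  by have [_ h] := labP t; have [_ h'] := labP t'; rewrite [LHS]h e -h'.
have chl : is_character (fun x => psi x l).
  by split=> [x|x y]; [apply: expo_neq0 | apply: lattice_charDl].
pose t0 : torus R n :=
  exist (fun t => t \in [set t | is_character t]%classic) (psi^~ l) (mem_set chl).
have St0 : Sigma R X k t0 by apply/SigmaP; exists l.
pose t : set_type (Sigma R X k) := exist (fun t => t \in Sigma R X k) t0 (mem_set St0).
exists t => //.
have [alt' ltx] := labP t.
have [|//] := @alcove_unique R _ _ _ _ _ _ _ _ _ du' (lab t) l 1%:M 1%:M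
  alt' al (weyl1 _) (weyl1 _).
rewrite !mulmx1 => x; rewrite lattice_charDl lattice_charNl !lattice_char_sym.
by rewrite -ltx -expoN -expoD addrN expo0.
Qed.

Let finite_torus : finite_set [set: set_type (Sigma R X k)]%classic.
Proof.
have [K KP] := box_period R du; have finA := finite_alcove du' (KPtr KP).
have : finite_set (lab @^-1` alc')%classic.
  by apply: finite_preimage => // t t' _ _; have [_ inj _] := lab_bij; apply: inj; apply/mem_set.
by apply: sub_finite_set => t _; have [] := labP t.
Qed.

Let ts := finmap.enum_fset (fset_set [set: set_type (Sigma R X k)]%classic).

Let tsP t : t \in ts. Proof. by rewrite in_fset_set //; apply/mem_set. Qed.

Let sum_lab (f : 'rV[int]_n -> R[i]) :
  \sum_(t <- ts) f (lab t) = \sum_(l <- finmap.enum_fset (fset_set alc')) f l.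
Proof.
have [K KP] := box_period R du; have finA := finite_alcove du' (KPtr KP).
have := reindex_fsbig (op := GRing.add) _ _ _ f lab_bij.
by rewrite !fsbig_finite // => ->.
Qed.

Let J_lab x (t : set_type (Sigma R X k)) : J x (val t) = alt (x + rho) (lab t).
Proof.
rewrite /J /alt_sum; apply: eq_fsbigr => w /set_mem Ww.
have [_ ->] := labP t; congr (_ * _).
rewrite -(sign_weyl_length (du_diag du) Ww).
by rewrite rmorphXn rmorphN1.
Qed.

Let J0_neq0 (t : set_type (Sigma R X k)) : J 0 (val t) != 0.
Proof.
by rewrite J_lab add0r; apply: (alt_sum_rho_neq0 R du fd); have [] := labP t.
Qed.

Let card_neq0 : (card_quotient X k)%:R != 0 :> R[i].
Proof.
have [K KP] := box_period R du; rewrite pnatr_eq0 -lt0n.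
have : (0 < #|{: 'rV['I_K.+2]_n}|)%N by apply/card_gt0P; exists 0.
by rewrite -(card_quotient_mul KP) muln_gt0 => /andP[].
Qed.

Let PkP x : Pk X k x -> alc (x + rho).
Proof. by rewrite /alc /= addrK. Qed.

Let alt_orthogonal x y : Pk X k x -> Pk X k y ->
  \sum_(t <- ts) alt (x + rho) (lab t) * Num.conj (alt (y + rho) (lab t)) =
  (x == y)%:R * (card_quotient X k)%:R.
Proof.
move=> /PkP ax /PkP ay; have [K KP] := box_period R du.
have := alt_sum_orthogonal du KP ax ay.
have := card_quotient_mul KP => e; have c0 : (trivial_count R F N K)%:R != 0 :> R[i].
  have : (0 < #|{: 'rV['I_K.+2]_n}|)%N by apply/card_gt0P; exists 0.
  by rewrite -e muln_gt0 pnatr_eq0 -lt0n => /andP[].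
rewrite (sum_lab (fun l => alt (x + rho) l * Num.conj (alt (y + rho) l))).
rewrite -e natrM mulrA mulrC => /(mulIf c0) ->.
by rewrite (inj_eq (addIr rho)).
Qed.

Let Pk_finite : finite_set (Pk X k).
Proof.
have [K KP] := box_period R du; have finA := finite_alcove du KP.
have : finite_set ((fun x => x + rho) @^-1` alc)%classic.
  by apply: finite_preimage => // x y _ _; apply: addIr.
by apply: sub_finite_set => x; apply: PkP.
Qed.

Let Pks := finmap.enum_fset (fset_set (Pk X k)).

(** [alt_sum_orthogonal] for the exchanged lattices, read back through [alt_sum_sym]. *)
Let alt_dual_orthogonal t t' :
  \sum_(x <- Pks) alt (x + rho) (lab t) * Num.conj (alt (x + rho) (lab t')) =
  (t == t')%:R * (card_quotient X k)%:R.
Proof.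
have [K KP] := box_period R du; have finA := finite_alcove du KP.
have [[al _] [al' _]] := (labP t, labP t').
have := alt_sum_orthogonal du' (KPtr KP) al al'; rewrite trivial_count_tr //.
have := card_quotient_mul KP => e; have c0 : (trivial_count R F N K)%:R != 0 :> R[i].
  have : (0 < #|{: 'rV['I_K.+2]_n}|)%N by apply/card_gt0P; exists 0.
  by rewrite -e muln_gt0 pnatr_eq0 -lt0n => /andP[].
rewrite -e natrM mulrA mulrC => /(mulIf c0).
have -> : (lab t == lab t') = (t == t').
  apply/eqP/eqP => [|->//]; have [_ inj _] := lab_bij; apply: inj; exact/mem_set.
move=> <-; have bij : set_bij (Pk X k) alc (fun x => x + rho).
  split=> [x|x y _ _|x ax]; [exact: PkP|exact: addIr|].
  by exists (x - rho); rewrite ?subrK.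
have := reindex_fsbig (op := GRing.add) _ _ _
  (fun x => alt x (lab t) * Num.conj (alt x (lab t'))) bij.
rewrite !fsbig_finite // => <-.
by apply: eq_bigr => x _; rewrite !(alt_sum_sym R du).
Qed.

Local Notation form := (@Rk_form R X k).
Local Notation chi := (@chi R X k).
Local Notation Rk := (set_type (Sigma R X k) -> R[i]).

Let Delta_gt0 (t : set_type (Sigma R X k)) : 0 < Delta (val t).
Proof. by rewrite /Delta exprn_gt0 // normr_gt0. Qed.

Let formE (f g : Rk) : form f g = (card_quotient X k)%:R^-1 *
  \sum_(t <- ts) f t * Num.conj (g t) * Delta (val t).
Proof. by rewrite /Rk_form fsbig_finite. Qed.

(** [Delta] cancels the denominators, reducing the form on characters to alternating sums. *)
Let chi_mul x y t : chi x t * Num.conj (chi y t) * Delta (val t) =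
  alt (x + rho) (lab t) * Num.conj (alt (y + rho) (lab t)).
Proof.
rewrite /chi /Delta normCK -!J_lab rmorphM fmorphV /=.
have z0 := J0_neq0 t; have z0' : Num.conj (J 0 (val t)) != 0 by rewrite conjC_eq0.
by field; rewrite z0 z0'.
Qed.

Let form_linear (f g h : Rk) (a : R[i]) : form (a *: f + g) h = a * form f h + form g h.
Proof.
rewrite !formE [a * (_ * _)]mulrCA -mulrDr; congr (_ * _); rewrite mulr_sumr -big_split /=.
by apply: eq_bigr => t _; rewrite [(a *: f + g) t]/(a * f t + g t); rewrite !mulrDl !mulrA.
Qed.

Let form_hermitian (f g : Rk) : form f g = Num.conj (form g f).
Proof.
rewrite !formE rmorphM rmorph_sum fmorphV rmorph_nat /=; congr (_ * _).
apply: eq_bigr => t _; have /CrealP := gtr0_real (Delta_gt0 t).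
move: (Delta (val t)) => D DE.
by rewrite rmorphM rmorphM /= conjCK DE [f t * _]mulrC.
Qed.

Let form_positive (f : Rk) : f != 0 -> 0 < form f f.
Proof.
move=> f0; have [t ft] : exists t, f t != 0.
  apply: contrapT => h; case/eqP: f0; apply/funext => t.
  by apply: contrapT => ft; apply: h; exists t; apply/eqP.
have t_ge0 s : 0 <= f s * Num.conj (f s) * Delta (val s).
  by rewrite mulr_ge0 ?mul_conjC_ge0 // ltW.
rewrite formE mulr_gt0 //; first by rewrite invr_gt0 lt0r card_neq0 ler0n.
rewrite (big_rem _ (tsP t)) ltr_pwDl ?sumr_ge0 //=.
by apply: mulr_gt0 (Delta_gt0 t); rewrite mul_conjC_gt0.
Qed.

Let chi_orthonormal : is_orthonormal form (Pk X k) chi.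
Proof.
move=> x y Px Py; rewrite formE; under eq_bigr do rewrite chi_mul.
by rewrite alt_orthogonal // mulrCA mulVf ?mulr1.
Qed.

Let sum_chi (c : 'rV[int]_n -> R[i]) (t : set_type (Sigma R X k)) :
  (\sum_(x \in Pk X k) c x *: chi x) t = \sum_(x <- Pks) c x * chi x t.
Proof. by rewrite fsbig_finite // fct_sumE. Qed.

(** Independence follows from orthonormality. For spanning, u is expanded with the coefficients (u,
    chi_x), and column orthogonality collapses the double sum to the value of u at t0. *)
Let chi_basis : is_basis (Pk X k) chi.
Proof.
split=> [c _ c0 y Py|u].
  have form0 : form (\sum_(x \in Pk X k) c x *: chi x) (chi y) = 0.
    by rewrite c0 formE big1 ?mulr0 // => t _; rewrite [0 t]/(0 : R[i]) !mul0r.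
  move: form0; rewrite fsbig_finite // -/Pks.
  have form_sum (r : seq 'rV[int]_n) : form (\sum_(x <- r) c x *: chi x) (chi y) =
      \sum_(x <- r) c x * form (chi x) (chi y).
    elim: r => [|x r IH]; last by rewrite !big_cons form_linear IH.
    by rewrite !big_nil formE big1 ?mulr0 // => t _; rewrite [0 t]/(0 : R[i]) !mul0r.
  have yin : y \in Pks by rewrite in_fset_set //; apply/mem_set.
  rewrite form_sum (bigD1_seq y) ?finmap.fset_uniq //= chi_orthonormal // eqxx mulr1.
  rewrite big1_seq ?addr0 // => x /andP[xy]; rewrite in_fset_set // => /set_mem Px.
  by rewrite chi_orthonormal // (negPf xy) mulr0.
exists (fun x => form u (chi x)).
  by apply: sub_finite_set Pk_finite => x [].
apply/funext => t0; rewrite sum_chi.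
under eq_bigr do rewrite formE -mulrA mulr_suml.
rewrite -mulr_sumr exchange_big /=.
have inner t : \sum_(x <- Pks) u t * Num.conj (chi x t) * Delta (val t) * chi x t0 =
   u t * J 0 (val t) / J 0 (val t0) * ((t0 == t)%:R * (card_quotient X k)%:R).
  rewrite -alt_dual_orthogonal mulr_sumr; apply: eq_bigr => x _.
  rewrite -!J_lab /chi /Delta normCK rmorphM fmorphV /=.
  have z0 := J0_neq0 t; have z0' : Num.conj (J 0 (val t)) != 0 by rewrite conjC_eq0.
  by have := J0_neq0 t0; move=> w0; field; rewrite z0' w0.
under eq_bigr do rewrite inner.
rewrite (bigD1_seq t0) ?tsP ?finmap.fset_uniq //= eqxx big1 => [|t tt0]; last first.
  by rewrite eq_sym (negPf tt0) mul0r mulr0.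
by rewrite mul1r addr0 mulfK ?J0_neq0 // mulrCA mulVf ?mulr1.
Qed.

Lemma inner_product_orthonormal_basis :
  is_inner_product (@Rk_form R X k) /\
  is_orthonormal (@Rk_form R X k) (Pk X k) (@Defs.chi R X k) /\
  is_basis (Pk X k) (@Defs.chi R X k).
Proof. by split; [exact: inner_product_intro | split]. Qed.
End Conclusion.

(** * The normalized form, and the two families of types *)

Lemma pairingE n (u v : 'rV[rat]_n) : pairing u v = (u *m v^T) 0 0.
Proof. by rewrite /pairing mxE; apply: eq_bigr => i _; rewrite mxE. Qed.

Lemma bilin_eq n (B1 B2 : 'M[rat]_n) : (forall x y, bilin B1 x y = bilin B2 x y) -> B1 = B2.
Proof.
move=> e; apply/matrixP=> i j; have := e (delta_mx 0 i) (delta_mx 0 j).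
by rewrite /bilin trmx_delta !mul_delta_col -!rowE !mxE eqxx !mulr1n.
Qed.

Lemma bilin_scale n a (B : 'M[rat]_n) x y : bilin (a *: B) x y = a * bilin B x y.
Proof. by rewrite /bilin -scalemxAr -scalemxAl mxE. Qed.

Lemma gcm_unit n (C : 'M[int]_n) del B :
  finite_datum C del B -> (map_mx intr C : 'M[rat]_n) \in unitmx.
Proof.
move=> fd; rewrite -unitmx_tr -row_free_unit; apply: inj_row_free => v v0.
apply/rowP=> i; rewrite [RHS]mxE; apply: (fd_root_free fd (c := fun i => v 0 i)).
by rewrite -[RHS]v0; apply/rowP=> j; rewrite summxE !mxE; apply: eq_bigr => l _; rewrite !mxE.
Qed.

Section NormalizedForm.
Variables (n : nat) (A : 'M[int]_n) (d m : 'I_n -> int) (r t : int) (c : rat).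
Hypothesis mg : marked_gcm A d m r.
Hypotheses (t0 : 0 < t) (tc : t%:~R * c = (2 * r)%:~R).
Hypothesis t_dvd : forall i j, (d i %| t * A j i)%Z.

Let tQ : t%:~R != 0 :> rat. Proof. by rewrite intr_eq0 lt0r_neq0. Qed.
Let rQ : r%:~R != 0 :> rat. Proof. by rewrite intr_eq0 lt0r_neq0 // (mg_rpos mg). Qed.
Let dQ i : (d i)%:~R != 0 :> rat. Proof. by rewrite intr_eq0 lt0r_neq0 // (mg_dpos mg). Qed.
Let norm : c = (2 * r)%:~R / t%:~R.
Proof. by apply: (mulfI tQ); rewrite tc mulrCA mulfV ?mulr1. Qed.

Lemma normalized_form_exists : exists B, normalized_invariant_form A c B.
Proof.
have [B fd] := mg_datum mg; exists (t%:~R^-1 *: B); split.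
- by rewrite linearZ /= (fd_sym fd).
- by move=> w Ww x y; rewrite !bilin_scale (fd_weyl fd).
by rewrite bilin_scale (highest_rootE mg) (iformE fd) /iform (mg_norm mg) norm mulrC.
Qed.

(** Invariance under s_i gives 2 (x|alpha_i) = x_i (alpha_i|alpha_i). Symmetry and connectedness
    make (alpha_i|alpha_i) proportional to d_i, and the norm of theta fixes the factor 2 / t. So the
    choice made in [form_mx] does not matter. *)
Lemma normalized_form_root B : normalized_invariant_form A c B ->
  forall x i, bilin B x (toQ (simple_root A i)) = (d i)%:~R / t%:~R * x 0 i.
Proof.
move=> [Bsym Binv Bnorm]; have [B0 fd] := mg_datum mg.
pose q i := bilin B (toQ (simple_root A i)) (toQ (simple_root A i)).
have half x i : 2 * bilin B x (toQ (simple_root A i)) = x 0 i * q i.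
  have := Binv _ (weyl_refl A i) x (toQ (simple_root A i)).
  rewrite !(fd_refl) !mxE (mg_diag mg).
  have -> : toQ (simple_root A i) - 2%:~R *: toQ (simple_root A i) = - toQ (simple_root A i).
    by rewrite (_ : 2%:~R = 2 :> rat) // scaler_nat mulr2n opprD addrA subrr add0r.
  by rewrite bilinNr bilinDl bilinNl bilinZl /q => e; lra.
have qsym i j : (A i j)%:~R * q i = (A j i)%:~R * q j.
  have := half (toQ (simple_root A i)) j; have := half (toQ (simple_root A j)) i.
  by rewrite (bilinC _ _ Bsym) !mxE => -> ->.
have [i0 di0] := mg_long mg.
have ratio : forall i, q i / (d i)%:~R == q i0 / (d i0)%:~R.
  apply: (mg_conn mg); first by exists i0.
  move=> i j /eqP <- Aij; have e := qsym i j.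
  have := congr1 (fun z : int => z%:~R : rat) (mg_sym mg i j); rewrite !intrM => e'.
  have Aji : (A j i)%:~R != 0 :> rat.
    apply: contra_neq (_ : (A i j)%:~R != 0 :> rat); rewrite ?intr_eq0 // => z.
    by move: e'; rewrite z mulr0 => /eqP; rewrite mulf_eq0 (negPf (dQ i)) => /eqP.
  have qj : q j = (A i j)%:~R * q i / (A j i)%:~R by rewrite e mulrAC mulfV ?mul1r.
  have dj : (d j)%:~R = (d i)%:~R * (A i j)%:~R / (A j i)%:~R :> rat by rewrite e' mulfK.
  have Aij' : (A i j)%:~R != 0 :> rat by rewrite intr_eq0.
  by rewrite qj dj; apply/eqP; field; rewrite Aij' Aji dQ.
set a := q i0 / (d i0)%:~R in ratio.
have qE i : q i = a * (d i)%:~R by rewrite -(eqP (ratio i)) divfK.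
have aE : a = 2 / t%:~R.
  have : 2 * bilin B (toQ (root_comb A m)) (toQ (root_comb A m)) = a * (2 * r)%:~R.
    rewrite {2}toQ_root_comb bilin_sumr -(mg_norm mg) !mulr_sumr rmorph_sum mulr_sumr /=.
    apply: eq_bigr => i _; rewrite bilinZr mulrCA half qE !intrM mxE; ring.
  rewrite -(highest_rootE mg) Bnorm norm mulrA => e.
  apply: (mulIf (_ : (2 * r)%:~R != 0)); first by rewrite intrM mulf_neq0.
  by rewrite -e mulrAC.
move=> x i; have := half x i; rewrite qE aE => e.
by apply: (mulfI (_ : 2 != 0)) => //; rewrite e; field.
Qed.

Variable F : 'M[rat]_n.
Hypothesis FP : normalized_invariant_form A c F.

Lemma form_root x i : bilin F x (toQ (simple_root A i)) = (d i)%:~R / t%:~R * x 0 i.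
Proof. exact: normalized_form_root FP x i. Qed.

Lemma form_sym : F^T = F.
Proof. by have [] := FP. Qed.

(** Row i is t alpha_i / d_i, the image of alpha_i^vee under kappa, so the rows span M; the
    divisibility hypothesis makes them integral. *)
Definition scaled_roots : 'M[int]_n := \matrix_(i, j) (t * A j i %/ d i)%Z.
Local Notation G := scaled_roots.

Lemma scaled_rootsE i j : G i j * d i = t * A j i.
Proof. by rewrite mxE divzK. Qed.

Lemma scaled_roots_form : map_mx intr G *m F = 1%:M.
Proof.
apply/matrixP=> i j; have rowG : delta_mx 0 i *m map_mx intr G =
    (t%:~R / (d i)%:~R) *: toQ (simple_root A i) :> 'rV[rat]_n.
  rewrite -rowE; apply/rowP=> l; rewrite mxE [LHS]mxE [RHS]mxE !mxE.
  apply: (mulIf (dQ i)); rewrite mulrAC divfK //.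
  by have := scaled_rootsE i l; rewrite mxE -!intrM => ->.
have -> : (map_mx intr G *m F) i j = bilin (map_mx intr G *m F) (delta_mx 0 i) (delta_mx 0 j).
  by rewrite /bilin trmx_delta mul_delta_col -rowE !mxE eqxx mulr1n.
have -> : bilin (map_mx intr G *m F) (delta_mx 0 i) (delta_mx 0 j) =
    bilin F (delta_mx 0 i *m map_mx intr G) (delta_mx 0 j).
  by rewrite /bilin !mulmxA.
rewrite rowG bilinZl (bilinC _ _ form_sym) form_root !mxE eqxx /=.
by rewrite mulrA [_ * (_ / _)]mulrA divfK // mulfV // mul1r eq_sym.
Qed.

Lemma form_simple_refl i : map_mx intr (simple_refl A i) *m F =
  F *m (map_mx intr (simple_refl A i))^T.
Proof.
apply: bilin_eq => x y.
have -> : bilin (map_mx intr (simple_refl A i) *m F) x y =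
    bilin F (x *m map_mx intr (simple_refl A i)) y by rewrite /bilin !mulmxA.
have -> : bilin (F *m (map_mx intr (simple_refl A i))^T) x y =
    bilin F x (y *m map_mx intr (simple_refl A i)) by rewrite /bilin trmx_mul !mulmxA.
rewrite !fd_refl !(bilinDl, bilinDr, bilinNl, bilinNr, bilinZl, bilinZr).
rewrite (bilinC (toQ (simple_root A i)) y form_sym) !form_root; ring.
Qed.
End NormalizedForm.

Section Levels.
Variables (n : nat) (h k : nat) (t : int) (c : 'I_n -> int).
Hypothesis t0 : 0 < t.
Hypothesis t_dvd : forall i, (t %| c i)%Z.
Hypothesis c_sum : \sum_i c i + t = t * h%:Z.

(* [rho] has level [h - 1], which turns [<=] at level [k] into [<] at [k + h].  *)
Lemma shifted_level (x : 'rV[int]_n) :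
  dominant (x - sum_fundamental n) /\
    \sum_i c i * (x - sum_fundamental n) 0 i <= t * k%:Z <->
  (forall i, 0 < x 0 i) /\ \sum_i c i * x 0 i < t * (k + h)%N%:Z.
Proof.
have sE : \sum_i c i * (x - sum_fundamental n) 0 i = \sum_i c i * x 0 i - \sum_i c i.
  by rewrite -sumrB; apply: eq_bigr => i _; rewrite !mxE mulrBr mulr1.
have : (t %| \sum_i c i * x 0 i)%Z by rewrite rpred_sum // => i _; rewrite dvdz_mulr.
rewrite sE PoszD => /dvdzP[q ->].
have -> : \sum_i c i = t * h%:Z - t by rewrite -c_sum addrK.
have e : (q * t - (t * h%:Z - t) <= t * k%:Z) = (q * t < t * (k%:Z + h%:Z)).
  rewrite [q * t]mulrC (_ : t * q - (t * h%:Z - t) = t * (q - h%:Z + 1)); last by ring.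
  by rewrite ler_pM2l // ltr_pM2l //; lia.
rewrite e; split=> -[dom ->]; split=> // i; have := dom i.
  by rewrite /sum_fundamental !mxE; move: (x 0 i) => z; lia.
by rewrite /sum_fundamental !mxE; move: (x 0 i) => z; lia.
Qed.
End Levels.

(** Both lattices are P, paired by the normalized form, with one alcove on both sides. The matrix
    diag(d) maps weights to coweights, where theta bounds the alcove at t N. *)
Lemma untwisted_orthonormal_basis (R : realType) (X : affine_type) (k : nat) :
  untwisted_or_Aeven X ->
  is_inner_product (@Rk_form R X k) /\
  is_orthonormal (@Rk_form R X k) (Pk X k) (@Defs.chi R X k) /\
  is_basis (Pk X k) (@Defs.chi R X k).
Proof.
move=> uX; have [d [m [r [t [mg t0 tc [t_dvd t_dvd'] hsum]]]]] := untwisted_marks_exist uX.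
have FP : normalized_invariant_form (cartan X) (theta_norm X) (form_mx X).
  exact: xgetPex (normalized_form_exists mg t0 tc).
have Froot := form_root mg t0 tc FP; have Fsym := form_sym FP.
pose G := scaled_roots (cartan X) d t.
have GF : map_mx intr G *m form_mx X = 1%:M := scaled_roots_form mg t0 tc t_dvd FP.
have FG : form_mx X *m (map_mx intr G)^T = 1%:M.
  by rewrite -Fsym -trmx_mul GF trmx1.
have [B fd] := mg_datum mg.
have h0 : (0 < dual_coxeter X)%N.
  rewrite -ltz_nat -(pmulr_rgt0 _ t0) -hsum ltr_wpDl // sumr_ge0 // => i _.
  by rewrite mulr_ge0 // ltW // ?(mg_mpos mg) ?(mg_dpos mg).
have N0 : (0 < k + dual_coxeter X)%N by rewrite addn_gt0 h0 orbT.
pose alc : set 'rV[int]_(affine_rank X) := [set x | Pk X k (x - sum_fundamental _)]%classic.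
have levE x : pairing (toQ x) (theta_check X) = (\sum_i m i * d i * x 0 i)%:~R / t%:~R.
  rewrite /theta_check uX /kappa_inv /theta (highest_rootE mg) pairingE trmx_mul Fsym mulmxA.
  rewrite -[LHS]/(bilin (form_mx X) (toQ x) (toQ (root_comb (cartan X) m))).
  rewrite toQ_root_comb bilin_sumr rmorph_sum mulr_suml; apply: eq_bigr => i _ /=.
  by rewrite bilinZr Froot !intrM mxE; ring.
have alcP x : alc x <-> (forall i, 0 < x 0 i) /\
    \sum_i m i * d i * x 0 i < t * (k + dual_coxeter X)%N%:Z.
  apply: iff_trans (shifted_level k t0 t_dvd' hsum x).
  rewrite /alc /Pk /= levE ler_pdivrMr ?ltr0z //.
  by rewrite -[k%:R]/(k%:Z%:~R) -intrM ler_int [k%:Z * t]mulrC.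
have aA : alcove_data (cartan X) G (k + dual_coxeter X)%N alc.
  apply: (pullback_alcove mg _ t0 (mg_dpos mg)) alcP; first by rewrite ltz_nat.
  - by move=> i j; rewrite mulrC (mg_sym mg).
  move=> i j; apply: (mulIf (lt0r_neq0 (mg_dpos mg i))).
  rewrite mulrAC scaled_rootsE // -!mulrA; congr (_ * _).
  by rewrite mulrC (mg_sym mg) mulrC.
have du : duality (cartan X) (cartan X) (form_mx X) G G (k + dual_coxeter X) alc alc.
  split=> //; try exact: (mg_diag mg); try exact: (fd_weyl_finite fd).
  by move=> i; apply: (form_simple_refl mg t0 tc FP).
apply: (inner_product_orthonormal_basis du fd) => [T|q].
  rewrite /Sigma uX; split=> [[l Pl lx]|[l al lx]].
    exists (sum_fundamental _ + l); first by rewrite /alc /= addrC addKr.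
    by move=> x; rewrite lx /lattice_char [in RHS]bilinC.
  exists (l - sum_fundamental _) => // x.
  by rewrite lx addrC subrK /lattice_char [in LHS]bilinC.
rewrite /latM uX; have invF : invmx (form_mx X) = map_mx intr G.
  have [uG uF] := mulmx1_unit GF.
  by rewrite -[RHS]mulmx1 -(mulmxV uF) mulmxA GF mul1mx.
split=> [[_ [c _ <-] <-]|[c ->]].
  by exists c; rewrite /kappa invF toQM.
by exists (toQ c); [exists c | rewrite /kappa invF toQM].
Qed.

Lemma root_comb_mx n (A : 'M[int]_n) c : root_comb A c = (\row_i c i) *m A^T.
Proof. by apply/rowP=> i; rewrite root_combE !mxE; apply: eq_bigr => j _; rewrite !mxE mulrC. Qed.

Section CoweightForm.
Variables (n : nat) (A : 'M[int]_n).
Let AQ : 'M[rat]_n := map_mx intr A.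
Hypothesis AU : AQ \in unitmx.

Lemma coweight_root_comb c : coweight A (root_comb A^T c) = toQ (\row_i c i).
Proof. by rewrite /coweight root_comb_mx trmxK toQM mulmxK. Qed.

Lemma pairing_root_comb c (l : 'rV[int]_n) :
  pairing (toQ (root_comb A c)) (coweight A l) = (\sum_i c i * l 0 i)%:~R.
Proof.
rewrite pairingE root_comb_mx toQM /coweight trmx_mul mulmxA -[_ *m (invmx _)^T]mulmxA.
rewrite -map_trmx -trmx_mul mulVmx // trmx1 mulmx1 mxE rmorph_sum.
by apply: eq_bigr => i _; rewrite /= !mxE intrM.
Qed.

Lemma coweight_simple_refl i : map_mx intr (simple_refl A i) *m (invmx AQ)^T =
  (invmx AQ)^T *m (map_mx intr (simple_refl A^T i))^T.
Proof.
have rootE (C : 'M[int]_n) : simple_root C i = delta_mx 0 i *m C^T.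
  by rewrite -rowE; apply/rowP=> j; rewrite !mxE.
rewrite /simple_refl !rootE trmxK !map_mxB !map_mx1 !map_mxM -map_trmx mulmxBl mul1mx.
rewrite linearB /= trmx1 mulmxBr mulmx1 -/AQ; congr (_ - _).
rewrite !map_delta_mx !trmx_mul !trmx_delta !mulmxA -trmx_mul.
rewrite -[delta_mx i 0 *m _ *m _ *m _]mulmxA -trmx_mul mulVmx // trmx1 mulmx1.
by rewrite mulmxV // trmx1 mul1mx.
Qed.
End CoweightForm.

Lemma twisted_orthonormal_basis (R : realType) (X : affine_type) (k : nat) :
  ~~ untwisted_or_Aeven X ->
  is_inner_product (@Rk_form R X k) /\
  is_orthonormal (@Rk_form R X k) (Pk X k) (@Defs.chi R X k) /\
  is_basis (Pk X k) (@Defs.chi R X k).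
Proof.
move=> tX; have uX := negPf tX.
have [[d [m [r [mg msum]]]] [d' [m' [r' [mg' msum']]]]] := twisted_marks_exist tX.
have [B fd] := mg_datum mg; have [B' fd'] := mg_datum mg'.
have AU := gcm_unit fd; set A := cartan X in mg mg' fd fd' AU.
set AQ : 'M[rat]_ _ := map_mx intr A in AU.
have h0 : (0 < dual_coxeter X)%N.
  by rewrite -ltz_nat -msum ltr_wpDl // sumr_ge0 // => i _; rewrite ltW // (mg_mpos mg).
have N0 : 0 < (k + dual_coxeter X)%N%:Z by rewrite ltz_nat addn_gt0 h0 orbT.
pose rho := sum_fundamental (affine_rank X).
pose alc : set 'rV[int]_(affine_rank X) := [set x | Pk X k (x - rho)]%classic.
pose alc' : set 'rV[int]_(affine_rank X) := [set x | Pk_check X k (x - rho)]%classic.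
have levelP (c : 'I_(affine_rank X) -> int) (x : 'rV[int]_(affine_rank X)) :
    \sum_i c i + 1 = (dual_coxeter X)%:Z ->
    dominant (x - rho) /\ (\sum_i c i * (x - rho) 0 i)%:~R <= k%:R :> rat <->
    (forall i, 0 < x 0 i) /\ \sum_i c i * 1 * x 0 i < 1 * (k + dual_coxeter X)%N%:Z.
  move=> csum; have csum' : \sum_i c i + 1 = 1 * (dual_coxeter X)%:Z by rewrite mul1r.
  have := shifted_level (t := 1) k isT (fun i => dvd1z (c i)) csum' x.
  rewrite [1 * k%:Z]mul1r -[k%:R]/(k%:Z%:~R) ler_int.
  by have -> : \sum_i c i * 1 * x 0 i = \sum_i c i * x 0 i by apply: eq_bigr => i _; rewrite mulr1.
have aA : alcove_data A A^T (k + dual_coxeter X)%N alc.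
  apply: (pullback_alcove (e := fun=> 1) (t := 1) mg' N0) => //.
  - by move=> i j; rewrite mulr1 mul1r [RHS]mxE.
  - by move=> i j; rewrite mulr1 mul1r.
  move=> x; apply: iff_trans (levelP m' x msum').
  rewrite /alc /Pk /= /theta_check uX /highest_coroot (highest_rootE mg').
  rewrite coweight_root_comb // /pairing rmorph_sum /=.
  by under eq_bigr => i _ do rewrite ![toQ _ 0 _]mxE [(\row__ _) 0 _]mxE -intrM mulrC.
have aA' : alcove_data A^T A (k + dual_coxeter X)%N alc'.
  apply: (pullback_alcove (e := fun=> 1) (t := 1) mg N0) => //.
  - by move=> i j; rewrite mulr1 mul1r [LHS]mxE.
  - by move=> i j; rewrite mulr1 mul1r.
  move=> x; apply: iff_trans (levelP m x msum).
  by rewrite /alc' /Pk_check /= /theta (highest_rootE mg) pairing_root_comb.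
have du : duality A A^T (invmx AQ)^T A^T A (k + dual_coxeter X) alc alc'.
  split=> //.
  - exact: mg_diag mg.
  - exact: mg_diag mg'.
  - exact: coweight_simple_refl.
  - by rewrite -map_trmx -trmx_mul mulVmx ?trmx1.
  - by rewrite -trmx_mul mulmxV ?trmx1.
  - exact: fd_weyl_finite fd.
  - exact: fd_weyl_finite fd'.
have charE x l : pairing (toQ x) (coweight A l) = bilin (invmx AQ)^T (toQ x) (toQ l).
  by rewrite pairingE /coweight trmx_mul /bilin mulmxA.
apply: (inner_product_orthonormal_basis du fd) => [T|q].
  rewrite /Sigma uX; split=> [[l Pl lx]|[l al lx]].
    exists (rho + l); first by rewrite /alc' /= addrC addKr.
    by move=> x; rewrite lx /lattice_char -charE.
  exists (l - rho) => // x.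
  by rewrite lx [rho + _]addrC subrK /lattice_char -charE.
rewrite /latM uX; split=> [[x [c ->] <-]|[c ->]].
  by exists (\row_i c i); rewrite -root_comb_mx.
exists (c *m A^T) => //; exists (fun i => c 0 i).
by rewrite -[RHS]/(root_comb A _) root_comb_mx; congr (_ *m _); apply/rowP=> i; rewrite mxE.
Qed.

Theorem theorem2p1 (R : realType) (X : affine_type) (k : nat) :
  is_inner_product (@Rk_form R X k) /\
  is_orthonormal (@Rk_form R X k) (Pk X k) (@chi R X k) /\
  is_basis (Pk X k) (@chi R X k).
Proof.
case uX : (untwisted_or_Aeven X); first exact: untwisted_orthonormal_basis.
by apply: twisted_orthonormal_basis; rewrite uX.
Qed.
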